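(* Let $G$ be a countable group acting on a Lebesgue space $(X,\Sigma,\mu)$, and assume that the action is ergodic, measure-preserving and perfectly non-free. Let $\mathcal R\subset X\times X$ be the corresponding orbit equivalence relation and let $\pi$ be the associated groupoid representation of $G$ in $L^2(\mathcal R,\nu)$. Then $\mathcal M_{\mathcal R}=\mathcal M_\pi$, and the character $\chi(g)=\mu(\mathrm{Fix}(g))$, $g\in G$, is indecomposable.
   Context: A Lebesgue space is a standard probability space, i.e. (modulo null sets) a probability space isomorphic to an interval with Lebesgue measure, a finite or countable set of atoms, or a disjoint union of both. For a measure-preserving automorphism $g$ of $X$ put $\mathrm{Fix}(g)=\{x\in X: gx=x\}$ and $\mathrm{supp}(g)=X\setminus \mathrm{Fix}(g)$ (defined modulo null sets). For measurable $A\subset X$ put $G_A=\{g\in G:\mu(\mathrm{supp}(g)\setminus A)=0\}$. Perfectly non-free: a measure-preserving action of a countable group $G$ on a Lebesgue space $(X,\Sigma,\mu)$ is perfectly non-free if there is a collection $\mathcal A$ of measurable subsets of $X$ such that $\mathcal A$ together with the sets of measure zero generates the sigma-algebra $\Sigma$, and for each $A\in\mathcal A$ the orbit $\{gx:g\in G_A\}$ is infinite for $\mu$-almost all $x\in A$. Groupoid representation: $\mathcal R=\{(x,y)\in X^2: y\in Gx\}$, equipped with the measure $\nu(B)=\int_X |B\cap (X\times\{x\})|\,d\mu(x)$ ($|\cdot|$ denotes cardinality). The (left) groupoid representation $\pi$ of $G$ in $L^2(\mathcal R,\nu)$ is $(\pi(g)f)(x,y)=f(g^{-1}x,y)$. $\mathcal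 M_\pi$ is the von Neumann algebra generated by the operators $\pi(g)$, $g\in G$. For $m\in L^\infty(X,\mu)$ let $m_l$ be the operator on $L^2(\mathcal R,\nu)$ given by $(m_lf)(x,y)=m(x)f(x,y)$. $\mathcal M_{\mathcal R}$ is the von Neumann algebra generated by $\mathcal M_\pi$ and all the operators $m_l$, $m\in L^\infty(X,\mu)$. A character on $G$ is a function $\chi:G\to\mathbb C$ such that $\chi(g_1g_2)=\chi(g_2g_1)$ for all $g_1,g_2\in G$, the matrix $(\chi(g_ig_j^{-1}))_{i,j=1}^n$ is positive semi-definite for all $n\ge1$ and $g_1,\dots,g_n\in G$, and $\chi(e)=1$. It is indecomposable if it cannot be written as $\chi=\alpha\chi_1+(1-\alpha)\chi_2$ with $0<\alpha<1$ and $\chi_1,\chi_2$ distinct characters. The function $g\mapsto\mu(\mathrm{Fix}(g))$ is always a character for a measure-preserving action. *)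

(* Defs.v *)
From HB Require Import structures.
From mathcomp Require Import all_boot all_order all_algebra.
From mathcomp Require Import all_classical all_reals all_analysis.
From mathcomp Require Import measurable_realfun complex.
From mathcomp Require Import ring lra.
Set Implicit Arguments.
Unset Strict Implicit.
Unset Printing Implicit Defensive.
Import Order.TTheory GRing.Theory Num.Theory.
Import numFieldNormedType.Exports.
Local Open Scope classical_set_scope.
Local Open Scope ring_scope.

Section complex_L2.
Context d (T : measurableType d) (R : realType) (nu : {measure set T -> \bar R}).
Local Notation C := R[i].

Definition sqnormc (z : C) : R := Normc.normc z ^+ 2.

Definition measurable_funC (f : T -> C) : Prop :=
  measurable_fun setT (fun x => complex.Re (f x)) /\
  measurable_fun setT (fun x => complex.Im (f x)).

Definition square_integrable (f : T -> C) : Prop :=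
  measurable_funC f /\ (\int[nu]_x (sqnormc (f x))%:E < +oo)%E.

Let normc2 (z : C) : sqnormc z = complex.Re z ^+ 2 + complex.Im z ^+ 2.
Proof. by case: z => a b; rewrite /sqnormc /= sqr_sqrtr// addr_ge0 ?sqr_ge0. Qed.

Let sqnormc_ge0 (z : C) : 0 <= sqnormc z.
Proof. exact: sqr_ge0. Qed.

Lemma measurable_sqnormc f : measurable_funC f ->
  measurable_fun setT (fun x => (sqnormc (f x))%:E).
Proof.
move=> [mr mi]; apply/measurable_EFinP.
rewrite (_ : (fun x => _) = (fun x => complex.Re (f x) ^+ 2 + complex.Im (f x) ^+ 2)).
  by apply: measurable_funD; apply: measurable_funX.
by apply/funext => x; rewrite normc2.
Qed.

Lemma measurable_funCD f g : measurable_funC f -> measurable_funC g ->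
  measurable_funC (fun x => f x + g x).
Proof.
move=> [fr fi] [gr gi]; split.
  rewrite (_ : (fun x => _) = (fun x => complex.Re (f x) + complex.Re (g x))).
    exact: measurable_funD.
  by apply/funext => x; case: (f x); case: (g x).
rewrite (_ : (fun x => _) = (fun x => complex.Im (f x) + complex.Im (g x))).
  exact: measurable_funD.
by apply/funext => x; case: (f x); case: (g x).
Qed.

Lemma measurable_funCM f g : measurable_funC f -> measurable_funC g ->
  measurable_funC (fun x => f x * g x).
Proof.
move=> [fr fi] [gr gi]; split.
  rewrite (_ : (fun x => _) = (fun x => complex.Re (f x) * complex.Re (g x) -
    complex.Im (f x) * complex.Im (g x))).
    by apply: measurable_funB; apply: measurable_funM.
  by apply/funext => x; case: (f x); case: (g x).
rewrite (_ : (fun x => _) = (fun x => complex.Re (f x) * complex.Im (g x) +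
    complex.Im (f x) * complex.Re (g x))).
  by apply: measurable_funD; apply: measurable_funM.
by apply/funext => x; case: (f x); case: (g x).
Qed.

Lemma measurable_funC_conj f : measurable_funC f -> measurable_funC (fun x => (f x)^*).
Proof.
move=> [fr fi]; split.
  rewrite (_ : (fun x => _) = (fun x => complex.Re (f x)))//.
  by apply/funext => x; case: (f x).
rewrite (_ : (fun x => _) = (fun x => - complex.Im (f x))).
  exact: measurableT_comp.
by apply/funext => x; case: (f x).
Qed.

Lemma square_integrable0 : square_integrable (fun=> 0).
Proof.
split; first by split; exact: measurable_cst.
rewrite integral0_eq ?ltry// => x _.
by rewrite /sqnormc Normc.normc0 expr0n.
Qed.

Lemma square_integrableD f g : square_integrable f -> square_integrable g ->
  square_integrable (fun x => f x + g x).
Proof.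
move=> [mf lf] [mg lg]; split; first exact: measurable_funCD.
have mfg := measurable_sqnormc (measurable_funCD mf mg).
apply: (@le_lt_trans _ _ (\int[nu]_x (2%:E * (sqnormc (f x))%:E +
   2%:E * (sqnormc (g x))%:E)))%E.
  apply: ge0_le_integral.
  - exact: measurableT.
  - by move=> x _; rewrite lee_fin.
  - exact: mfg.
  - by apply: emeasurable_funD; apply: measurable_funeM; exact: measurable_sqnormc.
  - move=> x _; rewrite -!EFinM -EFinD lee_fin.
    case: (f x) => a b; case: (g x) => a' b'.
    rewrite !normc2 /=.
    have := sqr_ge0 (a - a'); have := sqr_ge0 (b - b').
    by nra.
have mf2 := measurable_sqnormc mf; have mg2 := measurable_sqnormc mg.
have ge0 h x : setT x -> (0 <= 2%:E * (sqnormc (h x))%:E :> \bar R)%E.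
  by move=> _; rewrite mule_ge0// lee_fin.
rewrite ge0_integralD//; [|exact: ge0|exact: measurable_funeM|exact: ge0
  |exact: measurable_funeM].
rewrite !ge0_integralZl//; try by move=> x _; rewrite lee_fin.
by rewrite lte_add_pinfty// lte_mul_pinfty.
Qed.

Lemma square_integrableZ (c : C) f : square_integrable f ->
  square_integrable (fun x => c * f x).
Proof.
move=> [mf lf]; split.
  by apply: measurable_funCM => //; split; exact: measurable_cst.
under eq_integral do rewrite {1}/sqnormc Normc.normcM exprMn EFinM.
have c0 : (0 <= (sqnormc c)%:E :> \bar R)%E by rewrite lee_fin.
rewrite ge0_integralZl//; first by rewrite lte_mul_pinfty.
- exact: (measurable_sqnormc mf).
- by move=> x _; rewrite lee_fin sqr_ge0.
Qed.

(* [L2 nu] is the complex Hilbert space L^2(nu): square-integrable functions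
   modulo equality nu-almost everywhere. *)
Definition L2fun := {f : T -> C | `[< square_integrable f >]}.
Definition L2eq (f g : L2fun) := `[< {ae nu, forall x, val f x = val g x} >].

Let L2eq_refl : reflexive L2eq.
Proof. by move=> f; apply/asboolP; exact/aeW. Qed.
Let L2eq_sym : symmetric L2eq.
Proof.
by move=> f g; apply/asboolP/asboolP; apply: filterS => x ->.
Qed.
Let L2eq_trans : transitive L2eq.
Proof.
move=> g f h /asboolP fg /asboolP gh; apply/asboolP.
by move: fg gh; apply: filterS2 => x -> ->.
Qed.

Canonical L2eq_equiv := EquivRel L2eq L2eq_refl L2eq_sym L2eq_trans.

Definition L2 : Type := {eq_quot L2eq}%qT.
HB.instance Definition _ := Choice.on L2.
HB.instance Definition _ := EqQuotient.on L2.
Definition L2_to_fun (u : L2) : T -> C := val (repr u).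
Coercion L2_to_fun : L2 >-> Funclass.

Lemma L2P (u : L2) : square_integrable u.
Proof. by have /asboolP := valP (repr u). Qed.

Definition L2class f (hf : square_integrable f) : L2 :=
  \pi_L2%qT (exist _ f (introT (asboolP _) hf) : L2fun).

Lemma L2classE f (hf : square_integrable f) :
  {ae nu, forall x, L2class hf x = f x}.
Proof. by have /eqmodP/asboolP := reprK (L2class hf). Qed.

Lemma L2_eqP (u v : L2) : u = v <-> {ae nu, forall x, u x = v x}.
Proof.
split=> [->|uv]; first exact/aeW.
by rewrite -[u]reprK -[v]reprK; apply/eqmodP; exact/asboolP.
Qed.

Definition L2_zero : L2 := L2class square_integrable0.
Definition L2_add (u v : L2) : L2 :=
  L2class (square_integrableD (L2P u) (L2P v)).
Definition L2_scale (c : C) (u : L2) : L2 :=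
  L2class (square_integrableZ c (L2P u)).

Let L2_addE u v : {ae nu, forall x, L2_add u v x = u x + v x}.
Proof. exact: L2classE. Qed.
Let L2_scaleE c u : {ae nu, forall x, L2_scale c u x = c * u x}.
Proof. exact: L2classE. Qed.

Let L2_addA : associative L2_add.
Proof.
move=> u v w; apply/L2_eqP.
apply: filterS2 (filterI (L2_addE u (L2_add v w)) (L2_addE v w))
  (filterI (L2_addE (L2_add u v) w) (L2_addE u v)) => x [-> ->] [-> ->].
by rewrite addrA.
Qed.

Let L2_addC : commutative L2_add.
Proof.
move=> u v; apply/L2_eqP.
have := L2_addE u v; have := L2_addE v u.
by apply: filterS2 => x h1 h2; rewrite h1 h2 addrC.
Qed.

Let L2_add0 : left_id L2_zero L2_add.
Proof.
move=> u; apply/L2_eqP.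
have := L2_addE L2_zero u; have := L2classE square_integrable0.
by apply: filterS2 => x h1 h2; rewrite h2 h1 add0r.
Qed.

Let L2_addN : left_inverse L2_zero (L2_scale (-1)) L2_add.
Proof.
move=> u; apply/L2_eqP.
have := L2_addE (L2_scale (-1) u) u; have := L2classE square_integrable0.
have := L2_scaleE (-1) u.
by apply: filterS3 => x h1 h2 h3; rewrite h3 h1 h2 mulN1r addNr.
Qed.

HB.instance Definition _ :=
  GRing.isZmodule.Build L2 L2_addA L2_addC L2_add0 L2_addN.

Let L2_scaleA a b u : L2_scale a (L2_scale b u) = L2_scale (a * b) u.
Proof.
apply/L2_eqP; have := L2_scaleE (a * b) u; have := L2_scaleE b u.
have := L2_scaleE a (L2_scale b u).
by apply: filterS3 => x h1 h2 h3; rewrite h3 h1 h2 mulrA.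
Qed.

Let L2_scale1 : left_id 1 L2_scale.
Proof.
move=> u; apply/L2_eqP; have := L2_scaleE 1 u.
by apply: filterS => x ->; rewrite mul1r.
Qed.

Let L2_scaleDr : right_distributive L2_scale +%R.
Proof.
move=> a u v; apply/L2_eqP.
apply: filterS3 (filterI (L2_scaleE a (L2_add u v)) (L2_addE u v))
  (L2_addE (L2_scale a u) (L2_scale a v))
  (filterI (L2_scaleE a u) (L2_scaleE a v)) => x [h1 h2] h3 [h4 h5].
by rewrite [LHS]h1 [RHS]h3 h2 h4 h5 mulrDr.
Qed.

Let L2_scaleDl u : {morph L2_scale^~ u : a b / a + b}.
Proof.
move=> a b; apply/L2_eqP.
apply: filterS3 (L2_scaleE (a + b) u) (L2_addE (L2_scale a u) (L2_scale b u))
  (filterI (L2_scaleE a u) (L2_scaleE b u)) => x h1 h2 [h3 h4].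
by rewrite [LHS]h1 [RHS]h2 h3 h4 mulrDl.
Qed.

HB.instance Definition _ := GRing.Zmodule_isLmodule.Build C L2
  L2_scaleA L2_scale1 L2_scaleDr L2_scaleDl.

Lemma L2_addrE (u v : L2) : {ae nu, forall x, (u + v : L2) x = u x + v x}.
Proof. exact: L2_addE. Qed.

Lemma L2_scalerE (c : C) (u : L2) : {ae nu, forall x, (c *: u : L2) x = c * u x}.
Proof. exact: L2_scaleE. Qed.

Definition integralC (f : T -> C) : C :=
  Complex (\int[nu]_x complex.Re (f x)) (\int[nu]_x complex.Im (f x)).

Definition integrableC (f : T -> C) : Prop :=
  nu.-integrable setT (fun x => (complex.Re (f x))%:E) /\
  nu.-integrable setT (fun x => (complex.Im (f x))%:E).

(* Linear in the first argument, as required by [{dot _ for _}]. *)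
Definition L2dot (u v : L2) : C := integralC (fun x => u x * (v x)^*).

Let integralCD f g : integrableC f -> integrableC g ->
  integralC (fun x => f x + g x) = integralC f + integralC g.
Proof.
move=> [fr fi] [gr gi]; rewrite /integralC.
apply/eqP; rewrite eq_complex /=; apply/andP; split; apply/eqP.
  rewrite -RintegralD//; apply: eq_Rintegral => x _.
  by case: (f x); case: (g x).
rewrite -RintegralD//; apply: eq_Rintegral => x _.
by case: (f x); case: (g x).
Qed.

Let integralCZ c f : integrableC f ->
  integralC (fun x => c * f x) = c * integralC f.
Proof.
case: c => a b [fr fi]; rewrite /integralC.
have Z r h : nu.-integrable setT (fun x => (h x)%:E) ->
  nu.-integrable setT (fun x => (r * h x)%:E).
  by move=> ih; apply: (integrableZl measurableT r ih).
apply/eqP; rewrite eq_complex /=; apply/andP; split; apply/eqP.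
  rewrite -!RintegralZl// -RintegralB//; [|exact: Z..].
  by apply: eq_Rintegral => x _; case: (f x).
rewrite -!RintegralZl// -RintegralD//; [|exact: Z..].
by apply: eq_Rintegral => x _; case: (f x).
Qed.

Let integralC_conj f : integrableC f ->
  integralC (fun x => (f x)^*) = (integralC f)^*.
Proof.
move=> [fr fi]; rewrite /integralC.
apply/eqP; rewrite eq_complex /=; apply/andP; split; apply/eqP.
  by apply: eq_Rintegral => x _; case: (f x).
rewrite -mulN1r -RintegralZl//; apply: eq_Rintegral => x _.
by rewrite mulN1r; case: (f x).
Qed.

Let ae_integralC f g : measurable_funC f -> measurable_funC g ->
  {ae nu, forall x, f x = g x} -> integralC f = integralC g.
Proof.
move=> [fr fi] [gr gi] fg; rewrite /integralC /Rintegral.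
congr Complex; congr fine; apply: ae_eq_integral => //.
- exact/measurable_EFinP.
- exact/measurable_EFinP.
- by apply: filterS fg => x ->.
- exact/measurable_EFinP.
- exact/measurable_EFinP.
- by apply: filterS fg => x ->.
Qed.

Let measurable_dot (u v : L2) : measurable_funC (fun x => u x * (v x)^*).
Proof.
have [mu _] := L2P u; have [mv _] := L2P v.
by apply: measurable_funCM => //; exact: measurable_funC_conj.
Qed.

Let integrable_sqnormc (u : L2) :
  nu.-integrable setT (fun x => (sqnormc (u x))%:E).
Proof.
have [mu iu] := L2P u; apply/integrableP; split; first exact: measurable_sqnormc.
by under eq_integral do rewrite gee0_abs ?lee_fin//.
Qed.

Lemma integrable_dot (u v : L2) : integrableC (fun x => u x * (v x)^*).
Proof.
have [mr mi] := measurable_dot u v.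
have i2 := integrableD measurableT (integrable_sqnormc u) (integrable_sqnormc v).
split; apply: le_integrable i2 => //; try exact/measurable_EFinP;
  move=> x _; rewrite -EFinD !abse_EFin lee_fin [leRHS]ger0_norm ?addr_ge0//;
  rewrite !normc2; case: (u x) => a b; case: (v x) => a' b' /=.
- have := sqr_ge0 (a - a'); have := sqr_ge0 (b - b').
  have := sqr_ge0 (a + a'); have := sqr_ge0 (b + b').
  by rewrite ler_norml => *; apply/andP; split; nra.
- have := sqr_ge0 (a - b'); have := sqr_ge0 (b - a').
  have := sqr_ge0 (a + b'); have := sqr_ge0 (b + a').
  by rewrite ler_norml => *; apply/andP; split; nra.
Qed.

Let integrableC_Z c f : integrableC f -> integrableC (fun x => c * f x).
Proof.
case: c => a b [fr fi].
have Z r h : nu.-integrable setT (fun x => (h x)%:E) ->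
  nu.-integrable setT (fun x => (r * h x)%:E).
  by move=> ih; apply: (integrableZl measurableT r ih).
split.
  rewrite (_ : (fun x => _) = fun x => ((a * complex.Re (f x))%:E -
    (b * complex.Im (f x))%:E)%E).
    by apply: integrableB => //; exact: Z.
  by apply/funext => x; case: (f x).
rewrite (_ : (fun x => _) = fun x => ((a * complex.Im (f x))%:E +
  (b * complex.Re (f x))%:E)%E).
  by apply: integrableD => //; exact: Z.
by apply/funext => x; case: (f x).
Qed.

Let L2dot_linearl (v : L2) : linear_for *%R (L2dot^~ v).
Proof.
move=> c u w; rewrite /L2dot -integralCZ; last exact: integrable_dot.
rewrite -integralCD; [|exact/integrableC_Z/integrable_dot|exact: integrable_dot].
apply: ae_integralC; first exact: measurable_dot.
  apply: measurable_funCD; last exact: measurable_dot.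
  by apply: measurable_funCM; [split; exact: measurable_cst|exact: measurable_dot].
apply: filterS2 (L2_addrE (c *: u) w) (L2_scalerE c u) => x -> ->.
by rewrite mulrDl mulrA.
Qed.

Let L2dot_herm (u v : L2) : L2dot u v = (-1) ^+ false * (L2dot v u)^*.
Proof.
rewrite expr0 mul1r /L2dot -integralC_conj; last exact: integrable_dot.
by congr integralC; apply/funext => x; rewrite rmorphM /= conjCK mulrC.
Qed.

Let L2dot_linearr (u : L2) : linear_for (Num.conj \; *%R) (L2dot u).
Proof.
move=> c v w; have h := L2dot_herm; move: h; rewrite expr0 => h.
rewrite h (L2dot_linearl u c v w) (h u v) (h u w) !mul1r rmorphD rmorphM.
by [].
Qed.

HB.instance Definition _ := bilinear_isBilinear.Build C L2 L2 C *%R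
  (Num.conj \; *%R) L2dot (pair L2dot_linearl L2dot_linearr).

HB.instance Definition _ := isHermitianSesquilinear.Build C L2 false Num.conj
  L2dot L2dot_herm.

Let L2dot_gt0 (u : L2) : u != 0 -> 0 < L2dot u u.
Proof.
move=> u0.
have ReE x : complex.Re (u x * (u x)^*) = sqnormc (u x).
  by rewrite normc2; case: (u x) => a b /=; ring.
have Im0 x : complex.Im (u x * (u x)^*) = 0.
  by case: (u x) => a b /=; ring.
rewrite /L2dot /integralC ltcE /=.
under eq_Rintegral do rewrite Im0.
under [in X in _ && X]eq_Rintegral do rewrite ReE.
rewrite Rintegral_cst// mul0r eqxx /= lt_neqAle Rintegral_ge0// andbT.
apply: contra_neq u0 => /esym int0; apply/L2_eqP.
have [mu _] := L2P u.
have h0 : (\int[nu]_x (sqnormc (u x))%:E = 0)%E.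
  rewrite -[LHS]fineK; last exact: integrable_fin_num (integrable_sqnormc u).
  by rewrite -[fine _]/(Rintegral _ _ _) int0.
have : (\int[nu]_x `|(sqnormc (u x))%:E| = 0)%E.
  by rewrite -[RHS]h0; apply: eq_integral => x _; rewrite gee0_abs ?lee_fin.
move/(ae_eq_integral_abs nu measurableT (measurable_sqnormc mu)).
apply: filterS2 (L2classE square_integrable0) => x h /(_ I) [] /eqP.
rewrite sqrf_eq0 => /eqP /Normc.eq0_normc ->.
by rewrite [RHS]h.
Qed.

HB.instance Definition _ := isDotProduct.Build C L2 L2dot L2dot_gt0.

End complex_L2.

Section operator_algebras.
Context (R : realType).
Local Notation C := R[i].
Context (H : lmodType C) (dot : {dot H for Num.conj}).
Implicit Types (A B : H -> H) (S M : set (H -> H)).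

(* ||A u||^2 <= c ||u||^2, the norms being expressed by the inner product. *)
Definition bounded_operator A : Prop :=
  linear A /\ exists c : R, forall u, dot (A u) (A u) <= c%:C%C * dot u u.

Definition commutant S : set (H -> H) :=
  [set A | bounded_operator A /\ forall B, S B -> A \o B = B \o A].

Definition adjoint_operators A B : Prop :=
  forall u v, dot (A u) v = dot u (B v).

(* As in Dixmier and Takesaki: a *-algebra of bounded operators equal to its
   bicommutant. [dot] is meant to be the inner product of a Hilbert space. *)
Record von_neumann_algebra M : Prop := {
  vN_bounded : forall A, M A -> bounded_operator A ;
  vN_id : M idfun ;
  vN_add : forall A B, M A -> M B -> M (fun u => A u + B u) ;
  vN_scale : forall (c : C) A, M A -> M (fun u => c *: A u) ;
  vN_comp : forall A B, M A -> M B -> M (A \o B) ;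
  vN_adjoint : forall A B, M A -> adjoint_operators A B -> M B ;
  vN_bicommutant : commutant (commutant M) = M }.

Definition von_neumann_generated S : set (H -> H) :=
  smallest von_neumann_algebra S.

End operator_algebras.

Section characters.
Context (R : realType) (G : groupType).
Local Notation C := R[i].

Definition positive_semidefinite n (A : 'M[C]_n) : Prop :=
  forall v : 'rV[C]_n, 0 <= (v *m A *m (map_mx Num.conj v)^T) 0 0.

Record is_character (chi : G -> C) : Prop := {
  character_central : forall g h, chi (g * h)%g = chi (h * g)%g ;
  character_psd : forall n (g : 'I_n -> G),
    positive_semidefinite (\matrix_(i, j) chi (g i * (g j)^-1)%g) ;
  character1 : chi 1%g = 1 }.

Definition indecomposable_character (chi : G -> C) : Prop :=
  is_character chi /\
  ~ exists (a : R) (chi1 chi2 : G -> C),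
      [/\ 0 < a < 1, is_character chi1, is_character chi2, chi1 <> chi2 &
        forall g, chi g = a%:C%C * chi1 g + (1 - a)%:C%C * chi2 g].

End characters.

Section lebesgue_space.
Context d (X : measurableType d) (R : realType).

Notation completedR := (caratheodory_type (@wlength R idfun)^*%mu).

(* A complete probability space which is, up to a null set, the disjoint union
   of a countable set [D] of points and a set [X0] isomorphic mod 0 to the
   interval [0, a] with the Lebesgue-measurable sets and Lebesgue measure.
   The isomorphism [phi] and its inverse are measurable and measure preserving:
   this is the last condition, since [phi] is a bijection. Points of [D] may be
   null, and either part may be missing. *)
Definition lebesgue_space (mu : probability X R) : Prop :=
  measure_is_complete mu /\
  exists (D X0 : set X) (a : R) (Y0 : set completedR) (phi : X -> completedR),
    [/\ countable D, (forall x, D x -> measurable [set x]),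
        measurable X0, D `&` X0 = set0 & mu (~` (D `|` X0)) = 0%E] /\
    [/\ measurable Y0, Y0 `<=` `[0, a],
        completed_lebesgue_measure (`[0, a] `\` Y0) = 0%E, set_bij X0 Y0 phi &
        forall A, A `<=` X0 ->
          (measurable A <-> measurable (phi @` A)) /\
          (measurable A -> mu A = completed_lebesgue_measure (phi @` A))].

End lebesgue_space.

Section actions.
Context d (X : measurableType d) (R : realType) (mu : probability X R).
Context (G : groupType) (act : G -> X -> X).

Record pmp_action : Prop := {
  act1 : forall x, act 1%g x = x ;
  actM : forall g h x, act (g * h)%g x = act g (act h x) ;
  act_measurable : forall g, measurable_fun setT (act g) ;
  act_preserving : forall g A, measurable A -> mu (act g @^-1` A) = mu A }.

Definition ergodic_action : Prop := forall A, measurable A ->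
  (forall g, act g @^-1` A = A) -> mu A = 0%E \/ mu A = 1%E.

Definition Fix (g : G) : set X := [set x | act g x = x].
Definition supp (g : G) : set X := ~` Fix g.

Definition subgroup_on (A : set X) : set G :=
  [set g | mu (supp g `\` A) = 0%E].

Definition perfectly_nonfree : Prop := exists AA : set (set X),
  [/\ AA `<=` measurable,
      <<s AA `|` [set N | measurable N /\ mu N = 0%E] >> = measurable &
      forall A, AA A -> {ae mu, forall x, A x ->
        infinite_set [set act g x | g in subgroup_on A]}].

Definition Linfty (m : X -> R[i]) : Prop :=
  measurable_funC m /\ exists c : R, {ae mu, forall x, Normc.normc (m x) <= c}.

Definition orbit_relation : set (X * X) :=
  [set p | exists g, p.2 = act g p.1].

End actions.

Section orbit_measure.
Context d (X : measurableType d) (R : realType) (mu : probability X R).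
Context (G : groupType) (act : G -> X -> X).

(* The measure nu, extended by 0 from the orbit relation to X * X. The three
   proof arguments do not occur in the formula; they are what makes this function a
   measure on the product sigma-algebra. *)
Definition orbit_measure (countG : countable [set: G])
    (lebX : lebesgue_space mu) (pmp : pmp_action mu act) (B : set (X * X)) :
    \bar R :=
  (\int[mu]_x counting (B `&` orbit_relation act `&` (setT `*` [set x])))%E.

Context (countG : countable [set: G]) (lebX : lebesgue_space mu).
Context (pmp : pmp_action mu act).

Lemma actK g : cancel (act g) (act g^-1%g).
Proof. by move=> x; rewrite -(actM pmp) mulVg (act1 pmp). Qed.

Lemma actKV g : cancel (act g^-1%g) (act g).
Proof. by move=> x; rewrite -(actM pmp) mulgV (act1 pmp). Qed.

Lemma measurable_Fix g : measurable (Fix act g).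
Proof.
have [cmu [D [X0 [a [Y0 [phi [[cD mD mX0 _ DX0]]]]]]]] := lebX.
move=> [mY0 Y0a _ [phiY0 phiI phiS] phim].
have mphi : measurable_fun X0 (phi : X -> measurableTypeR R).
  move=> _ B mB.
  have sX : X0 `&` phi @^-1` B `<=` X0 by move=> x [].
  apply/(phim _ sX).1.
  rewrite (_ : phi @` _ = Y0 `&` B); last first.
    apply/seteqP; split=> [_ [x [X0x Bx] <-]|y [Y0y By]].
      by split => //; exact: phiY0.
    have [x X0x xy] := phiS _ Y0y.
    by exists x => //; split => //; rewrite /preimage /= xy.
  apply: measurableI => //.
  exact: sub_caratheodory.
pose E := D `|` X0.
have mDs B : B `<=` D -> measurable B.
  move=> BD; have /countable_injP[f finj] := sub_countable (subset_card_le BD) cD.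
  rewrite (_ : B = \bigcup_n (B `&` f @^-1` [set n])); last first.
    by rewrite -setI_bigcupr -preimage_bigcup bigcup_imset1 image_id setIT.
  apply: bigcupT_measurable => n.
  have [[x [Bx fx]]|no] := pselect (exists x, B x /\ f x = n).
    rewrite (_ : _ `&` _ = [set x]); first exact/mD/BD.
    apply/seteqP; split=> [y [By /= fy]|y /= ->//].
    by apply: finj; rewrite ?inE// fx fy.
  rewrite (_ : _ `&` _ = set0)//; apply/seteqP; split=> [y [By fy]|//].
  by case: no; exists y.
have mE : measurable E by apply: measurableU => //; exact: mDs.
have mgE : measurable (act g @^-1` E).
  by rewrite -[X in measurable X]setTI; exact: (act_measurable pmp g).
have mgX0 : measurable (act g @^-1` X0).
  by rewrite -[X in measurable X]setTI; exact: (act_measurable pmp g).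
rewrite -(setUIDK (Fix act g) E); apply: measurableU; last first.
  by apply: cmu; exists (~` E); split=> //; exact: measurableC.
rewrite /E setIUr; apply: measurableU; first exact: mDs.
rewrite (_ : _ `&` _ = (X0 `&` act g @^-1` X0) `&`
    (fun x => phi (act g x) == phi x) @^-1` [set true]).
  apply: (@measurable_fun_eqr _ _ R) => //; last exact: measurableI.
    apply: (@measurable_comp _ _ _ _ _ _ X0) mphi _ => //.
      by move=> _ [x [_ gx] <-].
    exact: measurable_funS (act_measurable pmp g).
  by apply: measurable_funS mphi.
apply/seteqP; split=> x /=; rewrite /Fix /=.
  by move=> [gx X0x]; rewrite gx; split => //; exact/eqP.
move=> [[X0x X0gx] /eqP phx]; split => //.
by apply: phiI => //; rewrite inE.
Qed.

Let enum : nat -> G :=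
  fun n => xget 1%g [set g | sval (cid (countable_injP _ countG)) g = n].

Let enumP g : exists n, enum n = g.
Proof.
rewrite /enum; case: cid => f /= finj; exists (f g).
have /= := @xgetPex _ 1%g [set h | f h = f g] (ex_intro _ g erefl).
by move=> h; apply: finj h; rewrite inE.
Qed.

(* [F i] is the graph of the [i]-th group element, and [U i] the set of points
   at which it is disjoint from the previous graphs. *)
Let F i (y : X) : X * X := (act (enum i) y, y).
Let U i : set X := [set y | forall j, (j < i)%N -> act (enum j) y <> act (enum i) y].

Let mF i : measurable_fun setT (F i).
Proof.
by apply: measurable_fun_pair; [exact: (act_measurable pmp)|exact: measurable_id].
Qed.

Let mU i : measurable (U i).
Proof.
rewrite (_ : U i = \bigcap_(j in [set j | (j < i)%N])
    ~` Fix act ((enum j)^-1 * enum i)%g).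
  by apply: bigcap_measurableType => // j _; apply: measurableC; exact: measurable_Fix.
apply/seteqP; split=> [y Uy j ji|y Uy j ji] /=.
  rewrite /Fix /= (actM pmp) => ji'; apply: (Uy j ji).
  by rewrite -[in LHS]ji' actKV.
move=> e; apply: (Uy j ji); rewrite /Fix /= (actM pmp) -e.
by rewrite actK.
Qed.

Let counting_bij (S : choiceType) (T : pointedType) (A : set S) (B : set T) (f : S -> T) :
  set_bij A B f -> counting A = counting B :> \bar R.
Proof.
move=> fAB; have AB : (A #= B)%card by apply/card_set_bijP; exists f.
rewrite /counting (eq_finite_set AB); case: asboolP => // fB.
congr (_%:R%:E); apply/fcard_eq => //.
by rewrite (eq_finite_set AB).
Qed.

Let counting_section B x :
  counting (B `&` orbit_relation act `&` (setT `*` [set x])) =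
  (\sum_(0 <= i <oo) (\1_(U i `&` F i @^-1` B) x)%:E)%E :> \bar R.
Proof.
rewrite -(@counting_bij _ _ [set i | U i x /\ B (F i x)] _ (fun i => F i x)).
  rewrite counting_dirac; apply: eq_eseriesr => i _.
  by rewrite diracE indicE; congr (_%:R%:E); congr nat_of_bool;
    apply/idP/idP; rewrite !inE.
split.
- move=> i [Uix Bi]; split=> //; split=> //; exists (enum i)^-1%g.
  by rewrite /= actK.
- move=> i j; rewrite !inE => -[Ui _] [Uj _] [] e.
  case: (ltngtP i j) => // ij.
    by have := Uj _ ij; rewrite e.
  by have := Ui _ ij; rewrite e.
- move=> [x' y] [[Bp [g /= yg]] [_ /= yx]]; subst x.
  have ex : exists n, `[< act (enum n) y = x' >].
    have [n en] := enumP g^-1%g; exists n; apply/asboolP.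
    by rewrite en yg actK.
  case: (ex_minnP ex) => n /asboolP en nmin.
  exists n; last by rewrite /F en.
  split=> /=; last by rewrite /F en.
  move=> j jn; rewrite en => ej.
  by have := nmin j; rewrite leqNgt jn => /(_ (asboolT ej)).
Qed.

Let orbit_measureE B : measurable B -> orbit_measure countG lebX pmp B =
  (\sum_(0 <= i <oo) mu (U i `&` F i @^-1` B))%E.
Proof.
move=> mB; rewrite /orbit_measure.
have mUF i : measurable (U i `&` F i @^-1` B).
  by apply: measurableI => //; rewrite -[X in measurable X]setTI; exact: mF.
under eq_integral do rewrite counting_section.
rewrite integral_nneseries//.
- by apply: eq_eseriesr => i _; rewrite integral_indic// setIT.
- by move=> i; apply/measurable_EFinP; exact: measurable_indic.
Qed.

Let orbit_measure0 : orbit_measure countG lebX pmp set0 = 0%E.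
Proof.
rewrite orbit_measureE//; apply: eseries0 => i _ _.
by rewrite preimage_set0 setI0.
Qed.

Let orbit_measure_ge0 B : (0 <= orbit_measure countG lebX pmp B)%E.
Proof.
apply: integral_ge0 => x _; rewrite /counting.
by case: ifP => _ //; rewrite lee_fin.
Qed.

Let orbit_measure_sigma_additive :
  semi_sigma_additive (orbit_measure countG lebX pmp).
Proof.
move=> B mB tB mUB; rewrite orbit_measureE//.
under eq_fun do under eq_bigr do rewrite orbit_measureE//.
have mUF i n : measurable (U i `&` F i @^-1` B n).
  by apply: measurableI => //; rewrite -[X in measurable X]setTI; exact: mF.
rewrite (_ : (\sum_(0 <= i <oo) _ = \sum_(0 <= n <oo) \sum_(0 <= i <oo)
    mu (U i `&` F i @^-1` B n))%E).
  by apply: is_cvg_nneseries => n _ _; apply: nneseries_ge0.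
rewrite -nneseries_interchange//; apply: eq_eseriesr => i _.
have tF : trivIset setT (fun n => U i `&` F i @^-1` B n).
  apply: trivIset_setIl; apply/classical_sets.trivIsetP => i0 j0 _ _ ij.
  rewrite -preimage_setI ((classical_sets.trivIsetP.1 tB) _ _ _ _ ij)//.
rewrite preimage_bigcup setI_bigcupr measure_semi_bigcup//.
exact: bigcupT_measurable.
Qed.

HB.instance Definition _ := isMeasure.Build _ (X * X)%type R
  (orbit_measure countG lebX pmp) orbit_measure0 orbit_measure_ge0
  orbit_measure_sigma_additive.

Local Notation nu := (orbit_measure countG lebX pmp).

Definition translate (g : G) (p : X * X) : X * X := (act g^-1%g p.1, p.2).

Lemma measurable_translate g : measurable_fun setT (translate g).
Proof.
apply: measurable_fun_pair; last exact: measurable_snd.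
exact: (measurableT_comp (act_measurable pmp _) measurable_fst).
Qed.

Lemma orbit_measure_translate g B : nu (translate g @^-1` B) = nu B.
Proof.
rewrite /orbit_measure; apply: eq_integral => x _.
apply: (@counting_bij _ _ _ _ (translate g)); split.
- move=> [x' y] [[Bp [h /= yh]] [_ /= yx]]; split=> //; split=> //.
  by exists (h * g)%g; rewrite /= (actM pmp) actKV.
- move=> [x1 y1] [x2 y2]; rewrite !inE => -[_ [_ /= e1]] [_ [_ /= e2]].
  by case=> /(can_inj (actK g^-1%g)) -> _; rewrite e1 e2.
- move=> [x' y] [[Bp [h /= yh]] [_ /= yx]].
  exists (act g x', y); last by rewrite /translate /= actK.
  split=> //; split; first by rewrite /= /translate /= actK.
  by exists (h * g^-1)%g; rewrite /= (actM pmp) actK.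
Qed.

Lemma square_integrable_translate g f : square_integrable nu f ->
  square_integrable nu (fun p : X * X => f (act g^-1%g p.1, p.2)).
Proof.
have mt := measurable_translate g.
move=> [[mr mi] lf]; split.
  split; first exact: (measurableT_comp mr mt).
  exact: (measurableT_comp mi mt).
apply: le_lt_trans lf; rewrite le_eqVlt; apply/orP; left; apply/eqP.
have msq : measurable_fun setT (fun p => (sqnormc (f p))%:E) by exact: measurable_sqnormc.
rewrite -[LHS](@ge0_integral_pushforward _ _ _ _ _ _ mt nu setT _ measurableT msq).
  by apply: eq_measure_integral => B mB _; rewrite /pushforward; exact: orbit_measure_translate.
by move=> x _; rewrite lee_fin sqr_ge0.
Qed.

Definition groupoid_rep (g : G) (u : L2 nu) : L2 nu :=
  L2class (square_integrable_translate g (L2P u)).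

Lemma ae_orbit_measure_fst (P : set X) :
  {ae mu, forall x, P x} -> {ae nu, forall p, P p.1}.
Proof.
move=> [N [mN N0 PN]]; have mNT : measurable (N `*` [set: X]).
  exact: measurableX.
exists (N `*` setT); split=> //; last by move=> [x y] /= Px; split=> //; exact: PN.
rewrite [LHS]orbit_measureE//; apply: eseries0 => i _ _.
have mFN : measurable (F i @^-1` (N `*` setT)).
  by rewrite -[X in measurable X]setTI; exact: mF.
apply/eqP; rewrite -measure_le0 -N0 -(act_preserving pmp (enum i) mN).
rewrite le_measure ?inE//; first exact: measurableI.
  by rewrite -[X in measurable X]setTI; exact: (act_measurable pmp).
by move=> y [_ []].
Qed.

Lemma square_integrable_mul m f : Linfty mu m -> square_integrable nu f ->
  square_integrable nu (fun p : X * X => m p.1 * f p).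
Proof.
move=> [[mr mi] [c mc]] [mf lf].
have mm : measurable_funC (fun p : X * X => m p.1).
  split; first exact: (measurableT_comp mr measurable_fst).
  exact: (measurableT_comp mi measurable_fst).
have mmf := measurable_funCM mm mf.
split=> //; pose g p := ((c ^+ 2)%:E * (sqnormc (f p))%:E)%E.
have c0 : (0 <= (c ^+ 2)%:E :> \bar R)%E by rewrite lee_fin sqr_ge0.
have g0 p : (0 <= g p)%E by rewrite mule_ge0// lee_fin sqr_ge0.
apply: (@le_lt_trans _ _ (\int[nu]_p g p))%E; last first.
  rewrite ge0_integralZl//; first by rewrite lte_mul_pinfty.
    exact: measurable_sqnormc.
  by move=> p _; rewrite lee_fin sqr_ge0.
apply: ae_ge0_le_integral => //.
- by move=> p _; rewrite lee_fin sqr_ge0.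
- exact: measurable_sqnormc.
- exact/measurable_funeM/measurable_sqnormc.
apply: filterS (ae_orbit_measure_fst mc) => p /= mp _.
rewrite /g -EFinM lee_fin /sqnormc Normc.normcM exprMn.
have n0 : 0 <= Normc.normc (m p.1) by case: (m p.1) => a b; exact: sqrtr_ge0.
by rewrite ler_wpM2r ?sqr_ge0// lerXn2r// nnegrE (le_trans n0).
Qed.

Definition mult_op m (hm : Linfty mu m) (u : L2 nu) : L2 nu :=
  L2class (square_integrable_mul hm (L2P u)).

Definition groupoid_vN : set (L2 nu -> L2 nu) :=
  von_neumann_generated (@L2dot _ _ _ nu) (range groupoid_rep).

Definition relation_vN : set (L2 nu -> L2 nu) :=
  von_neumann_generated (@L2dot _ _ _ nu)
    (groupoid_vN `|` [set T | exists m (hm : Linfty mu m), T = mult_op hm]).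

End orbit_measure.

Arguments orbit_measure {d X R mu G act} countG lebX pmp B.
Arguments groupoid_rep {d X R mu G act} countG lebX pmp g u.
Arguments mult_op {d X R mu G act} countG lebX pmp {m} hm u.
Arguments groupoid_vN {d X R mu G act} countG lebX pmp _.
Arguments relation_vN {d X R mu G act} countG lebX pmp _.

Definition fix_character d (X : measurableType d) (R : realType)
    (mu : probability X R) (G : groupType) (act : G -> X -> X) (g : G) : R[i] :=
  (fine (mu (Fix act g)))%:C%C.

(* Main.v *)
Require Import Defs.
From HB Require Import structures.
From mathcomp Require Import finmap.
From mathcomp Require Import all_boot all_order all_algebra.
From mathcomp Require Import all_classical all_reals all_analysis.
From mathcomp Require Import measurable_realfun complex.
From mathcomp Require Import ring lra.
Set Implicit Arguments.
Unset Strict Implicit.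
Unset Printing Implicit Defensive.
Import Order.TTheory GRing.Theory Num.Theory.
Import numFieldNormedType.Exports.
Local Open Scope classical_set_scope.
Local Open Scope ring_scope.

(** Let pi be the groupoid representation and, for a measurable set A, let 1_A act on
L^2(nu) by multiplication in the first variable. Everything rests on one fact: for A in
the family witnessing perfect non-freeness, the projection 1_(~A) is a strong limit of
averages of the operators pi(g), with g ranging over the elements supported in A. Indeed
such averages of a vector u accumulate, by the mean ergodic theorem, at a vector v fixed
by all these pi(g) ([mean_ergodic]). In each fiber v is square summable and constant along
infinite orbits over A, so v vanishes over A ([fixed_vector_vanishes]); outside A the
averages do not change u. Hence v is the restriction of u to ~A
([average_to_localizeC]). The sets A for which 1_A is a strong limit of elements of the
group algebra, on two prescribed vectors at a time, form a sigma-algebra that contains the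
null sets, so they are all the measurable sets ([measurable_approximable]).

The equality of the two von Neumann algebras follows: an operator T commuting with all
pi(g) commutes with 1_A, as one sees by approximating 1_A simultaneously on u and T u
([commute_localize]), hence with multiplication by every bounded function, by uniform
approximation with step functions ([commute_Linfty]). So these multiplications lie in the
bicommutant of pi(G).

For indecomposability let xi be the indicator of the diagonal; then
<pi(g) xi, xi> = mu(Fix g). If this character is a convex combination in which chi occurs
with weight a > 0, then |chi(s)|^2 is at most ||s xi||^2 / a for s in the group algebra,
so Riesz representation gives a vector k with chi(s) = L(s xi), where L(u) = <u, k>
([exists_density]). Since chi is a trace and 1_B can be approximated in the group algebra,
L behaves like a trace also on products involving 1_B. Therefore
L(pi(g) 1_B xi) = L(1_B pi(g) 1_B xi), which is 0 if g moves B off itself ([L_moved]).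
The set where g acts nontrivially is, up to a null set, a countable union of such B, so
chi(g) = L(1_(Fix g) xi) ([L_fix]). Finally B |-> L(1_B xi) is an invariant complex
measure with a density with respect to mu, so by ergodicity it is a multiple of mu, and it
has total mass chi(1) = 1 ([L_localize]). Thus chi(g) = mu(Fix g), and no nontrivial
decomposition exists. *)

(** * Hilbert-space geometry *)

Section linear_facts.
Context (K : pzRingType) (U V : lmodType K) (f : U -> V) (lf : linear f).

Let fl : {linear U -> V} := HB.pack f (GRing.isLinear.Build _ _ _ _ f lf).

Lemma lin0 : f 0 = 0. Proof. exact: (linear0 fl). Qed.
Lemma linD : {morph f : u v / u + v}. Proof. exact: (linearD fl). Qed.
Lemma linB : {morph f : u v / u - v}. Proof. exact: (linearB fl). Qed.
Lemma linZ c u : f (c *: u) = c *: f u. Proof. exact: (linearZ_LR fl). Qed.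
Lemma lin_sum (I : Type) (r : seq I) (F : I -> U) :
  f (\sum_(i <- r) F i) = \sum_(i <- r) f (F i).
Proof. exact: (linear_sum fl). Qed.

End linear_facts.

Section hilbert.
Context (R : realType).
Local Notation C := R[i].
Context (H : lmodType C) (dot : {dot H for Num.conj}).
Implicit Types (u v w : H) (K : set H).

Definition sqnorm u : R := complex.Re (dot u u).
Definition hnorm u : R := Num.sqrt (sqnorm u).

Lemma ge0_complexE (z : C) : 0 <= z -> z = (complex.Re z)%:C%C.
Proof. by case: z => a b; rewrite lecE /= => /andP[/eqP -> _]. Qed.

Lemma normc_sqrE (z : C) : z * z^* = (sqnormc z)%:C%C.
Proof.
case: z => a b; rewrite /sqnormc /= sqr_sqrtr ?addr_ge0 ?sqr_ge0//.
by apply/eqP; rewrite eq_complex /=; apply/andP; split; apply/eqP; ring.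
Qed.

Lemma sqnormcE (z : C) : sqnormc z = complex.Re z ^+ 2 + complex.Im z ^+ 2.
Proof. by case: z => a b; rewrite /sqnormc /= sqr_sqrtr// addr_ge0 ?sqr_ge0. Qed.

Lemma sqnormc_ge0 (z : C) : 0 <= sqnormc z.
Proof. exact: sqr_ge0. Qed.

Lemma ReD (x y : C) : complex.Re (x + y) = complex.Re x + complex.Re y.
Proof. by case: x; case: y. Qed.

Lemma normc_half : Normc.normc (2^-1 : C) = 2^-1.
Proof.
rewrite (_ : 2^-1 = (2^-1 : R)%:C%C); last by rewrite rmorphV ?unitfE//= rmorph_nat.
by rewrite /= expr0n addr0 sqrtr_sqr ger0_norm.
Qed.

Lemma dotC u v : dot v u = (dot u v)^*.
Proof. by rewrite (hermC dot v u) expr0 mul1r. Qed.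

Lemma dotDl u v w : dot (u + v) w = dot u w + dot v w.
Proof. exact: linearDl. Qed.
Lemma dotDr u v w : dot w (u + v) = dot w u + dot w v.
Proof. exact: linearDr. Qed.
Lemma dotBl u v w : dot (u - v) w = dot u w - dot v w.
Proof. exact: linearBl. Qed.
Lemma dotZl c u w : dot (c *: u) w = c * dot u w.
Proof. exact: linearZl_LR. Qed.
Lemma dotZr c u w : dot w (c *: u) = c^* * dot w u.
Proof. exact: linearZr_LR. Qed.

Lemma dot_sqnorm u : dot u u = (sqnorm u)%:C%C.
Proof.
apply: ge0_complexE; exact: dnorm_ge0.
Qed.

Lemma sqnorm_ge0 u : 0 <= sqnorm u.
Proof. by have := dnorm_ge0 dot u; rewrite dot_sqnorm lecR. Qed.

Lemma sqnorm_eq0 u : sqnorm u = 0 -> u = 0.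
Proof. by move=> h; apply/eqP; rewrite -(dnorm_eq0 dot) dot_sqnorm h. Qed.

Lemma sqnormD u v : sqnorm (u + v) = sqnorm u + sqnorm v + 2 * complex.Re (dot u v).
Proof.
rewrite /sqnorm dotDl !dotDr (dotC u v) !ReD.
by case: (dot u v) => a b /=; ring.
Qed.

Lemma sqnormZ c u : sqnorm (c *: u) = sqnormc c * sqnorm u.
Proof.
rewrite /sqnorm dotZl dotZr mulrA normc_sqrE dot_sqnorm.
by rewrite -rmorphM.
Qed.

Lemma sqnormN u : sqnorm (- u) = sqnorm u.
Proof. by rewrite -scaleN1r sqnormZ sqnormcE /=; lra. Qed.

(** In this form the identity bounds the distance of two nearly shortest vectors of a
    midpoint-closed set, whose midpoint cannot be much shorter. *)
Lemma parallelogram u v :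
  sqnorm (u - v) = 2 * sqnorm u + 2 * sqnorm v - 4 * sqnorm (2^-1 *: (u + v)).
Proof.
have -> : sqnorm (2^-1 *: (u + v)) = 4^-1 * sqnorm (u + v).
  rewrite sqnormZ; congr (_ * _).
  rewrite (_ : 2^-1 = (2^-1 : R)%:C%C); last by rewrite rmorphV ?unitfE//= rmorph_nat.
  by rewrite sqnormcE /=; lra.
rewrite !sqnormD sqnormN.
have -> : dot u (- v) = - dot u v by rewrite -scaleN1r dotZr rmorphN1 mulN1r.
by case: (dot u v) => a b /=; lra.
Qed.

Lemma eq_hnorm u v : sqnorm u = sqnorm v -> hnorm u = hnorm v.
Proof. by rewrite /hnorm => ->. Qed.

Lemma hnorm_ge0 u : 0 <= hnorm u. Proof. exact: sqrtr_ge0. Qed.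
Lemma hnorm2 u : hnorm u ^+ 2 = sqnorm u.
Proof. by rewrite sqr_sqrtr// sqnorm_ge0. Qed.
Lemma hnorm_zero : hnorm 0 = 0.
Proof. by rewrite /hnorm /sqnorm linear0l /= sqrtr0. Qed.
Lemma hnorm_eq0 u : hnorm u = 0 -> u = 0.
Proof. by move=> h; apply: sqnorm_eq0; rewrite -hnorm2 h expr0n. Qed.
Lemma hnorm_opp u : hnorm (- u) = hnorm u.
Proof. by rewrite /hnorm sqnormN. Qed.
Lemma hnormC u v : hnorm (u - v) = hnorm (v - u).
Proof. by rewrite -opprB hnorm_opp. Qed.
Lemma hnormZ c u : hnorm (c *: u) = Normc.normc c * hnorm u.
Proof.
rewrite /hnorm sqnormZ sqrtrM ?sqnormc_ge0// /sqnormc sqrtr_sqr ger0_norm//.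
by case: c => a b; exact: sqrtr_ge0.
Qed.

Lemma cauchy_schwarz_sqr u v : sqnormc (dot u v) <= sqnorm u * sqnorm v.
Proof.
have [v0|v0] := eqVneq (sqnorm v) 0.
  by rewrite v0 mulr0 (sqnorm_eq0 v0) linear0r sqnormcE /=; lra.
have vp : 0 < sqnorm v by rewrite lt_neqAle eq_sym v0 sqnorm_ge0.
have := sqnorm_ge0 ((sqnorm v)%:C%C *: u - dot u v *: v).
rewrite -scaleNr sqnormD !sqnormZ dotZl dotZr !sqnormcE.
case: (dot u v) => a b /=; rewrite !expr0n/= => h.
have {}h : 0 <= sqnorm v * (sqnorm u * sqnorm v - (a ^+ 2 + b ^+ 2)) by nra.
by move: h; rewrite pmulr_rge0//; lra.
Qed.

Lemma normc_ge0 (z : C) : 0 <= Normc.normc z.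
Proof. by case: z => a b; exact: sqrtr_ge0. Qed.

Lemma cauchy_schwarz u v : Normc.normc (dot u v) <= hnorm u * hnorm v.
Proof.
rewrite -(@ler_pXn2r _ 2)// ?nnegrE ?mulr_ge0 ?normc_ge0 ?hnorm_ge0//.
by rewrite exprMn !hnorm2; exact: cauchy_schwarz_sqr.
Qed.

Lemma Re_le_normc (z : C) : complex.Re z <= Normc.normc z.
Proof.
case: z => a b /=; apply: le_trans (ler_norm a) _; rewrite -sqrtr_sqr.
by apply: ler_wsqrtr; rewrite lerDl sqr_ge0.
Qed.

Lemma hnorm_triangle u v : hnorm (u + v) <= hnorm u + hnorm v.
Proof.
rewrite -(@ler_pXn2r _ 2)// ?nnegrE ?addr_ge0 ?hnorm_ge0//.
rewrite hnorm2 sqnormD sqrrD !hnorm2.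
have := le_trans (Re_le_normc _) (cauchy_schwarz u v).
by rewrite -mulr_natr; lra.
Qed.

Lemma hnorm_dist u w v : hnorm (u - v) <= hnorm (u - w) + hnorm (w - v).
Proof. by rewrite -(subrKA w) hnorm_triangle. Qed.

Lemma hnorm_le u v : hnorm u <= hnorm v + hnorm (u - v).
Proof. by rewrite -{1}(subrK v u) addrC hnorm_triangle. Qed.

Lemma hnorm_eq u v : (forall e, 0 < e -> hnorm (u - v) < e) -> u = v.
Proof.
move=> h; apply/eqP; rewrite -subr_eq0; apply/eqP/hnorm_eq0/eqP.
rewrite eq_le hnorm_ge0 andbT leNgt; apply/negP => /h.
by rewrite ltxx.
Qed.

Definition adherent K v := forall e : R, 0 < e -> exists2 u, K u & hnorm (u - v) < e.

Definition complete_space := forall u : nat -> H,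
  (forall e : R, 0 < e -> exists N, forall m n, (N <= m)%N -> (N <= n)%N ->
     hnorm (u m - u n) < e) ->
  exists v, forall e : R, 0 < e -> exists N, forall n, (N <= n)%N -> hnorm (u n - v) < e.

Definition midpoint_closed K := forall u v, K u -> K v -> K (2^-1 *: (u + v)).

Lemma adherent_midpoint K u v : midpoint_closed K ->
  adherent K u -> adherent K v -> adherent K (2^-1 *: (u + v)).
Proof.
move=> mK au av e e0; have [u' Ku' du] := au _ e0; have [v' Kv' dv] := av _ e0.
exists (2^-1 *: (u' + v')); first exact: mK.
have -> : 2^-1 *: (u' + v') - 2^-1 *: (u + v) = 2^-1 *: ((u' - u) + (v' - v)).
  by rewrite -scalerBr opprD addrACA.
rewrite hnormZ; have := hnorm_triangle (u' - u) (v' - v).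
by rewrite normc_half => h; lra.
Qed.

(** A minimizing sequence is Cauchy by the parallelogram identity. Closure under midpoints
    is all of convexity that this argument uses, and it is easier to check on generated sets. *)
Lemma exists_min_norm K : complete_space -> K !=set0 -> midpoint_closed K ->
  exists2 v, adherent K v & forall u, adherent K u -> hnorm v <= hnorm u.
Proof.
move=> cpl [u0 Ku0] mK.
pose D := [set sqnorm u | u in K]; pose delta := inf D.
have hD : has_inf D.
  by split; [exists (sqnorm u0); exists u0|exists 0 => _ [u _ <-]; exact: sqnorm_ge0].
have ledelta u : K u -> delta <= sqnorm u.
  by move=> Ku; apply: ge_inf; [exact: hD.2|exists u].
have delta0 : 0 <= delta.
  by apply: lb_le_inf; [exact: hD.1|move=> _ [u _ <-]; exact: sqnorm_ge0].
have ex n : exists u, K u /\ sqnorm u < delta + n.+1%:R^-1.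
  have n0 : 0 < n.+1%:R^-1 :> R by rewrite invr_gt0.
  have [_ [u Ku <-] h] := inf_adherent n0 hD.
  by exists u.
have [s sP] := choice ex.
have near1 (e : R) : 0 < e -> exists N, forall n, (N <= n)%N -> (n.+1%:R^-1 : R) < e.
  move=> e0; have e1 : 0 <= e^-1 by rewrite invr_ge0 ltW.
  exists (Num.Def.archi_bound e^-1) => n Nn.
  have := archi_boundP e1; set k := Num.Def.archi_bound _ in Nn *.
  move=> ek; rewrite -[e]invrK ltf_pV2 ?posrE ?invr_gt0//.
  by apply: lt_le_trans ek _; rewrite ler_nat leqW.
have [v sv] : exists v, forall e : R, 0 < e -> exists N, forall n, (N <= n)%N ->
    hnorm (s n - v) < e.
  apply: cpl => e e0.
  have [N NP] := near1 (e ^+ 2 / 4) (ltac:(by rewrite divr_gt0// exprn_gt0)).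
  exists N => m n Nm Nn; rewrite -(@ltr_pXn2r _ 2)// ?nnegrE ?hnorm_ge0 ?(ltW e0)//.
  rewrite hnorm2 parallelogram.
  have [Km hm] := sP m; have [Kn hn] := sP n.
  have := ledelta _ (mK _ _ Km Kn); have := NP _ Nm; have := NP _ Nn.
  move: hm hn; set x := m.+1%:R^-1; set y := n.+1%:R^-1.
  move: (sqnorm (s m)) (sqnorm (s n)) (sqnorm _) => p q r *.
  by lra.
have aux u : adherent K u -> Num.sqrt delta <= hnorm u.
  move=> au; rewrite leNgt; apply/negP => h.
  have [w Kw dw] := au (Num.sqrt delta - hnorm u) ltac:(by rewrite subr_gt0).
  have := ler_wsqrtr (ledelta _ Kw); rewrite -/(hnorm w).
  by have := hnorm_le w u; lra.
have av : adherent K v.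
  by move=> e e0; have [N NP] := sv e e0; exists (s N); [exact: (sP N).1|exact: NP].
exists v => // u au; apply: le_trans (aux _ au).
rewrite leNgt; apply/negP => h.
pose t := Num.sqrt delta; have t0 : 0 <= t by exact: sqrtr_ge0.
pose r := hnorm v - t; have r0 : 0 < r by rewrite subr_gt0.
have [N NP] := sv (r / 2) ltac:(by rewrite divr_gt0).
have [M MP] := near1 (r ^+ 2 / 4) (ltac:(by rewrite divr_gt0// exprn_gt0)).
have h1 := NP (maxn N M) (leq_maxl _ _).
have h2 := MP (maxn N M) (leq_maxr _ _).
have [_ h3] := sP (maxn N M).
have h4 := hnorm_le v (s (maxn N M)); rewrite hnormC in h4.
have h5 : hnorm (s (maxn N M)) < t + r / 2.
  rewrite -(@ltr_pXn2r _ 2)// ?nnegrE ?hnorm_ge0//; last by lra.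
  rewrite hnorm2 sqrrD (sqr_sqrtr delta0); have : 0 <= t * r by rewrite mulr_ge0// ltW.
  rewrite -mulr_natr; move: h2 h3; set x := _.+1%:R^-1.
  move: (sqnorm _) (r) (t) (x) => p a b y *.
  by lra.
by move: h4 h1 h5; rewrite /r; lra.
Qed.


(** Expand the square norm at the optimal c, minus the coefficient of the projection
    of v onto t. *)
Lemma min_norm_orthogonal v t : (forall c, hnorm v <= hnorm (v + c *: t)) -> dot t v = 0.
Proof.
move=> h.
have [t0|t0] := eqVneq (sqnorm t) 0; first by rewrite (sqnorm_eq0 t0) linear0l.
have tp : 0 < sqnorm t by rewrite lt_neqAle eq_sym t0 sqnorm_ge0.
set q := sqnorm t in tp; pose s := q^-1.
have qV : q * s = 1 by rewrite mulfV// gt_eqF.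
have sp : 0 < s by rewrite invr_gt0.
rewrite (dotC v t); case E : (dot v t) => [a b].
have := h (Complex (- (a * s)) (- (b * s))).
rewrite -(@ler_pXn2r _ 2)// ?nnegrE ?hnorm_ge0// !hnorm2 sqnormD sqnormZ dotZr.
rewrite E sqnormcE -/q /=.
move=> h'; have {h} h : s * (a ^+ 2 + b ^+ 2) <= 0.
  have e : q * s * s * (a ^+ 2 + b ^+ 2) = s * (a ^+ 2 + b ^+ 2) by rewrite qV mul1r.
  by move: h' e; clearbody s; clear; lra.
rewrite pmulr_rle0// in h.
have : a ^+ 2 = 0 by have := sqr_ge0 a; have := sqr_ge0 b; lra.
have : b ^+ 2 = 0 by have := sqr_ge0 a; have := sqr_ge0 b; lra.
move=> /eqP; rewrite sqrf_eq0 => /eqP -> /eqP; rewrite sqrf_eq0 => /eqP ->.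
by rewrite -[RHS]conjC0.
Qed.

(** The functional is given by its graph P on a subspace that need not be closed. If it is not
    zero, the vector of least norm adherent to the affine hyperplane where it takes the value 1
    is orthogonal to its kernel, and a multiple of it represents the functional. *)
Lemma riesz_subspace (P : H -> C -> Prop) (M : R) : complete_space ->
  P 0 0 ->
  (forall c u a v b, P u a -> P v b -> P (u + c *: v) (a + c * b)) ->
  (forall u a, P u a -> Normc.normc a <= M * hnorm u) ->
  exists k, forall u a, P u a -> a = dot u k.
Proof.
move=> cpl P0 PD PM.
have [[u0 [a0 [Pu0 a00]]]|no] := pselect (exists u a, P u a /\ a != 0); last first.
  exists 0 => u a Pua; rewrite linear0r; apply: contrapT => /eqP a0.
  by apply: no; exists u, a.
pose K := [set u | P u 1].
have K0 : K !=set0.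
  exists (a0^-1 *: u0); have := PD a0^-1 _ _ _ _ P0 Pu0.
  by rewrite !add0r mulVf.
have mK : midpoint_closed K.
  move=> u v Ku Kv.
  have := PD 2^-1 _ _ _ _ (PD 2^-1 _ _ _ _ P0 Ku) Kv.
  rewrite !add0r mulr1 -scalerDr (_ : 2^-1 + 2^-1 = 1 :> C)//.
  by rewrite -[RHS](@mulVf _ (2 : C))// -[X in X + X]mulr1 -mulrDr.
have [v av vmin] := exists_min_norm cpl K0 mK.
have K1 u : K u -> 1 <= M * hnorm u by move/PM; rewrite /= expr0n expr1n addr0 sqrtr1.
have v0 : hnorm v != 0.
  apply/negP => /eqP v0; have [u Ku] := av (1 / (1 + `|M|)) ltac:(by rewrite divr_gt0// addr_gt0_ge0).
  rewrite (hnorm_eq0 v0) subr0 ltr_pdivlMr ?addr_gt0_ge0// => h.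
  have := K1 _ Ku; have := hnorm_ge0 u; have := ler_norm M.
  by nra.
have kerv t : P t 0 -> dot t v = 0.
  move=> Pt; apply: min_norm_orthogonal => c; apply: vmin => e e0.
  have [u Ku du] := av _ e0; exists (u + c *: t).
    by have := PD c _ _ _ _ Ku Pt; rewrite mulr0 addr0.
  by rewrite opprD addrACA subrr addr0.
have Kv u : K u -> dot u v = (sqnorm v)%:C%C.
  move=> Ku; apply/eqP; rewrite -subr_eq0 -dot_sqnorm -dotBl.
  apply/eqP/Normc.eq0_normc/eqP; rewrite eq_le normc_ge0 andbT leNgt; apply/negP => h.
  set r := Normc.normc _ in h.
  have vp : 0 < hnorm v by rewrite lt_neqAle eq_sym v0 hnorm_ge0.
  have [w Kw dw] := av (r / hnorm v) ltac:(by rewrite divr_gt0).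
  have e : dot (u - v) v = dot (w - v) v.
    have := PD (-1) _ _ _ _ Ku Kw; rewrite mulN1r subrr scaleN1r => /kerv.
    by rewrite !dotBl => /eqP; rewrite subr_eq0 => /eqP ->.
  move: dw; rewrite ltr_pdivlMr// => /(le_lt_trans (cauchy_schwarz _ _)).
  by rewrite -e ltxx.
exists ((sqnorm v)^-1%:C%C *: v) => u a Pua.
have [w Kw] := K0.
have := kerv (u + (- a) *: w); have := PD (- a) _ _ _ _ Pua Kw.
rewrite mulr1 subrr => Pw /(_ Pw); rewrite dotDl dotZl (Kv w Kw) mulNr => /eqP.
rewrite subr_eq0 => /eqP e; rewrite dotZr e.
have -> : ((sqnorm v)^-1%:C%C : C)^* = ((sqnorm v)%:C%C)^-1.
  by rewrite -fmorphV /=; apply/eqP; rewrite eq_complex /= oppr0 !eqxx.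
rewrite mulrCA mulVf ?mulr1//; apply/eqP => /(congr1 (@complex.Re _)) /= s0.
by move/eqP: v0; rewrite /hnorm s0 sqrtr0.
Qed.

(** The operators obtained from the identity by composing with members of [Gam] and taking
    midpoints; they are convex combinations of words in [Gam]. *)
Inductive averages (Gam : set (H -> H)) : (H -> H) -> Prop :=
| avg_id : averages Gam idfun
| avg_act g a : Gam g -> averages Gam a -> averages Gam (g \o a)
| avg_mid a b : averages Gam a -> averages Gam b ->
    averages Gam (fun u => 2^-1 *: (a u + b u)).

(** The adherent vector v of least norm to the averages of u is fixed: the midpoint of v and
    g v is again adherent, so it is not shorter than v, and the parallelogram identity
    forces g v = v. *)
Lemma mean_ergodic (Gam : set (H -> H)) u : complete_space ->
  (forall g, Gam g -> linear g /\ forall u, hnorm (g u) <= hnorm u) ->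
  exists2 v, (forall g, Gam g -> g v = v) &
    forall e, 0 < e -> exists2 a, averages Gam a & hnorm (a u - v) < e.
Proof.
move=> cpl hG; pose K := [set w | exists2 a, averages Gam a & w = a u].
have mK : midpoint_closed K.
  move=> _ _ [a Ka ->] [b Kb ->]; exists (fun u => 2^-1 *: (a u + b u)) => //.
  exact: avg_mid.
have K0 : K !=set0 by exists u; exists idfun => //; exact: avg_id.
have [v av vmin] := exists_min_norm cpl K0 mK.
exists v; last by move=> e /av[_ [a Ka ->]]; exists a.
move=> g Gg; have [lg gle] := hG g Gg.
have agv : adherent K (g v).
  move=> e /av[_ [a Ka ->]] d; exists (g (a u)).
    by exists (g \o a) => //; exact: avg_act.
  by apply: le_lt_trans d; rewrite -(linB lg).
have := vmin _ (adherent_midpoint mK av agv).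
rewrite -(@ler_pXn2r _ 2)// ?nnegrE ?hnorm_ge0// !hnorm2 => h.
have := gle v; rewrite -(@ler_pXn2r _ 2)// ?nnegrE ?hnorm_ge0// !hnorm2 => h2.
have h3 := parallelogram v (g v); have h4 := sqnorm_ge0 (v - g v).
by apply/esym/eqP; rewrite -subr_eq0; apply/eqP/sqnorm_eq0; lra.
Qed.

End hilbert.

(** * Completeness of the space of square-integrable functions *)

Section L2_complete.
Context d (T : measurableType d) (R : realType) (nu : {measure set T -> \bar R}).
Local Notation C := R[i].
Local Notation dot := (@L2dot _ _ _ nu).
Implicit Types (u v w : L2 nu).

Lemma L2_sqnormE u : ((sqnorm dot u)%:E = \int[nu]_x (sqnormc (u x))%:E)%E.
Proof.
have [mu iu] := L2P u.
have ReE x : complex.Re (u x * (u x)^*) = sqnormc (u x) by rewrite normc_sqrE.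
rewrite /sqnorm /= /L2dot /integralC /= /Rintegral.
under eq_integral do rewrite ReE.
by rewrite fineK// ge0_fin_numE// integral_ge0// => x _; rewrite lee_fin sqr_ge0.
Qed.

Lemma L2_sqnorm_ae u (f : T -> C) : measurable_funC f ->
  {ae nu, forall x, u x = f x} ->
  ((sqnorm dot u)%:E = \int[nu]_x (sqnormc (f x))%:E)%E.
Proof.
move=> mf uf; rewrite L2_sqnormE; apply: ae_eq_integral => //.
- by apply: measurable_sqnormc; have [] := L2P u.
- exact: measurable_sqnormc.
- by apply: filterS uf => x ->.
Qed.

Lemma L2_subrE u v : {ae nu, forall x, (u - v : L2 nu) x = u x - v x}.
Proof.
apply: filterS2 (L2_addrE u (-1 *: v)) (L2_scalerE (-1) v) => x.
by rewrite scaleN1r => -> ->; rewrite mulN1r.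
Qed.

Lemma measurable_funCN (f : T -> C) : measurable_funC f -> measurable_funC (fun x => - f x).
Proof.
move=> mf; rewrite (_ : (fun x => - f x) = (fun x => (-1) * f x)).
  by apply: measurable_funCM => //; split; exact: measurable_cst.
by apply/funext => x; rewrite mulN1r.
Qed.

Lemma L2_sqnormB u v : ((sqnorm dot (u - v))%:E = \int[nu]_x (sqnormc (u x - v x))%:E)%E.
Proof.
apply: L2_sqnorm_ae; last exact: L2_subrE.
apply: measurable_funCD; first by have [] := L2P u.
by apply: measurable_funCN; have [] := L2P v.
Qed.

Lemma sqr_normr_Re (z : C) : `|complex.Re z| ^+ 2 <= sqnormc z.
Proof. by rewrite real_normK ?num_real// sqnormcE lerDl sqr_ge0. Qed.
Lemma sqr_normr_Im (z : C) : `|complex.Im z| ^+ 2 <= sqnormc z.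
Proof. by rewrite real_normK ?num_real// sqnormcE lerDr sqr_ge0. Qed.

(** Summability of the weighted square increments forces geometric decay of the increments. *)
Lemma cvg_of_summable (a : nat -> R) (b : nat -> R) :
  (\sum_(0 <= k <oo) (4 ^+ k * b k)%:E < +oo)%E ->
  (forall k, `|a k.+1 - a k| ^+ 2 <= b k) -> cvgn a.
Proof.
move=> sb ab.
have b0 k : 0 <= b k by apply: le_trans (ab k); exact: sqr_ge0.
have u0 k : (0 <= (4 ^+ k * b k)%:E :> \bar R)%E by rewrite lee_fin mulr_ge0.
pose M := fine (\sum_(0 <= k <oo) (4 ^+ k * b k)%:E)%E.
have M0 : 0 <= M by apply: fine_ge0; apply: nneseries_ge0.
have bM k : 4 ^+ k * b k <= M.
  rewrite -lee_fin fineK; last by rewrite ge0_fin_numE// nneseries_ge0.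
  apply: le_trans (nneseries_lim_ge k.+1 (fun n _ _ => u0 n)).
  by rewrite big_nat_recr//= leeDr// sume_ge0.
have aM k : `|a k.+1 - a k| <= Num.sqrt M * (2^-1) ^+ k.
  rewrite -(@ler_pXn2r _ 2)// ?nnegrE ?mulr_ge0 ?sqrtr_ge0 ?exprn_ge0 ?invr_ge0//.
  apply: le_trans (ab k) _; rewrite exprMn sqr_sqrtr// -exprM mulnC exprM.
  have -> : (2^-1 : R) ^+ 2 = 4^-1 by lra.
  by rewrite exprVn ler_pdivlMr ?exprn_gt0// mulrC.
rewrite (_ : a = (fun n => a 0%N + series (telescope a) n)); last first.
  by apply/funext => n; exact: eq_sum_telescope.
apply: is_cvgD; first exact: is_cvg_cst.
apply: normed_cvg.
apply: (@series_le_cvg _ _ (geometric (Num.sqrt M) (2^-1))).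
- by move=> n /=.
- by move=> n; rewrite /= mulr_ge0 ?sqrtr_ge0 ?exprn_ge0 ?invr_ge0.
- exact: aM.
- apply: is_cvg_geometric_series; rewrite ger0_norm; lra.
Qed.

(** Riesz-Fischer. Along a subsequence with increments below 4^-k, the weighted sum of the
    square increments is integrable, hence finite almost everywhere, which gives pointwise
    convergence off a null set; Fatou's lemma then identifies the pointwise limit as the limit
    in norm. *)
Theorem L2_complete : complete_space dot.
Proof.
move=> u0; pose u : nat -> L2 nu := u0; rewrite -[u0]/u => cu.
have ex k : exists N, forall m n, (N <= m)%N -> (N <= n)%N ->
    hnorm dot (u m - u n) < (4^-1) ^+ k.
  by apply: cu; rewrite exprn_gt0// invr_gt0.
have [N NP] := choice ex.
(* The index is forced to increase strictly, so that s k >= k. *)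
pose s := fix s k := if k is k'.+1 then maxn (s k').+1 (N k) else N 0%N.
have sN k : (N k <= s k)%N by case: k => //= k; exact: leq_maxr.
have sS k : (s k < s k.+1)%N by exact: leq_maxl.
pose v k : L2 nu := u (s k).
have vS k : sqnorm dot (v k.+1 - v k) <= (16^-1) ^+ k.
  rewrite -hnorm2; have -> : (16^-1 : R) = 4^-1 ^+ 2 by lra.
  rewrite -exprM mulnC exprM ler_pXn2r ?nnegrE ?hnorm_ge0 ?exprn_ge0 ?invr_ge0//.
  by apply/ltW/NP => //; exact: leq_trans (sN k) (ltnW (sS k)).
have mv k : measurable_funC (v k) by have [] := L2P (v k).
have md k : measurable_funC (fun x => v k.+1 x - v k x).
  by apply: measurable_funCD => //; exact: measurable_funCN.
pose D x k := sqnormc (v k.+1 x - v k x).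
pose F x := (\sum_(0 <= k <oo) (4 ^+ k * D x k)%:E)%E.
have mD k : measurable_fun setT (fun x => (4 ^+ k * D x k)%:E).
  rewrite (_ : (fun x => _) = (fun x => (4 ^+ k)%:E * (D x k)%:E)%E); last first.
    by apply/funext => x; rewrite EFinM.
  exact/measurable_funeM/measurable_sqnormc.
have D0 k x : (0 <= (4 ^+ k * D x k)%:E :> \bar R)%E.
  by rewrite lee_fin mulr_ge0// sqr_ge0.
have mF : measurable_fun setT F by apply: ge0_emeasurable_sum.
have F0 x : (0 <= F x)%E by apply: nneseries_ge0.
have intF : (\int[nu]_x F x < +oo)%E.
  rewrite integral_nneseries//.
  apply: (@le_lt_trans _ _ (\sum_(0 <= k <oo) (1 / (2 ^ (k + 0))%:R)%:E)%E).
    apply: lee_nneseries => [k _ _|k _]; first by apply: integral_ge0 => x _; exact: D0.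
    under eq_integral do rewrite EFinM.
    rewrite ge0_integralZl//; last 2 first.
      exact: measurable_sqnormc.
      by move=> x _; rewrite lee_fin sqr_ge0.
    rewrite -L2_sqnormB -EFinM lee_fin.
    apply: (@le_trans _ _ (4 ^+ k * 16^-1 ^+ k)); first by rewrite ler_wpM2l.
    rewrite -exprMn addn0 natrX div1r -exprVn lerXn2r ?nnegrE ?mulr_ge0 ?invr_ge0//.
    lra.
  have := @cvg_geometric_eseries_half R 2 0.
  move=> /cvg_lim h; rewrite (_ : (\sum_(0 <= k <oo) _)%E = (2 / 2 ^+ 0)%:E) ?ltry//.
  rewrite -[RHS]h//; apply: congr_lim; apply/funext => n.
  apply: eq_bigr => k _; congr EFin.
  by rewrite addn1 addn0 expnS natrM invfM mulrA mulfV// .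
have aeF : {ae nu, forall x, F x \is a fin_num}.
  have : nu.-integrable setT F.
    apply/integrableP; split => //.
    by under eq_integral do rewrite gee0_abs//.
  by move=> /(integrable_ae measurableT); apply: filterS => x; apply.
have [Z [mZ Z0 FZ]] := aeF.
have aeZ : {ae nu, forall x, ~ Z x} by exists Z; split=> // x /contrapT.
have finF x : ~ Z x -> (F x < +oo)%E.
  by move=> nZ; rewrite -ge0_fin_numE//; apply: contrapT => /FZ.
pose cut (g : T -> R) x := g x * \1_(~` Z) x.
have mcut g : measurable_fun setT g -> measurable_fun setT (cut g).
  move=> mg; apply: measurable_funM => //; apply: measurable_indic.
  exact: measurableC.
have cvcut (p : C -> R) x : (forall z, `|p z| ^+ 2 <= sqnormc z) ->
    (forall z z', p (z - z') = p z - p z') -> cvgn (fun k => cut (p \o v k) x).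
  move=> ple pB; have [Zx|nZx] := pselect (Z x).
    rewrite /cut indicE memNset; last by move=> nZx; exact: nZx.
    under eq_fun do rewrite mulr0.
    exact: is_cvg_cst.
  rewrite /cut indicE mem_set//.
  under eq_fun do rewrite mulr1.
  by apply: (@cvg_of_summable _ (D x)); [exact: finF|move=> k /=; rewrite -pB].
have ReB (z z' : C) : complex.Re (z - z') = complex.Re z - complex.Re z'.
  by case: z; case: z'.
have ImB (z z' : C) : complex.Im (z - z') = complex.Im z - complex.Im z'.
  by case: z; case: z'.
have cvRe x := cvcut (@complex.Re R) x sqr_normr_Re ReB.
have cvIm x := cvcut (@complex.Im R) x sqr_normr_Im ImB.
pose fr x := limn (fun k => cut (@complex.Re R \o v k) x).
pose fi x := limn (fun k => cut (@complex.Im R \o v k) x).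
pose f x : C := Complex (fr x) (fi x).
have mf : measurable_funC f.
  split.
    apply: (@measurable_fun_cvg _ _ _ _ (fun k => cut (@complex.Re R \o v k))).
      by move=> k; apply: mcut; have [] := mv k.
    by move=> x _; exact: cvRe.
  apply: (@measurable_fun_cvg _ _ _ _ (fun k => cut (@complex.Im R \o v k))).
    by move=> k; apply: mcut; have [] := mv k.
  by move=> x _; exact: cvIm.
have mfu n : measurable_funC (fun x => f x - u n x).
  by apply: measurable_funCD => //; apply: measurable_funCN; have [] := L2P (u n).
have mvu k n : measurable_funC (fun x => v k x - u n x).
  by apply: measurable_funCD => //; apply: measurable_funCN; have [] := L2P (u n).
have le_fu e n K : (forall k, (K <= k)%N -> sqnorm dot (v k - u n) <= e) ->
    (\int[nu]_x (sqnormc (f x - u n x))%:E <= e%:E)%E.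
  move=> ke; pose h k x := (sqnormc (v (k + K)%N x - u n x))%:E.
  have mh k : measurable_fun setT (h k) by exact: measurable_sqnormc.
  have h0 k x : setT x -> (0 <= h k x)%E by move=> _; rewrite lee_fin sqr_ge0.
  have := fatou nu measurableT mh h0.
  have -> : (\int[nu]_x limn_einf (h^~ x) = \int[nu]_x (sqnormc (f x - u n x))%:E)%E.
    apply: ae_eq_integral => //.
    - apply: (@measurableT_comp _ _ _ _ _ _ oppe) => //.
      by apply: measurable_fun_limn_esup => k; exact: measurableT_comp.
    - exact: measurable_sqnormc.
    apply: filterS aeZ => x nZx _.
    have cutE p k : cut (p \o v k) x = p (v k x).
      by rewrite /cut indicE mem_set// mulr1.
    have cRe : complex.Re (v k x) @[k --> \oo] --> fr x.
      have <- : (fun k => cut (@complex.Re R \o v k) x) = (fun k => complex.Re (v k x)).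
        by apply/funext => k; rewrite cutE.
      exact: cvRe.
    have cIm : complex.Im (v k x) @[k --> \oo] --> fi x.
      have <- : (fun k => cut (@complex.Im R \o v k) x) = (fun k => complex.Im (v k x)).
        by apply/funext => k; rewrite cutE.
      exact: cvIm.
    have cR2 : complex.Re (v (k + K)%N x) @[k --> \oo] --> fr x.
      by rewrite (cvg_shiftn K (fun k => complex.Re (v k x))).
    have cI2 : complex.Im (v (k + K)%N x) @[k --> \oo] --> fi x.
      by rewrite (cvg_shiftn K (fun k => complex.Im (v k x))).
    have ch : h k x @[k --> \oo] --> (sqnormc (f x - u n x))%:E.
      apply: cvg_EFin; first exact: nearW.
      have -> : fine \o h^~ x = fun k =>
        (complex.Re (v (k + K)%N x) - complex.Re (u n x)) ^+ 2 +
        (complex.Im (v (k + K)%N x) - complex.Im (u n x)) ^+ 2.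
        by apply/funext => k; rewrite /= sqnormcE ReB ImB.
      rewrite sqnormcE ReB ImB /=.
      by apply: cvgD; rewrite !expr2; apply: cvgM; apply: cvgB => //; exact: cvg_cst.
    by have [-> _] := cvg_limn_einf_sup ch.
  move=> /le_trans; apply.
  rewrite limn_einf_lim; apply: lime_le; first exact: is_cvg_einfs.
  apply: nearW => k; apply: (@le_trans _ _ (\int[nu]_x h k x)%E).
    by apply: ereal_inf_lbound; exists k => /=.
  by rewrite /h -L2_sqnormB lee_fin; apply: ke; exact: leq_addl.
have sqC (z z' : C) : sqnormc (z - z') = sqnormc (z' - z).
  by rewrite !sqnormcE !ReB !ImB; lra.
have fuN e : 0 < e -> exists N, forall n, (N <= n)%N ->
    (\int[nu]_x (sqnormc (f x - u n x))%:E <= (e ^+ 2)%:E)%E.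
  move=> e0; have [M MP] := cu e e0; exists M => n Mn.
  apply: (le_fu _ _ M) => k Mk; rewrite -hnorm2 ler_pXn2r ?nnegrE ?hnorm_ge0 ?(ltW e0)//.
  apply/ltW/MP => //; apply: leq_trans Mk _.
  by elim: k => // k IH; apply: leq_ltn_trans IH _.
have lf : square_integrable nu f.
  have [M MP] := fuN 1 ltr01.
  have h : square_integrable nu (fun x => f x - u M x).
    by split=> //; apply: le_lt_trans (MP M (leqnn _)) _; rewrite ltry.
  have := square_integrableD h (L2P (u M)).
  by congr square_integrable; apply/funext => x; rewrite subrK.
exists (L2class lf) => e e0.
have [M MP] := fuN (e / 2) ltac:(by rewrite divr_gt0); exists M => n Mn.
rewrite hnormC -(@ltr_pXn2r _ 2)// ?nnegrE ?hnorm_ge0 ?(ltW e0)// hnorm2.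
apply: (@le_lt_trans _ _ ((e / 2) ^+ 2)); last first.
  by rewrite ltr_pXn2r ?nnegrE ?(ltW e0)// ?divr_ge0 ?(ltW e0)//; lra.
rewrite -lee_fin; apply: le_trans (MP n Mn); rewrite le_eqVlt; apply/orP; left.
apply/eqP/L2_sqnorm_ae => //.
by apply: filterS2 (L2_subrE (L2class lf) (u n)) (L2classE lf) => x -> ->.
Qed.

End L2_complete.

(** * The measure on the orbit relation *)

Section integral_tools.
Context d (T : measurableType d) (R : realType) (mu : {measure set T -> \bar R}).

(** The integral of a nonnegative function is a supremum over the simple functions below it,
    so it is monotone without measurability. This avoids proving that the cardinality of the
    fibers of a subset of the orbit relation depends measurably on the base point. *)
Lemma ge0_le_integral_nonmeasurable (f g : T -> \bar R) :
  (forall x, 0 <= f x)%E -> (forall x, f x <= g x)%E ->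
  (\int[mu]_x f x <= \int[mu]_x g x)%E.
Proof.
move=> f0 fg; have g0 x : (0 <= g x)%E by exact: le_trans (fg x).
rewrite !ge0_integralTE//; apply: ereal_sup_le.
by move=> _ [h /= hf <-]; exists h => //= x; exact: le_trans (fg x).
Qed.

End integral_tools.

Section nu_tools.
Context d (X : measurableType d) (R : realType) (mu : probability X R).
Context (G : groupType) (act : G -> X -> X).
Context (countG : countable [set: G]) (lebX : lebesgue_space mu).
Context (pmp : pmp_action mu act).
Local Notation C := R[i].
Local Notation nu := (orbit_measure countG lebX pmp).
Local Notation dot := (@L2dot _ _ _ nu).
Local Notation pi := (groupoid_rep countG lebX pmp).
Implicit Types (g h : G) (y : X) (B : set (X * X)) (P : set (X * X)).

Lemma surjective_enum : exists enum : nat -> G, forall g, exists n, enum n = g.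
Proof.
have /countable_injP[f finj] := countG.
exists (fun n => xget 1%g [set g | f g = n]) => g; exists (f g).
have /= := @xgetPex _ 1%g [set h | f h = f g] (ex_intro _ g erefl).
by move=> h; apply: finj h; rewrite inE.
Qed.

Lemma ae_forall_group d' (T : measurableType d') (m : {measure set T -> \bar R})
    (P : G -> T -> Prop) :
  (forall g, {ae m, forall x, P g x}) -> {ae m, forall x, forall g, P g x}.
Proof.
have [e eP] := surjective_enum => h.
have : {ae m, forall x, forall n, P (e n) x} by apply/ae_foralln => n; exact: h.
by apply: filterS => x hx g; have [n <-] := eP g.
Qed.

Lemma measurable_bigcup_group d' (T : measurableType d') (F : G -> set T) :
  (forall g, measurable (F g)) -> measurable (\bigcup_g F g).
Proof.
have [e eP] := surjective_enum => mF.
rewrite (_ : \bigcup_g F g = \bigcup_n F (e n)); first exact: bigcupT_measurable.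
apply/seteqP; split=> [x [g _ Fx]|x [n _ Fx]]; last by exists (e n).
by have [n en] := eP g; exists n => //; rewrite en.
Qed.

(** The graphs of the group elements cover the orbit relation, and each meets the fiber over y
    in one point; statements about nu are reduced to statements about mu along them. *)
Definition graph g y : X * X := (act g y, y).

Lemma measurable_graph g : measurable_fun setT (graph g).
Proof.
by apply: measurable_fun_pair; [exact: (act_measurable pmp)|exact: measurable_id].
Qed.

Lemma measurable_graph_preimage g B : measurable B -> measurable (graph g @^-1` B).
Proof. by move=> mB; rewrite -[X in measurable X]setTI; exact: measurable_graph. Qed.

Lemma measurable_act_preimage g (A : set X) : measurable A -> measurable (act g @^-1` A).
Proof. by move=> mA; rewrite -[X in measurable X]setTI; exact: (act_measurable pmp). Qed.

Lemma ae_act g (P : X -> Prop) :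
  {ae mu, forall x, P x} -> {ae mu, forall x, P (act g x)}.
Proof.
move=> [N [mN N0 PN]]; exists (act g @^-1` N); split.
- exact: measurable_act_preimage.
- by rewrite (act_preserving pmp).
- by move=> x /= Px; exact: PN.
Qed.

Definition fiber B y := B `&` orbit_relation act `&` (setT `*` [set y]).

Lemma fiber_graph B g y : fiber B y (graph g y) <-> B (graph g y).
Proof.
split=> [[[//]]|Bg]; split => //; split => //.
by exists g^-1%g; rewrite /= (actK pmp).
Qed.

Lemma fiber_in B y p : fiber B y p -> exists g, p = graph g y /\ B (graph g y).
Proof.
case: p => x z [[Bp [g /= zE]] [_ /= yE]]; exists g^-1%g.
have xE : act g^-1%g y = x by rewrite -yE zE (actK pmp).
by rewrite /graph xE -yE.
Qed.

Lemma counting_ge1 (S : choiceType) (A : set S) : A !=set0 -> (1 <= counting A :> \bar R)%E.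
Proof.
move=> /set0P A0; rewrite /counting; case: asboolP => [fA|_]; last exact: leey.
by rewrite lee_fin ler1n lt0n cardfs_eq0 -fset_set0 //; apply: contra_neq A0 => /fset_set_inj ->.
Qed.

Lemma le_orbit_measure B (Y : set X) (c : R) : measurable Y -> 0 <= c ->
  (forall y, Y y -> (c%:E <= counting (fiber B y))%E) ->
  (c%:E * mu Y <= nu B)%E.
Proof.
move=> mY c0 h.
have -> : (c%:E * mu Y = \int[mu]_y (c%:E * (\1_Y y)%:E))%E.
  rewrite ge0_integralZl ?integral_indic ?setIT//.
  by apply/measurable_EFinP; exact: measurable_indic.
apply: ge0_le_integral_nonmeasurable => y; first by rewrite mule_ge0// lee_fin.
rewrite indicE; have [Yy|Yy] := boolP (y \in Y).
  by rewrite mule1; apply: h; rewrite inE in Yy.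
by rewrite mule0 /counting; case: ifP => _ //; rewrite lee_fin.
Qed.

(** The fibers of B are empty off the countable union of the null sets where some graph
    meets B. *)
Lemma orbit_measure_null B : measurable B ->
  (forall g, mu (graph g @^-1` B) = 0%E) -> nu B = 0%E.
Proof.
move=> mB h.
have [N [mN N0 HN]] : {ae mu, forall y, forall g, ~ B (graph g y)}.
  apply: ae_forall_group => g; exists (graph g @^-1` B); split; [|exact: h|].
    exact: measurable_graph_preimage.
  by move=> y /= /contrapT.
apply/eqP; rewrite eq_le measure_ge0 andbT.
apply: (@le_trans _ _ (\int[mu]_y ((cst +oo%E) \_ N) y)%E); last first.
  by rewrite -integral_mkcond null_set_integral.
apply: ge0_le_integral_nonmeasurable => y.
  by rewrite /counting; case: ifP => _ //; rewrite lee_fin.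
rewrite patchE -[_ `&` _ `&` _]/(fiber B y); have [Ny|Ny] := boolP (y \in N); first exact: leey.
rewrite (_ : fiber B y = set0) ?measure0//; apply/seteqP; split=> p // /fiber_in[g [_ Bg]].
by move/negP: Ny; apply; rewrite inE; apply: HN => /= /(_ g).
Qed.

(** Over each y the fiber of B is empty or the single point of the graph. *)
Lemma orbit_measure_graph g B : measurable B ->
  (forall y p, fiber B y p -> p = graph g y) -> nu B = mu (graph g @^-1` B).
Proof.
move=> mB h; have mgB := measurable_graph_preimage g mB.
rewrite -[in RHS](setIT (graph g @^-1` B)) -(integral_indic _ measurableT)//.
apply: eq_integral => y _; rewrite indicE -[_ `&` _ `&` _]/(fiber B y).
have [Bg|Bg] := pselect (B (graph g y)).
  rewrite mem_set//; rewrite (_ : fiber B y = [set graph g y]).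
    by rewrite /counting asboolT// fset_set1 cardfs1.
  apply/seteqP; split=> p; first exact: h.
  by move=> /= ->; exact/fiber_graph.
rewrite memNset// (_ : fiber B y = set0) ?measure0//.
by apply/seteqP; split=> p // fp; apply: Bg; rewrite -(h _ _ fp); have [[]] := fp.
Qed.

Lemma ae_graph (P : X * X -> Prop) g :
  {ae nu, forall p, P p} -> {ae mu, forall y, P (graph g y)}.
Proof.
move=> [N [mN N0 PN]]; exists (graph g @^-1` N); split.
- exact: measurable_graph_preimage.
- have mY := measurable_graph_preimage g mN.
  apply/eqP; rewrite eq_le measure_ge0 andbT -[leLHS]mul1e -N0.
  apply: le_orbit_measure => // y Ny; apply: counting_ge1.
  by exists (graph g y); exact/fiber_graph.
- by move=> y /= Py; exact: PN.
Qed.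

End nu_tools.

Section separator.
Context d (X : measurableType d) (R : realType) (mu : probability X R).

(** A real-valued function that is injective off a null set replaces countable separation: the
    diagonal of X need not be measurable in the product sigma-algebra, but it agrees up to a
    nu-null set with the set where m takes equal values. *)
Record separator (E : set X) (m : X -> R) : Prop := {
  sep_measurable : measurable E ;
  sep_ae : {ae mu, forall x, E x} ;
  sep_fun : measurable_fun setT m ;
  sep_inj : {in E &, injective m} }.

Lemma measurable_countable_subset (D : set X) : countable D ->
  (forall x, D x -> measurable [set x]) -> forall B, B `<=` D -> measurable B.
Proof.
move=> cD mD B BD; have /countable_injP[f finj] := sub_countable (subset_card_le BD) cD.
rewrite (_ : B = \bigcup_n (B `&` f @^-1` [set n])); last first.
  by rewrite -setI_bigcupr -preimage_bigcup bigcup_imset1 image_id setIT.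
apply: bigcupT_measurable => n.
have [[x [Bx fx]]|no] := pselect (exists x, B x /\ f x = n).
  rewrite (_ : _ `&` _ = [set x]); first exact/mD/BD.
  apply/seteqP; split=> [y [By /= fy]|y /= ->//].
  by apply: finj; rewrite ?inE// fx fy.
rewrite (_ : _ `&` _ = set0)//; apply/seteqP; split=> [y [By fy]|//].
by case: no; exists y.
Qed.

(** Use the coordinate in the interval on the continuous part, which is nonnegative, and
    distinct negative numbers on the countable part. *)
Lemma exists_separator : lebesgue_space mu -> exists E m, separator E m.
Proof.
move=> [_ [D [X0 [a [Y0 [phi [[cD mD mX0 DX0 E1]]]]]]]].
move=> [mY0 Y0a _ [phiY0 phiI phiS] phim].
have mDs := measurable_countable_subset cD mD.
have mphi : measurable_fun X0 (phi : X -> measurableTypeR R).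
  move=> _ B mB.
  have sX : X0 `&` phi @^-1` B `<=` X0 by move=> x [].
  apply/(phim _ sX).1.
  rewrite (_ : phi @` _ = Y0 `&` B); last first.
    apply/seteqP; split=> [_ [x [X0x Bx] <-]|y [Y0y By]].
      by split => //; exact: phiY0.
    have [x X0x xy] := phiS _ Y0y.
    by exists x => //; split => //; rewrite /preimage /= xy.
  by apply: measurableI => //; exact: sub_caratheodory.
have /countable_injP[f finj] := cD.
pose g x : R := - 1 - (f x)%:R.
exists (D `|` X0), (fun x => if x \in X0 then phi x else if x \in D then g x else 0).
have phi0 x : X0 x -> 0 <= (phi x : R).
  by move=> /phiY0/Y0a; rewrite /= in_itv /= => /andP[].
split.
- by apply: measurableU => //; exact: mDs.
- exists (~` (D `|` X0)); split => //; apply: measurableC.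
  by apply: measurableU => //; exact: mDs.
- rewrite (_ : setT = X0 `|` (D `|` ~` (D `|` X0))); last first.
    apply/seteqP; split=> // x _.
    have [X0x|nX0x] := pselect (X0 x); first by left.
    by have [Dx|nDx] := pselect (D x); right; [left|right => -[]].
  have mR : measurable (~` (D `|` X0)).
    by apply/measurableC/measurableU => //; exact: mDs.
  apply/measurable_funU => //; first by apply: measurableU => //; exact: mDs.
  split.
    apply: (eq_measurable_fun (phi : X -> measurableTypeR R)) mphi.
    by move=> x ->.
  apply/measurable_funU => //; first exact: mDs.
  split.
    by move=> _ B _; apply: mDs => x [].
  apply: (@eq_measurable_fun _ _ _ _ _ (cst (0 : R))); last exact: measurable_cst.
  move=> x; rewrite inE => /not_orP[nDx nX0x].
  by rewrite !memNset.
- move=> x y; rewrite !inE => xE yE.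
  have g0 z : g z < 0 by rewrite /g; have := ler0n R (f z); lra.
  have [X0x|nX0x] := boolP (x \in X0); have [X0y|nX0y] := boolP (y \in X0).
  + by apply: phiI.
  + case: ifP => [_ e|]; last by case: yE => [/mem_set ->//|/mem_set]; rewrite (negbTE nX0y).
    by rewrite inE in X0x; have := phi0 _ X0x; rewrite e leNgt g0.
  + case: ifP => [_ e|]; last by case: xE => [/mem_set ->//|/mem_set]; rewrite (negbTE nX0x).
    by rewrite inE in X0y; have := phi0 _ X0y; rewrite -e leNgt g0.
  + have Dx : x \in D by case: xE => /mem_set //; rewrite (negbTE nX0x).
    have Dy : y \in D by case: yE => /mem_set //; rewrite (negbTE nX0y).
    rewrite Dx Dy /g => /addrI/oppr_inj/eqP; rewrite eqr_nat => /eqP.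
    exact: finj.
Qed.

End separator.

(** * The groupoid representation and the localization operators *)

Section representation.
Context d (X : measurableType d) (R : realType) (mu : probability X R).
Context (G : groupType) (act : G -> X -> X).
Context (countG : countable [set: G]) (lebX : lebesgue_space mu).
Context (pmp : pmp_action mu act).
Local Notation C := R[i].
Local Notation nu := (orbit_measure countG lebX pmp).
Local Notation dot := (@L2dot _ _ _ nu).
Local Notation pi := (groupoid_rep countG lebX pmp).
Local Notation hnorm := (hnorm dot).
Local Notation sqnorm := (sqnorm dot).
Local Notation graph := (graph act).
Implicit Types (g h : G) (y : X) (B : set (X * X)) (u v w : L2 nu) (A : set X).

(** Conversely to [ae_graph]. The set where P fails need not be measurable. It is contained in
    a null set, because P holds at (x, y) when x agrees with some g y in the separating
    coordinate and y avoids the null set of base points above which some graph is bad. *)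
Lemma ae_orbit (P : X * X -> Prop) :
  (forall g, {ae mu, forall y, P (graph g y)}) -> {ae nu, forall p, P p}.
Proof.
move=> h; have [E [m [mE E1 mm minj]]] := exists_separator lebX.
have [N [mN N0 HN]] : {ae mu, forall y, forall g, [/\ P (graph g y), E (act g y) & E y]}.
  apply: (ae_forall_group countG) => g.
  by apply: filterS3 (h g) (ae_act pmp g E1) E1 => y.
(* K is a measurable substitute for the orbit relation. *)
pose K := [set p : X * X | [/\ E p.1, E p.2 & exists g, m p.1 = m (act g p.2)]].
have mK : measurable K.
  rewrite (_ : K = (E `*` E) `&` \bigcup_g
      [set p : X * X | (m p.1 - m (act g p.2)) = 0]); last first.
    apply/seteqP; split=> [[x y] [/= Ex Ey [g e]]|[x y] [[/= Ex Ey] [g _ e]]].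
      by split => //; exists g => //=; rewrite e subrr.
    by split => //; exists g; apply/eqP; rewrite -subr_eq0 e.
  apply: measurableI; first exact: measurableX.
  apply: (measurable_bigcup_group countG) => g; rewrite -[X in measurable X]setTI.
  have mF : measurable_fun setT (fun p : X * X => m p.1 - m (act g p.2)).
    apply: measurable_funB; first exact: (measurableT_comp mm measurable_fst).
    apply: (measurableT_comp mm).
    exact: (measurableT_comp (act_measurable pmp g) measurable_snd).
  exact: (mF measurableT [set 0] (measurable_set1 0)).
have mNT : measurable ([set: X] `*` N) by exact: measurableX.
have mL : measurable (~` K `|` ([set: X] `*` N)).
  by apply: measurableU => //; exact: measurableC.
exists (~` K `|` ([set: X] `*` N)); split => //.
- apply: (orbit_measure_null countG lebX pmp mL) => g.
  apply/eqP; rewrite eq_le measure_ge0 andbT -N0; apply: le_measure; rewrite ?inE//.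
    exact: (measurable_graph_preimage pmp).
  move=> y [nK|[]//]; apply: HN => /(_ g)[_ Eg Ey]; apply: nK; split => //.
  by exists g.
- move=> [x y] /= nP; have [Kp|] := pselect (K (x, y)); last by left.
  right; split=> //=; apply: HN => good; apply: nP.
  have [/= Ex Ey [g e]] := Kp; have [Pg Eg _] := good g.
  suff -> : x = act g y by [].
  by apply: minj; rewrite ?inE.
Qed.

Lemma L2_eq_orbit u v :
  (forall g, {ae mu, forall y, u (graph g y) = v (graph g y)}) -> u = v.
Proof. by move=> h; apply/L2_eqP/ae_orbit. Qed.

Lemma ae_translate g (P : X * X -> Prop) :
  {ae nu, forall p, P p} -> {ae nu, forall p, P (translate act g p)}.
Proof.
move=> [N [mN N0 PN]]; exists (translate act g @^-1` N); split.
- by rewrite -[X in measurable X]setTI; exact: (measurable_translate pmp).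
- by rewrite -[RHS]N0; exact: orbit_measure_translate.
- by move=> p /= Pp; exact: PN.
Qed.

Lemma repE g u : {ae nu, forall p, pi g u p = u (translate act g p)}.
Proof. exact: L2classE. Qed.

Lemma rep_linear g : linear (pi g).
Proof.
move=> c u v; apply/L2_eqP.
apply: filterS3 (filterI (repE g (c *: u + v)) (L2_addrE (c *: pi g u) (pi g v)))
  (filterI (filterI (L2_scalerE c (pi g u)) (repE g u)) (repE g v))
  (filterI (ae_translate g (L2_addrE (c *: u) v)) (ae_translate g (L2_scalerE c u))).
by move=> p [-> ->] [[-> ->] ->] [-> ->].
Qed.

Lemma rep_hnorm g u : hnorm (pi g u) = hnorm u.
Proof.
apply: eq_hnorm; apply: EFin_inj.
have mt := measurable_translate pmp g.
have [[mr mi] _] := L2P u.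
rewrite (@L2_sqnorm_ae _ _ _ _ _ (fun p => u (translate act g p))); last 2 first.
- split; first exact: (measurableT_comp mr mt).
  exact: (measurableT_comp mi mt).
- exact: repE.
have msq : measurable_fun setT (fun p => (sqnormc (u p))%:E) by exact: measurable_sqnormc.
rewrite -[LHS](@ge0_integral_pushforward _ _ _ _ _ _ mt nu setT _ measurableT msq).
  rewrite L2_sqnormE; apply: eq_measure_integral => B mB _.
  by rewrite /pushforward; exact: orbit_measure_translate.
by move=> x _; rewrite lee_fin sqr_ge0.
Qed.

Lemma rep1 u : pi 1%g u = u.
Proof.
apply/L2_eqP; apply: filterS (repE 1%g u) => -[x y] ->.
by rewrite /translate /= invg1 (act1 pmp).
Qed.

Lemma repM g h u : pi (g * h)%g u = pi g (pi h u).
Proof.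
apply/L2_eqP; apply: filterS3 (repE (g * h)%g u) (repE g (pi h u))
  (ae_translate g (repE h u)) => -[x y] -> -> ->.
by rewrite /translate /= invgM (actM pmp).
Qed.

Lemma mult_opE m (hm : Linfty mu m) u :
  {ae nu, forall p, mult_op countG lebX pmp hm u p = m p.1 * u p}.
Proof. exact: L2classE. Qed.

Lemma mult_op_linear m (hm : Linfty mu m) : linear (mult_op countG lebX pmp hm).
Proof.
move=> c u v; apply/L2_eqP.
apply: filterS3 (filterI (mult_opE hm (c *: u + v))
  (L2_addrE (c *: mult_op countG lebX pmp hm u) (mult_op countG lebX pmp hm v)))
  (filterI (filterI (L2_scalerE c (mult_op countG lebX pmp hm u)) (mult_opE hm u))
     (mult_opE hm v))
  (filterI (L2_addrE (c *: u) v) (L2_scalerE c u)).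
move=> p [-> ->] [[-> ->] ->] [-> ->].
by rewrite mulrDr mulrCA.
Qed.

Lemma hnorm_le_ae u v (c : R) : 0 <= c ->
  {ae nu, forall p, Normc.normc (u p) <= c * Normc.normc (v p)} ->
  hnorm u <= c * hnorm v.
Proof.
move=> c0 uv; rewrite -(@ler_pXn2r _ 2)// ?nnegrE ?mulr_ge0 ?hnorm_ge0//.
rewrite exprMn !hnorm2 -lee_fin EFinM !L2_sqnormE.
have [mu' _] := L2P u; have [mv _] := L2P v.
rewrite -ge0_integralZl ?lee_fin ?sqr_ge0//; last 2 first.
- exact: measurable_sqnormc.
- by move=> p _; rewrite lee_fin sqr_ge0.
apply: ae_ge0_le_integral => //.
- by move=> p _; rewrite lee_fin sqr_ge0.
- exact: measurable_sqnormc.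
- by move=> p _; rewrite mule_ge0// lee_fin sqr_ge0.
- by apply: measurable_funeM; exact: measurable_sqnormc.
apply: filterS uv => p uv _; rewrite -EFinM lee_fin /sqnormc -exprMn.
by rewrite ler_pXn2r ?nnegrE ?mulr_ge0 ?normc_ge0.
Qed.

Lemma mult_op_hnorm m (hm : Linfty mu m) (c : R) u : 0 <= c ->
  {ae mu, forall x, Normc.normc (m x) <= c} ->
  hnorm (mult_op countG lebX pmp hm u) <= c * hnorm u.
Proof.
move=> c0 mc; apply: hnorm_le_ae => //.
apply: filterS2 (mult_opE hm u) (ae_orbit_measure_fst countG lebX pmp mc) => p -> mp.
by rewrite Normc.normcM ler_wpM2r ?normc_ge0.
Qed.

Lemma Linfty_indic A : measurable A -> Linfty mu (fun x => (\1_A x)%:C%C : C).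
Proof.
move=> mA; split.
  by split => /=; [exact: measurable_indic|exact: measurable_cst].
exists 1; apply: aeW => x; rewrite /= expr0n addr0 sqrtr_sqr indicE.
by case: (x \in A); rewrite ?normr1 ?normr0.
Qed.

(** Multiplication by the indicator of A in the first variable. It is total in A, so that set
    operations can be rewritten without carrying proofs of measurability. *)
Definition localize A u : L2 nu :=
  if pselect (measurable A) is left mA then mult_op countG lebX pmp (Linfty_indic mA) u
  else u.

Lemma localize_mult_op A (mA : measurable A) u :
  localize A u = mult_op countG lebX pmp (Linfty_indic mA) u.
Proof. by rewrite /localize; case: pselect => // mA'; congr mult_op; exact: Prop_irrelevance. Qed.

Lemma localizeE A u : measurable A ->
  {ae nu, forall p, localize A u p = (\1_A p.1)%:C%C * u p}.
Proof. by move=> mA; rewrite localize_mult_op; exact: mult_opE. Qed.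

Lemma localize_linear A : measurable A -> linear (localize A).
Proof. by move=> mA c u v; rewrite !localize_mult_op; exact: mult_op_linear. Qed.

Lemma localize_hnorm A u : hnorm (localize A u) <= hnorm u.
Proof.
rewrite /localize; case: pselect => // mA; rewrite -[leRHS]mul1r.
apply: mult_op_hnorm => //; apply: aeW => x.
rewrite /= expr0n addr0 sqrtr_sqr indicE.
by case: (x \in A); rewrite ?normr1 ?normr0.
Qed.

Lemma localizeI A A' u : measurable A -> measurable A' ->
  localize A (localize A' u) = localize (A `&` A') u.
Proof.
move=> mA mB; apply/L2_eqP.
apply: filterS3 (localizeE (localize A' u) mA) (localizeE u mB) (localizeE u (measurableI _ _ mA mB)).
by move=> p -> -> ->; rewrite indicI /= rmorphM mulrA.
Qed.

Lemma localizeC A u : measurable A -> localize (~` A) u = u - localize A u.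
Proof.
move=> mA; apply/L2_eqP.
apply: filterS3 (localizeE u (measurableC mA)) (localizeE u mA) (L2_subrE u (localize A u)).
move=> p -> h ->; rewrite h !indicE in_setC.
by case: (p.1 \in A); rewrite ?mul1r ?mul0r ?subrr ?subr0.
Qed.

Lemma localize0 u : localize set0 u = 0.
Proof.
apply: (@hnorm_eq0 _ _ dot); apply/eqP; rewrite eq_le hnorm_ge0 andbT -[leRHS](mul0r (hnorm u)).
apply: hnorm_le_ae => //; apply: filterS (localizeE u measurable0) => p ->.
by rewrite indicE in_set0 (mul0r (u p)) Normc.normc0 mul0r.
Qed.

Lemma localizeT u : localize setT u = u.
Proof. by rewrite -setC0 localizeC// localize0 subr0. Qed.

(** Dominated convergence. *)
Lemma localize_small (D : nat -> set X) u : (forall n, measurable (D n)) ->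
  (forall x, exists N, forall n, (N <= n)%N -> ~ D n x) ->
  forall e : R, 0 < e -> exists N, forall n, (N <= n)%N -> hnorm (localize (D n) u) < e.
Proof.
move=> mD Dx e e0; have [mu' fu] := L2P u.
pose f n p := (sqnormc ((\1_(D n) p.1)%:C%C * u p))%:E.
have mf n : measurable_funC (fun p => (\1_(D n) p.1)%:C%C * u p).
  have [[m1 m2] _] := Linfty_indic (mD n).
  apply: measurable_funCM => //; split.
    exact: (measurableT_comp m1 measurable_fst).
  exact: (measurableT_comp m2 measurable_fst).
have [] := @dominated_convergence _ _ _ nu setT measurableT f (cst 0%E)
  (fun p => (sqnormc (u p))%:E).
- by move=> n; exact: measurable_sqnormc.
- exact: measurable_cst.
- apply: aeW => p _; apply: cvg_near_cst; have [N NP] := Dx p.1.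
  exists N => // n /= Nn; rewrite /f indicE memNset; last exact: NP.
  by rewrite mul0r /sqnormc Normc.normc0 expr0n.
- apply/integrableP; split; first exact: measurable_sqnormc.
  by under eq_integral do rewrite gee0_abs ?lee_fin ?sqr_ge0//.
- apply: aeW => p n _; rewrite gee0_abs ?lee_fin ?sqr_ge0// /f /sqnormc Normc.normcM exprMn.
  rewrite -[leRHS]mul1r ler_wpM2r ?sqr_ge0// /= expr0n addr0 sqr_sqrtr ?sqr_ge0//.
move=> _ _; rewrite integral0.
rewrite (_ : [sequence _]_n = fun n => (sqnorm (localize (D n) u))%:E); last first.
  by apply/funext => n; rewrite /= (L2_sqnorm_ae (mf n) (localizeE u (mD n))).
move=> /fine_cvg /cvgrPdist_lt /(_ (e ^+ 2)) /(_ (exprn_gt0 2 e0)) [N _ NP].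
exists N => n /NP /=; rewrite sub0r normrN ger0_norm ?sqnorm_ge0// -hnorm2.
by rewrite ltr_pXn2r ?nnegrE ?hnorm_ge0 ?(ltW e0).
Qed.

End representation.

(** * Averages over local subgroups converge to localization operators *)

Section approximation.
Context d (X : measurableType d) (R : realType) (mu : probability X R).
Context (G : groupType) (act : G -> X -> X).
Context (countG : countable [set: G]) (lebX : lebesgue_space mu).
Context (pmp : pmp_action mu act).
Local Notation C := R[i].
Local Notation nu := (orbit_measure countG lebX pmp).
Local Notation dot := (@L2dot _ _ _ nu).
Local Notation pi := (groupoid_rep countG lebX pmp).
Local Notation hnorm := (hnorm dot).
Local Notation localize := (@localize _ _ _ _ _ _ countG lebX pmp).
Local Notation graph := (graph act).
Implicit Types (g h : G) (y : X) (B : set (X * X)) (u v w : L2 nu) (A : set X).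
Implicit Types (s t : seq (C * G)).

(** Chebyshev's inequality. *)
Lemma level_set_finite v (k : nat) : exists2 B, measurable B &
  (forall p, B p <-> k.+1%:R^-1 <= sqnormc (v p)) /\ (nu B < +oo)%E.
Proof.
have [mv fv] := L2P v; have msq := measurable_sqnormc mv.
have k0 : 0 < (k.+1%:R^-1 : R) by rewrite invr_gt0.
pose B := [set p | (k.+1%:R^-1 <= sqnormc (v p))].
have mB : measurable B.
  have m : measurable_fun setT (fun p => sqnormc (v p)) by exact/measurable_EFinP.
  rewrite (_ : B = (fun p => sqnormc (v p)) @^-1` `[k.+1%:R^-1, +oo[%classic).
    by rewrite -[X in measurable X]setTI; apply: m => //; exact: measurable_itv.
  by apply/seteqP; split=> p /=; rewrite in_itv /= andbT.
exists B => //; split=> //.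
have h : ((k.+1%:R^-1)%:E * nu B <= \int[nu]_p (sqnormc (v p))%:E)%E.
  have -> : ((k.+1%:R^-1)%:E * nu B = \int[nu]_p ((k.+1%:R^-1)%:E * (\1_B p)%:E))%E.
    rewrite ge0_integralZl ?integral_indic ?setIT// ?lee_fin ?ltW//.
    by apply/measurable_EFinP; exact: measurable_indic.
  apply: ge0_le_integral_nonmeasurable => p.
    by rewrite mule_ge0// lee_fin// ltW.
  rewrite indicE; have [Bp|Bp] := boolP (p \in B).
    by rewrite mule1 lee_fin; rewrite inE in Bp.
  by rewrite mule0 lee_fin sqr_ge0.
rewrite ltey; apply/eqP => Boo; move: (le_lt_trans h fv).
by rewrite Boo gt0_muley// lte_fin.
Qed.

(** Over a typical y, the values of v at the points above y are invariant under the elements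
    supported in A. If one of them, at a point of A, is nonzero, then a level set of v has
    infinitely many points above y, since the orbit is infinite. As level sets have finite
    measure, this happens only for a null set of y. *)
Lemma fixed_vector_vanishes A v : measurable A ->
  {ae mu, forall x, A x -> infinite_set [set act g x | g in subgroup_on mu act A]} ->
  (forall g, subgroup_on mu act A g -> pi g v = v) -> localize A v = 0.
Proof.
move=> mA infA fixv; apply: L2_eq_orbit => h.
have aez : {ae mu, forall y, (0 : L2 nu) (graph h y) = 0}.
  exact: (ae_graph h (L2classE (square_integrable0 nu))).
have good1 : {ae mu, forall y, forall g, subgroup_on mu act A g ->
    v (graph (g * h)%g y) = v (graph h y)}.
  apply: (ae_forall_group countG) => g.
  have [Ag|nAg] := pselect (subgroup_on mu act A g); last exact: aeW.
  have e : {ae nu, forall p, v (translate act g p) = v p}.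
    by apply: filterS (repE g v) => p <-; rewrite fixv.
  apply: filterS (ae_graph (g * h)%g e) => y <- _.
  by rewrite /translate /graph /= -(actM pmp) mulgA mulVg mul1g.
have good2 := ae_act pmp h infA.
have [N [mN N0 HN]] := filterI good1 good2.
have small k : {ae mu, forall y, A (act h y) -> sqnormc (v (graph h y)) < k.+1%:R^-1}.
  have [B mB [BP Boo]] := level_set_finite v k.
  (* Every point of Y has an infinite fiber in the level set B, which has finite measure. *)
  pose Y := (graph h @^-1` B `&` act h @^-1` A) `\` N.
  have mY : measurable Y.
    apply: measurableD => //; apply: measurableI; first exact: (measurable_graph_preimage pmp).
    exact: (measurable_act_preimage pmp).
  have fibY y : Y y -> infinite_set (fiber act B y).
    move=> [[/= By Ay] nN]; have [g1 g2] := contra_notP (HN y) nN.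
    apply: contra_not (g2 Ay) => /(finite_image fst).
    apply: sub_finite_set => _ [g Ag <-].
    exists (graph (g * h)%g y); last by rewrite /= (actM pmp).
    by apply/(fiber_graph pmp)/BP; rewrite g1//; exact/BP.
  have Y0 : mu Y = 0%E.
    have cY (c : R) : 0 <= c -> (c%:E * mu Y <= nu B)%E.
      move=> c0; apply: le_orbit_measure => // y /fibY fy.
      by rewrite /counting asboolF// leey.
    have muYf : mu Y \is a fin_num by rewrite fin_num_measure.
    apply: contrapT => /eqP Yn0.
    have Yp : 0 < fine (mu Y).
      by rewrite fine_gt0// lt0e Yn0 measure_ge0 ltey_eq muYf.
    have Bf : nu B \is a fin_num by rewrite ge0_fin_numE.
    have := cY ((fine (nu B) + 1) / fine (mu Y)).
    rewrite -(fineK muYf) -EFinM -(fineK Bf) lee_fin mulfVK ?gt_eqF//.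
    have B0 : 0 <= fine (nu B) by exact: fine_ge0.
    rewrite divr_ge0 ?addr_ge0 ?(ltW Yp)// => /(_ isT); lra.
  exists (Y `|` N); split.
  - exact: measurableU.
  - by rewrite measureU0.
  - move=> y /=; have [Ny|nNy] := pselect (N y); first by right.
    move=> /not_implyP[Ay /negP]; rewrite -leNgt => /BP By.
    by left.
have small' : {ae mu, forall y, A (act h y) -> v (graph h y) = 0}.
  have := ae_foralln small.
  apply: filterS => y vy Ay; apply: Normc.eq0_normc; apply/eqP.
  rewrite -sqrf_eq0 eq_le sqr_ge0 andbT leNgt; apply/negP => vp.
  (* A positive value would exceed 1 / (k + 1) for large k. *)
  have := archi_boundP (_ : 0 <= (sqnormc (v (graph h y)))^-1).
  rewrite invr_ge0 ltW// => /(_ isT); set k := Num.Def.archi_bound _ => kP.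
  have := vy k Ay; rewrite ltNge => /negP; apply.
  rewrite invf_ple ?posrE//; apply: le_trans (ltW kP) _.
  by rewrite ler_nat.
apply: filterS3 aez (ae_graph h (localizeE v mA)) small' => y -> -> vy.
rewrite indicE; have [Ay|_] := boolP (_ \in A); last by rewrite mul0r.
by rewrite vy ?mulr0//; rewrite inE in Ay.
Qed.

(** Elements of the group algebra are represented by lists of weighted group elements, with no
    normal form, since only the operators and functionals that they define matter. *)
Definition op s u : L2 nu := \sum_(p <- s) p.1 *: pi p.2 u.

Lemma op_linear s : linear (op s).
Proof.
move=> c u v; rewrite /op scaler_sumr -big_split /=; apply: eq_bigr => p _.
by rewrite (rep_linear p.2 c u v) scalerDr !scalerA mulrC.
Qed.

Lemma op_cat s t u : op (s ++ t) u = op s u + op t u.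
Proof. by rewrite /op big_cat. Qed.

Definition scale_seq (c : C) s : seq (C * G) := [seq (c * p.1, p.2) | p <- s].
Lemma op_scale c s u : op (scale_seq c s) u = c *: op s u.
Proof.
by rewrite /op big_map scaler_sumr; apply: eq_bigr => p _; rewrite scalerA.
Qed.

Definition mul_seq s t : seq (C * G) := [seq (p.1 * q.1, (p.2 * q.2)%g) | p <- s, q <- t].
Lemma op_mul s t u : op (mul_seq s t) u = op s (op t u).
Proof.
rewrite /op big_allpairs_dep; apply: eq_bigr => p _ /=.
rewrite (lin_sum (rep_linear p.2)) scaler_sumr; apply: eq_bigr => q _.
by rewrite (linZ (rep_linear p.2)) scalerA repM.
Qed.

Definition one_seq : seq (C * G) := [:: (1, 1%g)].
Lemma op_one u : op one_seq u = u.
Proof. by rewrite /op big_seq1 scale1r rep1. Qed.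

Lemma averages_op (Gam : set G) a : averages [set pi g | g in Gam] a -> exists s, a = op s.
Proof.
elim=> [|_ b [g Ag <-] _ [s ->]|b c _ [s ->] _ [t ->]].
- by exists one_seq; apply/funext => u; rewrite op_one.
- exists (mul_seq [:: (1, g)] s); apply/funext => u.
  by rewrite op_mul {2}/op big_seq1 scale1r.
- exists (scale_seq 2^-1 (s ++ t)); apply/funext => u.
  by rewrite op_scale op_cat.
Qed.

(** Strong approximation on two vectors at once. One vector would not do: the commutation of
    1_A with an operator T needs the vectors u and T u, and compositions of approximations need
    a second vector as well. *)
Definition approximable A := forall u v (e : R), 0 < e -> exists s,
  hnorm (op s u - localize A u) < e /\ hnorm (op s v - localize A v) < e.


Lemma op_bounded s : exists2 M : R, 0 < M & forall u, hnorm (op s u) <= M * hnorm u.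
Proof.
elim: s => [|p s [M M0 IH]].
  by exists 1 => // u; rewrite /op big_nil hnorm_zero mul1r hnorm_ge0.
exists (Normc.normc p.1 + M); first by rewrite ltr_wpDl ?normc_ge0.
move=> u; rewrite /op big_cons -/(op s u) mulrDl.
by apply: le_trans (hnorm_triangle _ _ _) _; rewrite lerD// hnormZ rep_hnorm.
Qed.

Lemma averages_comp (Gam : set (L2 nu -> L2 nu)) a b :
  averages Gam a -> averages Gam b -> averages Gam (a \o b).
Proof.
move=> Ka Kb; elim: Ka => [//|g c Gg _ IH|c e _ IHc _ IHe].
- exact: (avg_act Gg IH).
- exact: (avg_mid IHc IHe).
Qed.

Lemma half_add u : 2^-1 *: (u + u) = u.
Proof.
rewrite -[u in u + _]scale1r -[u in _ + u]scale1r -scalerDl scalerA.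
by rewrite mulVf ?scale1r// pnatr_eq0.
Qed.

Lemma averages_fixed (Gam : set (L2 nu -> L2 nu)) a v :
  (forall f : L2 nu -> L2 nu, Gam f -> f v = v) -> averages Gam a -> a v = v.
Proof.
move=> fv; elim=> [//|g b Gg _ /= ->|b c _ -> _ ->]; first exact: fv.
exact: half_add.
Qed.

Lemma averages_hnorm (Gam : set G) a u : averages [set pi g | g in Gam] a -> hnorm (a u) <= hnorm u.
Proof.
elim=> [//|_ b [g _ <-] _ IH /=|b c _ IHb _ IHc]; first by rewrite rep_hnorm.
rewrite hnormZ normc_half.
have := hnorm_triangle dot (b u) (c u); lra.
Qed.

Lemma averages_linear (Gam : set G) a : averages [set pi g | g in Gam] a -> linear a.
Proof.
move=> /averages_op[s ->]; exact: op_linear.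
Qed.

(** Almost every point off A is fixed by g. *)
Lemma localize_rep A g u : measurable A -> subgroup_on mu act A g ->
  localize (~` A) (pi g u) = localize (~` A) u.
Proof.
move=> mA Ag; apply/L2_eqP.
have fixg : {ae mu, forall x, ~ A x -> act g x = x}.
  exists (supp act g `\` A); split => //.
    by apply: measurableD => //; apply: measurableC; exact: (measurable_Fix lebX pmp).
  by move=> x /= /not_implyP[nAx gx]; split.
apply: filterS3 (filterI (localizeE (pi g u) (measurableC mA)) (localizeE u (measurableC mA)))
  (repE g u) (ae_orbit_measure_fst countG lebX pmp fixg) => -[x y] [-> ->] -> /= fx.
rewrite indicE; have [nAx|_] := boolP (x \in ~` A); last by rewrite !mul0r.
rewrite inE in nAx; have e := fx nAx.
by rewrite /translate /= -{1}e (actK pmp).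
Qed.

Lemma localize_average A a u : measurable A ->
  averages [set pi g | g in subgroup_on mu act A] a ->
  localize (~` A) (a u) = localize (~` A) u.
Proof.
move=> mA; have ll := localize_linear (measurableC mA) (countG := countG) (lebX := lebX) (pmp := pmp).
elim=> [//|_ b [g Ag <-] _ /= IH|b c _ IHb _ IHc].
  by rewrite localize_rep.
by rewrite (linZ ll) (linD ll) IHb IHc half_add.
Qed.

(** The fixed vector produced by the mean ergodic theorem vanishes over A, and it agrees with
    u off A because all the averages of u do. *)
Lemma average_to_localizeC A u : measurable A ->
  {ae mu, forall x, A x -> infinite_set [set act g x | g in subgroup_on mu act A]} ->
  (forall g, subgroup_on mu act A g -> pi g (localize (~` A) u) = localize (~` A) u) /\
  forall e : R, 0 < e -> exists2 a, averages [set pi g | g in subgroup_on mu act A] a &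
    hnorm (a u - localize (~` A) u) < e.
Proof.
move=> mA infA.
have [|v fixv av] := mean_ergodic
  (Gam := [set pi g | g in subgroup_on mu act A]) u (@L2_complete _ _ _ nu).
  by move=> _ [g _ <-]; split=> [|w]; [exact: rep_linear|rewrite rep_hnorm].
suff -> : localize (~` A) u = v.
  by split => // g Ag; apply: fixv; exists g.
have vA : localize (~` A) v = v.
  rewrite localizeC// (fixed_vector_vanishes mA infA) ?subr0// => g Ag.
  by apply: fixv; exists g.
have ll := localize_linear (measurableC mA) (countG := countG) (lebX := lebX) (pmp := pmp).
apply: (@hnorm_eq _ _ dot) => e /av[a Ka]; rewrite -{2}vA -(localize_average u mA Ka) -(linB ll).
by apply: le_lt_trans; exact: localize_hnorm.
Qed.

Lemma approximableC A : measurable A -> approximable A -> approximable (~` A).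
Proof.
move=> mA aA u v e e0; have [s [su sv]] := aA u v e e0.
exists (one_seq ++ scale_seq (-1) s).
have h w : op (one_seq ++ scale_seq (-1) s) w - localize (~` A) w = - (op s w - localize A w).
  by rewrite op_cat op_one op_scale scaleN1r localizeC// !opprB addrC addrA subrK.
by rewrite !h !hnorm_opp.
Qed.

(** Average u first, by a, and then the average of v, by b. The second step does no harm to u:
    the limit 1_(~A) u is fixed by b, and b is a contraction. *)
Lemma approximable_generator A : measurable A ->
  {ae mu, forall x, A x -> infinite_set [set act g x | g in subgroup_on mu act A]} ->
  approximable A.
Proof.
move=> mA infA; rewrite -[A]setCK; apply: approximableC; first exact: measurableC.
move=> u v e e0.
have [fixu au] := average_to_localizeC u mA infA.
have [a Ka ua] := au e e0.
have [_ av] := average_to_localizeC (a v) mA infA.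
have [b Kb vb] := av e e0.
have [s bas] := averages_op (averages_comp Kb Ka).
exists s; rewrite -bas /=; split.
  rewrite -[X in b (a u) - X](averages_fixed _ Kb); last by move=> _ [g Ag <-]; exact: fixu.
  rewrite -(linB (averages_linear Kb)).
  by apply: le_lt_trans ua; exact: averages_hnorm Kb.
by rewrite -(localize_average v mA Ka).
Qed.

(** Approximate the outer projection first: its approximant t is a bounded operator, which
    determines how well the inner one has to be approximated. *)
Lemma approximableI A A' : measurable A -> measurable A' ->
  approximable A -> approximable A' -> approximable (A `&` A').
Proof.
move=> mA mA' aA aA' u v e e0; have e2 : 0 < e / 2 by rewrite divr_gt0.
have [t [tu tv]] := aA (localize A' u) (localize A' v) _ e2.
have [M M0 tM] := op_bounded t.
have [s [su sv]] := aA' u v (e / 2 / M) ltac:(by rewrite divr_gt0).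
exists (mul_seq t s).
have h w : hnorm (op t (localize A' w) - localize A (localize A' w)) < e / 2 ->
    hnorm (op s w - localize A' w) < e / 2 / M ->
    hnorm (op (mul_seq t s) w - localize (A `&` A') w) < e.
  move=> h1 h2; rewrite op_mul -localizeI//.
  apply: le_lt_trans (hnorm_dist _ _ (op t (localize A' w)) _) _.
  rewrite [e]splitr ltrD// -(linB (op_linear t)).
  apply: le_lt_trans (tM _) _.
  by rewrite mulrC -ltr_pdivlMr.
by split; exact: h.
Qed.

Lemma approximableU A A' : measurable A -> measurable A' ->
  approximable A -> approximable A' -> approximable (A `|` A').
Proof.
move=> mA mA' aA aA'; rewrite -[_ `|` _]setCK setCU.
apply: approximableC; first by apply: measurableI; exact: measurableC.
by apply: approximableI; try exact: measurableC; exact: approximableC.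
Qed.

Lemma localize_null A u : measurable A -> mu A = 0%E -> localize A u = 0.
Proof.
move=> mA A0; rewrite -(localize0 u); apply/L2_eqP.
have nA : {ae mu, forall x, ~ A x} by exists A; split => // x /contrapT.
apply: filterS3 (localizeE u mA) (localizeE u measurable0) (ae_orbit_measure_fst countG lebX pmp nA).
by move=> p -> -> np; rewrite !indicE memNset// in_set0.
Qed.

Lemma approximable_null A : measurable A -> mu A = 0%E -> approximable A.
Proof.
move=> mA A0 u v e e0; exists [::].
by split; rewrite localize_null// /op big_nil subrr hnorm_zero.
Qed.

Lemma localizeD A A' u : measurable A -> measurable A' -> A' `<=` A ->
  localize (A `\` A') u = localize A u - localize A' u.
Proof.
move=> mA mA' A'A; rewrite setDE -(localizeI u mA (measurableC mA')).
by rewrite localizeC// (linB (localize_linear mA)) localizeI// (setIidr A'A).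
Qed.

Lemma localize_bigcup (F : nat -> set X) u : (forall n, measurable (F n)) ->
  forall e : R, 0 < e -> exists N, forall n, (N <= n)%N ->
    hnorm (localize (\big[setU/set0]_(i < n) F i) u - localize (\bigcup_i F i) u) < e.
Proof.
move=> mF e e0.
have mU n : measurable (\big[setU/set0]_(i < n) F i) by exact: bigsetU_measurable.
have mB : measurable (\bigcup_i F i) by exact: bigcupT_measurable.
have sub n : \big[setU/set0]_(i < n) F i `<=` \bigcup_i F i.
  by move=> x; rewrite -bigcup_mkord => -[i _ Fi]; exists i.
have [|N NP] := @localize_small _ _ _ _ _ _ countG lebX pmp
  (fun n => (\bigcup_i F i) `\` \big[setU/set0]_(i < n) F i) u
  (fun n => measurableD mB (mU n)) _ e e0.
  move=> x; have [[i _ Fi]|nF] := pselect ((\bigcup_i F i) x); last by exists 0%N => n _ [].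
  exists i.+1 => n ni [_]; apply; rewrite -bigcup_mkord; exists i => //.
exists N => n /NP; rewrite localizeD// => h.
by rewrite hnormC.
Qed.

Lemma approximable_bigcup (F : nat -> set X) : (forall n, measurable (F n)) ->
  (forall n, approximable (F n)) -> approximable (\bigcup_i F i).
Proof.
move=> mF aF.
have aU n : approximable (\big[setU/set0]_(i < n) F i).
  elim: n => [|n IH]; first by rewrite big_ord0; apply: approximable_null; rewrite ?measure0.
  by rewrite big_ord_recr /=; apply: approximableU => //; exact: bigsetU_measurable.
move=> u v e e0; have e2 : 0 < e / 2 by rewrite divr_gt0.
have [N1 h1] := localize_bigcup u mF e2; have [N2 h2] := localize_bigcup v mF e2.
have [s [su sv]] := aU (maxn N1 N2) u v _ e2.
exists s; split; rewrite [e]splitr.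
  apply: le_lt_trans (hnorm_dist _ _ (localize (\big[setU/set0]_(i < maxn N1 N2) F i) u) _) _.
  by rewrite ltrD// h1// leq_maxl.
apply: le_lt_trans (hnorm_dist _ _ (localize (\big[setU/set0]_(i < maxn N1 N2) F i) v) _) _.
by rewrite ltrD// h2// leq_maxr.
Qed.

Theorem measurable_approximable : perfectly_nonfree mu act ->
  forall A, measurable A -> approximable A.
Proof.
move=> [AA [mAA gAA infAA]].
suff : <<s AA `|` [set N | measurable N /\ mu N = 0%E] >> `<=`
    [set A | measurable A /\ approximable A].
  by rewrite gAA => h A /h[].
apply: smallest_sub.
  split.
  - by split => //; apply: approximable_null; rewrite ?measure0.
  - move=> A [mA aA]; rewrite setTD.
    by split; [exact: measurableC|exact: approximableC].
  - move=> F hF; split; first by apply: bigcupT_measurable => n; have [] := hF n.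
    by apply: approximable_bigcup => n; have [] := hF n.
move=> A [AAA|[mA A0]]; split; rewrite //; first exact: mAA.
- by apply: approximable_generator; [exact: mAA|exact: infAA].
- exact: approximable_null.
Qed.

End approximation.

(** * The commutant and the algebra of the relation *)

Section bounded_operators.
Context (R : realType) (H : lmodType R[i]) (dot : {dot H for Num.conj}).

Lemma bounded_operator_hnorm (A : H -> H) : bounded_operator dot A ->
  linear A /\ exists2 M : R, 0 < M & forall u, hnorm dot (A u) <= M * hnorm dot u.
Proof.
move=> [lA [c hc]]; split=> //; exists (1 + Num.sqrt `|c|).
  by rewrite ltr_pwDl ?sqrtr_ge0.
move=> u; have := hc u; rewrite !dot_sqnorm -rmorphM lecR => h.
apply: (@le_trans _ _ (Num.sqrt `|c| * hnorm dot u)); last first.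
  by rewrite ler_wpM2r ?hnorm_ge0// lerDr.
rewrite /hnorm -sqrtrM ?normr_ge0//; apply: ler_wsqrtr; apply: le_trans h _.
by rewrite ler_wpM2r ?sqnorm_ge0// ler_norm.
Qed.

Lemma hnorm_bounded_operator (A : H -> H) (M : R) : linear A -> 0 <= M ->
  (forall u, hnorm dot (A u) <= M * hnorm dot u) -> bounded_operator dot A.
Proof.
move=> lA M0 h; split=> //; exists (M ^+ 2) => u.
rewrite !dot_sqnorm -rmorphM lecR -!hnorm2 -exprMn.
by rewrite ler_pXn2r ?nnegrE ?mulr_ge0 ?hnorm_ge0.
Qed.

End bounded_operators.

Section relation_algebra.
Context d (X : measurableType d) (R : realType) (mu : probability X R).
Context (G : groupType) (act : G -> X -> X).
Context (countG : countable [set: G]) (lebX : lebesgue_space mu).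
Context (pmp : pmp_action mu act) (pnf : perfectly_nonfree mu act).
Local Notation C := R[i].
Local Notation nu := (orbit_measure countG lebX pmp).
Local Notation dot := (@L2dot _ _ _ nu).
Local Notation pi := (groupoid_rep countG lebX pmp).
Local Notation hnorm := (hnorm dot).
Local Notation localize := (@localize _ _ _ _ _ _ countG lebX pmp).
Implicit Types (g h : G) (y : X) (u v w : L2 nu) (A : set X).
Implicit Types (T : L2 nu -> L2 nu).

(** An approximation s of 1_A commutes with T, and it is close to 1_A on u and on T u. *)
Lemma commute_localize T A u : commutant dot (range pi) T -> measurable A ->
  T (localize A u) = localize A (T u).
Proof.
move=> [/bounded_operator_hnorm[lT [M M0 TM]] Tpi] mA.
have Top s w : T (op s w) = op s (T w).
  rewrite /op (lin_sum lT); apply: eq_bigr => p _; rewrite (linZ lT); congr (_ *: _).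
  exact: (congr1 (fun f => f w) (Tpi (pi p.2) (ex_intro2 _ _ p.2 I erefl))).
apply: (@hnorm_eq _ _ dot) => e e0; have e2 : 0 < e / 2 by rewrite divr_gt0.
have d0 : 0 < Num.min (e / 2) (e / 2 / M) by rewrite lt_min e2 divr_gt0.
have [s [su sv]] := measurable_approximable pnf mA u (T u) d0.
move: su sv; rewrite !lt_min => /andP[_ su] /andP[sv _].
apply: le_lt_trans (hnorm_dist _ _ (op s (T u)) _) _.
rewrite [e]splitr ltrD// -Top -(linB lT); apply: le_lt_trans (TM _) _.
by rewrite mulrC -ltr_pdivlMr// hnormC.
Qed.

(** The sum counts the positive integers up to x, so it is the integer part of x. *)
Lemma staircase (N : nat) (x : R) : 0 <= x -> x <= N%:R ->
  `|\sum_(k < N) (k.+1%:R <= x)%R%:R - x| <= 1.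
Proof.
elim: N => [|N IH] x0 xN.
  by rewrite big_ord0 (_ : x = 0) ?subrr ?normr0//; apply/eqP; rewrite eq_le xN.
rewrite big_ord_recr /=; have [xle|xgt] := leP x N%:R.
  rewrite (_ : (N.+1%:R <= x) = false) ?addr0; first exact: IH.
  by apply/negbTE; rewrite -ltNge (le_lt_trans xle)// ltr_nat.
rewrite (eq_bigr (fun=> 1)); last first.
  by move=> k _; rewrite (le_trans _ (ltW xgt))// ler_nat.
rewrite sumr_const card_ord.
by case: (N.+1%:R <= x); rewrite ler_norml /=; move: xN xgt; rewrite -natr1;
  move: (N%:R : R) => n *; apply/andP; split; lra.
Qed.

Lemma normc_le (z : C) : Normc.normc z <= `|complex.Re z| + `|complex.Im z|.
Proof.
rewrite -(@ler_pXn2r _ 2)// ?nnegrE ?normc_ge0 ?addr_ge0//.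
rewrite -[leLHS]/(sqnormc z) sqnormcE sqrrD !real_normK ?num_real//.
by rewrite lerD2r lerDl mulrn_wge0// mulr_ge0.
Qed.

Lemma L2_sumE (N : nat) (F : nat -> L2 nu) :
  {ae nu, forall p, (\sum_(k < N) F k : L2 nu) p = \sum_(k < N) F k p}.
Proof.
elim: N => [|N IH].
  apply: filterS (L2classE (square_integrable0 nu)) => p h.
  by rewrite !big_ord0; exact: h.
rewrite big_ord_recr /=.
apply: filterS2 IH (L2_addrE (\sum_(k < N) F k) (F N)) => p h ->.
by rewrite h big_ord_recr.
Qed.

Definition stairs (n : nat) (f : X -> R) (k : nat) : set X :=
  [set x | k.+1%:R <= n.+1%:R * f x].

Lemma measurable_stairs n f k : measurable_fun setT f -> measurable (stairs n f k).
Proof.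
move=> mf; have m : measurable_fun setT (fun x => n.+1%:R * f x).
  by apply: measurable_funM => //; exact: measurable_cst.
rewrite (_ : stairs _ _ _ = (fun x => n.+1%:R * f x) @^-1` `[k.+1%:R, +oo[%classic).
  by rewrite -[X in measurable X]setTI; apply: m => //; exact: measurable_itv.
by apply/seteqP; split=> p /=; rewrite /stairs /= in_itv /= andbT.
Qed.

Definition stairs_op n N f u : L2 nu :=
  (n.+1%:R^-1 : R)%:C%C *: \sum_(k < N) localize (stairs n f k) u.

Lemma stairs_opE n N f u : measurable_fun setT f ->
  {ae nu, forall p, stairs_op n N f u p =
    (n.+1%:R^-1 * \sum_(k < N) (k.+1%:R <= n.+1%:R * f p.1)%R%:R)%:C%C * u p}.
Proof.
move=> mf; have h : {ae nu, forall p, forall k, localize (stairs n f k) u p =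
    (\1_(stairs n f k) p.1)%:C%C * u p}.
  by apply/ae_foralln => k; apply: localizeE; exact: measurable_stairs.
apply: filterS3 h (L2_sumE N (fun k => localize (stairs n f k) u))
  (L2_scalerE (n.+1%:R^-1 : R)%:C%C (\sum_(k < N) localize (stairs n f k) u)).
move=> p h1 h2 h3; rewrite [LHS]h3 h2 rmorphM /= -mulrA; congr (_ * _).
rewrite rmorph_sum /= mulr_suml; apply: eq_bigr => k _; rewrite h1; congr (_%:C%C * _).
rewrite indicE; congr (_%:R); congr nat_of_bool; apply/idP/idP; rewrite inE //.
Qed.

Lemma stairs_op_commute T n N f u : commutant dot (range pi) T -> measurable_fun setT f ->
  T (stairs_op n N f u) = stairs_op n N f (T u).
Proof.
move=> cT mf; have [/bounded_operator_hnorm[lT _] _] := cT.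
rewrite /stairs_op (linZ lT) (lin_sum lT); congr (_ *: _).
by apply: eq_bigr => k _; rewrite commute_localize//; exact: measurable_stairs.
Qed.

(** Shifting by a constant makes the real and imaginary parts nonnegative, so that they are
    uniform limits of finite sums of indicators. *)
Lemma Linfty_approx m (hm : Linfty mu m) (e : R) : 0 < e ->
  exists F : L2 nu -> L2 nu,
    (forall u, hnorm (F u - mult_op countG lebX pmp hm u) <= e * hnorm u) /\
    forall T u, commutant dot (range pi) T -> T (F u) = F (T u).
Proof.
move=> e0; have [[mr mi] [c0 mc0]] := hm.
pose c := `|c0|.
have mc : {ae mu, forall x, Normc.normc (m x) <= c}.
  by apply: filterS mc0 => x /le_trans; apply; exact: ler_norm.
pose n := Num.Def.archi_bound (2 / e).
have ne : 2 * n.+1%:R^-1 <= e.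
  have := archi_boundP (ltW (divr_gt0 (ltr0n R 2) e0) : 0 <= 2 / e); rewrite -/n.
  rewrite ltr_pdivrMr// => h; rewrite ler_pdivrMr//.
  by apply: le_trans (ltW h) _; rewrite mulrC ler_wpM2l ?(ltW e0)// ler_nat.
have c00 : 0 <= c by exact: normr_ge0.
have c2 : 0 <= n.+1%:R * (c + c) by rewrite mulr_ge0// addr_ge0.
pose N := Num.Def.archi_bound (n.+1%:R * (c + c)).
have nN := ltW (archi_boundP c2); rewrite -/N in nN.
pose fr x := complex.Re (m x) + c; pose fi x := complex.Im (m x) + c.
have mfr : measurable_fun setT fr by apply: measurable_funD => //; exact: measurable_cst.
have mfi : measurable_fun setT fi by apply: measurable_funD => //; exact: measurable_cst.
pose z : C := Complex (- c) (- c).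
exists (fun u => stairs_op n N fr u + ('i%C *: stairs_op n N fi u + z *: u)); split; last first.
  move=> T u cT; have [/bounded_operator_hnorm[lT _] _] := cT.
  by rewrite (linD lT) (linD lT) (linZ lT 'i%C) (linZ lT z) !(stairs_op_commute _ _ _ cT).
move=> u; apply: hnorm_le_ae; first exact: ltW.
set a := stairs_op n N fr u; set b := stairs_op n N fi u.
apply: filterS3 (filterI (filterI (L2_subrE (a + ('i%C *: b + z *: u)) (mult_op countG lebX pmp hm u))
   (L2_addrE a ('i%C *: b + z *: u)))
   (filterI (L2_addrE ('i%C *: b) (z *: u)) (mult_opE hm u)))
  (filterI (filterI (L2_scalerE 'i%C b) (L2_scalerE z u))
    (filterI (stairs_opE n N u mfr) (stairs_opE n N u mfi)))
  (ae_orbit_measure_fst countG lebX pmp mc) => p.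
move=> [[h1 h2] [h3 h4]] [[h5 h6] [h7 h8]] mp.
rewrite h1 h2 h3 h4 h5 h6 h7 h8.
set sr := _ * \sum_(k < N) _; set si := _ * \sum_(k < N) _.
rewrite !mulrA -!mulrDl -mulrBl Normc.normcM ler_wpM2r ?normc_ge0//.
apply: le_trans ne.
have close (t : R) : `|t| <= c ->
    `|n.+1%:R^-1 * \sum_(k < N) (k.+1%:R <= n.+1%:R * (t + c))%R%:R - (t + c)| <= n.+1%:R^-1.
  rewrite ler_norml => /andP[t1 t2].
  have t0 : 0 <= n.+1%:R * (t + c) by rewrite mulr_ge0//; lra.
  have tN : n.+1%:R * (t + c) <= N%:R.
    by apply: le_trans nN; rewrite ler_wpM2l// lerD2r.
  have := staircase t0 tN; set S := \sum_(k < N) _ => h.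
  have n0 : (n.+1%:R : R) != 0 by rewrite pnatr_eq0.
  have -> : n.+1%:R^-1 * S - (t + c) = n.+1%:R^-1 * (S - n.+1%:R * (t + c)).
    by rewrite mulrBr mulrA mulVf// mul1r.
  by rewrite normrM ger0_norm ?invr_ge0// -[leRHS]mulr1 ler_wpM2l ?invr_ge0.
have normRe : `|complex.Re (m p.1)| <= c.
  apply: le_trans mp; rewrite -(@ler_pXn2r _ 2)// ?nnegrE ?normc_ge0//.
  exact: sqr_normr_Re.
have normIm : `|complex.Im (m p.1)| <= c.
  apply: le_trans mp; rewrite -(@ler_pXn2r _ 2)// ?nnegrE ?normc_ge0//.
  exact: sqr_normr_Im.
have hr := close _ normRe; have hi := close _ normIm.
apply: le_trans (normc_le _) _.
rewrite (_ : complex.Re _ = sr - fr p.1); last first.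
  by rewrite /fr /z; case: (m p.1) => a' b' /=; lra.
rewrite (_ : complex.Im _ = si - fi p.1); last first.
  by rewrite /fi /z; case: (m p.1) => a' b' /=; lra.
by rewrite mulr_natl mulr2n lerD.
Qed.

Theorem commute_Linfty T m (hm : Linfty mu m) u : commutant dot (range pi) T ->
  T (mult_op countG lebX pmp hm u) = mult_op countG lebX pmp hm (T u).
Proof.
move=> cT; have [/bounded_operator_hnorm[lT [M M0 TM]] _] := cT.
apply: (@hnorm_eq _ _ dot) => e e0.
(* The accuracy e / q absorbs both error terms; the summand 1 makes q positive. *)
pose q := M * hnorm u + hnorm (T u) + 1.
have q0 : 0 < q by rewrite ltr_wpDl// addr_ge0 ?mulr_ge0 ?hnorm_ge0// ltW.
have [F [Fm FT]] := Linfty_approx hm (divr_gt0 e0 q0).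
apply: le_lt_trans (hnorm_dist _ _ (F (T u)) _) _.
have -> : T (mult_op countG lebX pmp hm u) - F (T u) = T (mult_op countG lebX pmp hm u - F u).
  by rewrite (linB lT) (FT _ _ cT).
have h1 := TM (mult_op countG lebX pmp hm u - F u); have h2 := Fm (T u).
have h3 := Fm u; rewrite hnormC in h3.
have h4 : M * hnorm (mult_op countG lebX pmp hm u - F u) <= M * (e / q * hnorm u).
  by rewrite ler_wpM2l ?(ltW M0).
apply: (@lt_le_trans _ _ (e / q * q)); last by rewrite mulfVK ?gt_eqF.
have eq0 : 0 < e / q by rewrite divr_gt0.
rewrite {2}/q; move: h1 h2 h4 eq0; clear.
move: (hnorm (T (_ - _))) (hnorm (F _ - _)) (hnorm (T u)) (hnorm (_ - _)) (hnorm u) (e / q).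
by move=> *; lra.
Qed.

(** A von Neumann algebra containing pi(G) equals its bicommutant, so it contains every bounded
    operator that commutes with the commutant of pi(G). *)
Theorem relation_vN_groupoid : relation_vN countG lebX pmp = groupoid_vN countG lebX pmp.
Proof.
apply/seteqP; split.
  move=> T hT M [vM piM]; apply: hT; split=> //.
  move=> S [|[m [hm ->]]]; first by apply.
  rewrite -(vN_bicommutant vM); split.
    have [_ [c mc]] := hm.
    apply: (@hnorm_bounded_operator _ _ dot _ `|c|); [exact: mult_op_linear|by []|].
    move=> u; apply: mult_op_hnorm => //.
    by apply: filterS mc => x /le_trans; apply; exact: ler_norm.
  move=> T' [bT' cT']; apply/funext => u /=; apply/esym/commute_Linfty; split=> //.
  by move=> B /piM; exact: cT'.
move=> T hT M [vM sM]; apply: hT; split=> //.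
move=> B [g _ <-]; apply: sM; left => N [_ piN]; apply: piN.
by exists g.
Qed.

End relation_algebra.

(** * Invariant densities of an ergodic action *)

Section ergodic.
Context d (X : measurableType d) (R : realType) (mu : probability X R).
Context (G : groupType) (act : G -> X -> X).
Context (countG : countable [set: G]) (pmp : pmp_action mu act).
Context (erg : ergodic_action mu act).

Lemma Rintegral_const_fun (c : R) : \int[mu]_x c = c.
Proof. by rewrite Rintegral_cst// [X in fine X](probability_setT mu) mulr1. Qed.

(** A function above its mean differs from it by a nonnegative function of integral 0. *)
Lemma ge_mean_ae_eq (f : X -> R) : mu.-integrable setT (EFin \o f) ->
  {ae mu, forall x, \int[mu]_x f x <= f x} -> {ae mu, forall x, f x = \int[mu]_x f x}.
Proof.
move=> intf; set c := \int[mu]_x f x => fc.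
have mf : measurable_fun setT f by apply/measurable_EFinP; exact: measurable_int intf.
have intc : mu.-integrable setT (EFin \o cst c) by exact: finite_measure_integrable_cst.
have h : \int[mu]_x (f x - c) = 0 by rewrite RintegralB// Rintegral_const_fun subrr.
have intB : mu.-integrable setT (EFin \o (fun x => f x - c)).
  rewrite (_ : EFin \o _ = (EFin \o f) \- (EFin \o cst c))%E; first exact: integrableB.
  by apply/funext => x /=; rewrite EFinB.
have h0 : (\int[mu]_x `|(f x - c)%:E| = 0)%E.
  rewrite (_ : 0%E = (\int[mu]_x (f x - c)%:E)%E); last first.
    rewrite -[RHS]fineK ?(integrable_fin_num _ intB)//.
    by rewrite -[fine _]/(\int[mu]_x (f x - c)) h.
  apply: ae_eq_integral => //.
  - by apply: measurableT_comp => //; exact: measurable_int intB.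
  - exact: measurable_int intB.
  - by apply: filterS fc => x fc _; rewrite gee0_abs// lee_fin subr_ge0.
have /(ae_eq_integral_abs mu measurableT) := h0.
move=> /(_ (measurable_int _ intB)); apply: filterS => x /(_ I) [] /eqP.
by rewrite subr_eq0 => /eqP.
Qed.

(** A density of an invariant measure is almost everywhere invariant, so its superlevel set at
    the mean is null or conull. In both cases the function lies almost everywhere on one side
    of its mean, hence is equal to it. *)
Lemma invariant_density_const (f : X -> R) : mu.-integrable setT (EFin \o f) ->
  (forall g B, measurable B ->
    (\int[mu]_(x in act g @^-1` B) (f x)%:E = \int[mu]_(x in B) (f x)%:E)%E) ->
  {ae mu, forall x, f x = \int[mu]_x f x}.
Proof.
move=> intf invf; set c := \int[mu]_x f x.
have mf : measurable_fun setT f by apply/measurable_EFinP; exact: measurable_int intf.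
have mg g : measurable_fun setT (act g) by exact: (act_measurable pmp).
have mfg g : measurable_fun setT (fun x => f (act g x)) by exact: measurableT_comp.
have aeg g : {ae mu, forall x, f x = f (act g x)}.
  have pushE B : (\int[pushforward mu (act g)]_(x in B) (f x)%:E =
     \int[mu]_(x in B) (f x)%:E)%E.
    apply: eq_measure_integral => B' mB' _; rewrite /pushforward.
    exact: (act_preserving pmp).
  have ifg B : measurable B -> mu.-integrable (act g @^-1` B) ((EFin \o f) \o act g).
    move=> mB; have mgB : measurable (act g @^-1` B) by rewrite -[X in measurable X]setTI; exact: mg.
    apply: (@integrableS _ _ _ _ setT) => //.
    apply/integrableP; split; first exact/measurable_EFinP.
    have /integrableP[_] := intf; apply: le_lt_trans.
    have mabs : measurable_fun setT (fun x => `|(f x)%:E|%E).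
      by apply: (measurableT_comp (f := abse)) => //; exact/measurable_EFinP.
    have abs0 : {in [set: X], forall x, (0 <= `|(f x)%:E|)%E} by [].
    rewrite -[leLHS](ge0_integral_pushforward (mg g) mu measurableT mabs abs0).
    rewrite le_eqVlt; apply/orP; left; apply/eqP; apply: eq_measure_integral => B' mB' _.
    exact: (act_preserving pmp).
  suff : ae_eq mu setT (EFin \o f) ((EFin \o f) \o act g).
    by apply: filterS => x /(_ I) [].
  apply: integral_ae_eq => //; first exact/measurable_EFinP.
  move=> B _ mB; pose D := act g^-1%g @^-1` B.
  have BE : B = act g @^-1` D.
    by apply/seteqP; split=> x; rewrite /D /preimage /= (actK pmp).
  have mD : measurable D by rewrite -[X in measurable X]setTI; exact: (act_measurable pmp).
  rewrite {2}BE -integral_pushforward//; last 2 first.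
    exact/measurable_EFinP.
    exact: ifg.
  by rewrite pushE -(invf g D mD) -BE.
have [e eP] := surjective_enum countG.
pose Y := [set x | forall g, c < f (act g x)].
have mY : measurable Y.
  rewrite (_ : Y = \bigcap_n (fun x => f (act (e n) x)) @^-1` `]c, +oo[%classic).
    apply: bigcapT_measurable => n; rewrite -[X in measurable X]setTI.
    by apply: mfg => //; exact: measurable_itv.
  apply/seteqP; split=> x /= h; first by move=> n _; rewrite /= in_itv /= andbT.
  by move=> g; have [n <-] := eP g; have := h n I; rewrite /= in_itv /= andbT.
have invY g : act g @^-1` Y = Y.
  apply/seteqP; split=> x /= h k; last by rewrite -(actM pmp).
  by have := h (k * g^-1)%g; rewrite (actM pmp) (actK pmp).
have aeall := ae_forall_group countG aeg.
have [Y0|Y1] := erg mY invY.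
  have aeN : {ae mu, forall x, - c <= - f x}.
    have aeY : {ae mu, forall x, ~ Y x} by exists Y; split => // x /contrapT.
    apply: filterS2 aeY aeall => x nY hx; rewrite lerN2 leNgt; apply/negP => cx.
    by apply: nY => g; rewrite -hx.
  have intN : mu.-integrable setT (EFin \o (fun x => - f x)).
    by apply: integrableN intf.
  have cN : \int[mu]_x (- f x) = - c.
    transitivity (\int[mu]_x (-1 * f x)); first by apply: eq_Rintegral => x _; rewrite mulN1r.
    by rewrite RintegralZl// mulN1r.
  have := ge_mean_ae_eq intN; rewrite cN => /(_ aeN).
  by apply: filterS => x /oppr_inj.
apply: ge_mean_ae_eq => //.
have aeY : {ae mu, forall x, Y x}.
  exists (~` Y); split => //; first exact: measurableC.
  by rewrite [LHS](probability_setC mu mY) Y1 subee.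
apply: filterS aeY => x /(_ 1%g); rewrite (act1 pmp); exact: ltW.
Qed.

Lemma invariant_density_integral (f : X -> R) B : mu.-integrable setT (EFin \o f) ->
  (forall g B, measurable B ->
    (\int[mu]_(x in act g @^-1` B) (f x)%:E = \int[mu]_(x in B) (f x)%:E)%E) ->
  measurable B -> \int[mu]_(x in B) f x = (\int[mu]_x f x) * fine (mu B).
Proof.
move=> intf invf mB; rewrite -Rintegral_cst//; congr fine.
apply: ae_eq_integral => //.
- by apply: measurable_funTS; exact: measurable_int intf.
- apply: filterS (invariant_density_const intf invf) => x h _.
  by rewrite [in LHS]h.
Qed.

End ergodic.

(** * The diagonal vector *)

Section isometries.
Context (R : realType) (H : lmodType R[i]) (dot : {dot H for Num.conj}).

(** Polarization. *)
Lemma dot_isometry (f : H -> H) u v : linear f ->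
  (forall w, hnorm dot (f w) = hnorm dot w) -> dot (f u) (f v) = dot u v.
Proof.
move=> lf hf.
have sf w : sqnorm dot (f w) = sqnorm dot w by rewrite -!hnorm2 hf.
have Ref x y : complex.Re (dot (f x) (f y)) = complex.Re (dot x y).
  have := sf (x + y); rewrite (linD lf) !sqnormD !sf => h.
  by apply: (@mulfI _ 2) => //; move/addrI: h.
apply/eqP; rewrite eq_complex Ref eqxx /=; apply/eqP.
have := Ref ((- 'i)%C *: u) v; rewrite (linZ lf) !dotZl.
case: (dot (f u) (f v)) => a b; case: (dot u v) => a' b' /=.
lra.
Qed.

Lemma dot_close (k u v : H) : Normc.normc (dot u k - dot v k) <= hnorm dot (u - v) * hnorm dot k.
Proof. by rewrite -dotBl; exact: cauchy_schwarz. Qed.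

End isometries.

Section diagonal.
Context d (X : measurableType d) (R : realType) (mu : probability X R).
Context (G : groupType) (act : G -> X -> X).
Context (countG : countable [set: G]) (lebX : lebesgue_space mu).
Context (pmp : pmp_action mu act).
Context (E : set X) (m : X -> R) (sep : separator mu E m).
Local Notation C := R[i].
Local Notation nu := (orbit_measure countG lebX pmp).
Local Notation dot := (@L2dot _ _ _ nu).
Local Notation pi := (groupoid_rep countG lebX pmp).
Local Notation hnorm := (hnorm dot).
Local Notation localize := (@localize _ _ _ _ _ _ countG lebX pmp).
Local Notation graph := (graph act).
Local Notation diag y := (graph 1%g y).
Implicit Types (g h : G) (y : X) (u v w : L2 nu) (A : set X).

Definition sep_diagonal : set (X * X) := [set p | [/\ E p.1, E p.2 & m p.1 = m p.2]].

Lemma measurable_sep_diagonal : measurable sep_diagonal.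
Proof.
have [mE E1 mm minj] := sep.
rewrite (_ : sep_diagonal = (E `*` E) `&` [set p : X * X | m p.1 - m p.2 = 0]).
  apply: measurableI; first exact: measurableX.
  have mF : measurable_fun setT (fun p : X * X => m p.1 - m p.2).
    apply: measurable_funB; first exact: (measurableT_comp mm measurable_fst).
    exact: (measurableT_comp mm measurable_snd).
  by rewrite -[X in measurable X]setTI; exact: (mF measurableT [set 0] (measurable_set1 0)).
apply/seteqP; split=> [[x y] [/= Ex Ey e]|[x y] [[/= Ex Ey] e]].
  by split => //=; rewrite e subrr.
by split => //; apply/eqP; rewrite -subr_eq0 e.
Qed.

Lemma sep_diagonalE p : sep_diagonal p -> p = diag p.2 /\ E p.2.
Proof.
case: p => x y [/= Ex Ey e]; rewrite /graph (act1 pmp); split => //.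
by congr pair; apply: (sep_inj sep); rewrite ?inE.
Qed.

Lemma diag_sep_diagonal y : sep_diagonal (diag y) <-> E y.
Proof. by rewrite /graph (act1 pmp); split=> [[]|Ey]. Qed.

Lemma orbit_measure_diagonal B : measurable B -> B `<=` sep_diagonal ->
  nu B = mu (graph 1%g @^-1` B).
Proof.
move=> mB BD; apply: orbit_measure_graph => // y p [[Bp _] [_ /= py]].
by have [-> _] := sep_diagonalE (BD _ Bp); rewrite py.
Qed.

Definition xi_fun (p : X * X) : C := (\1_sep_diagonal p)%:C%C.

Lemma xi_fun_square_integrable : square_integrable nu xi_fun.
Proof.
have mD := measurable_sep_diagonal.
split; first by split => /=; [exact: measurable_indic|exact: measurable_cst].
under eq_integral => p _.
  rewrite (_ : sqnormc (xi_fun p) = \1_sep_diagonal p); last first.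
    rewrite sqnormcE /xi_fun /= indicE; case: (p \in _); rewrite ?expr0n ?expr1n ?addr0 //.
  over.
rewrite integral_indic// setIT.
apply: (@le_lt_trans _ _ 1%E); last by rewrite ltry.
apply: le_trans (probability_le1 mu (measurable_graph_preimage pmp 1%g mD)).
by rewrite le_eqVlt; apply/orP; left; apply/eqP; exact: orbit_measure_diagonal.
Qed.

Definition xi : L2 nu := L2class xi_fun_square_integrable.

Lemma xiE : {ae nu, forall p, xi p = xi_fun p}.
Proof. exact: L2classE. Qed.

Lemma xi_fun_graph h : {ae mu, forall y, xi_fun (graph h y) = (\1_(Fix act h) y)%:C%C}.
Proof.
apply: filterS2 (sep_ae sep) (ae_act pmp h (sep_ae sep)) => y Ey Ehy.
rewrite /xi_fun !indicE; congr (_%:R%:C%C); congr nat_of_bool; apply/idP/idP; rewrite !inE.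
  by move=> /sep_diagonalE[[e] _]; rewrite /Fix /= e (act1 pmp).
by move=> e; split => //=; rewrite e.
Qed.

(** On the diagonal nu is the image of mu. *)
Lemma integral_diagonal (f : X * X -> R) : measurable_fun setT f ->
  nu.-integrable setT (fun p => (\1_sep_diagonal p * f p)%:E) ->
  mu.-integrable setT (fun y => (\1_E y * f (diag y))%:E) /\
  \int[nu]_p (\1_sep_diagonal p * f p) = \int[mu]_y (\1_E y * f (diag y)).
Proof.
move=> mf intf; have mD := measurable_sep_diagonal; have mE := sep_measurable sep.
have mg := measurable_graph pmp 1%g.
have preD : graph 1%g @^-1` sep_diagonal = E.
  by apply/seteqP; split=> y /diag_sep_diagonal.
have resD (D : set (X * X)) (h : X * X -> R) :
    (fun p => (\1_D p * h p)%:E) = (EFin \o h) \_ D.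
  apply/funext => p; rewrite patchE indicE; case: (p \in D); rewrite ?mul1r ?mul0r//.
have resE (D : set X) (h : X -> R) : (fun p => (\1_D p * h p)%:E) = (EFin \o h) \_ D.
  apply/funext => p; rewrite patchE indicE; case: (p \in D); rewrite ?mul1r ?mul0r//.
have pushE (h : X * X -> \bar R) : (\int[nu]_(p in sep_diagonal) h p =
    \int[pushforward mu (graph 1%g)]_(p in sep_diagonal) h p)%E.
  by apply: eq_measure_integral => B mB BD; exact: orbit_measure_diagonal.
have iD : nu.-integrable sep_diagonal (EFin \o f).
  by apply/(integrable_mkcond _ mD); rewrite -resD.
have mfg : measurable_fun setT (f \o graph 1%g) by exact: measurableT_comp.
have iE : mu.-integrable E ((EFin \o f) \o graph 1%g).
  apply/integrableP; split.
    by apply: measurable_funTS; exact/measurable_EFinP.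
  have /integrableP[_] := iD; apply: le_lt_trans.
  rewrite pushE ge0_integral_pushforward//; first by rewrite preD.
  by apply: (measurableT_comp (f := abse)) => //; apply: measurable_funTS; exact/measurable_EFinP.
split; first by rewrite resE; exact/(integrable_mkcond _ mE).
rewrite /Rintegral resD -integral_mkcond pushE integral_pushforward//; last 2 first.
- exact/measurable_EFinP.
- by rewrite preD.
by rewrite preD resE -integral_mkcond.
Qed.

(** The diagonal has finite measure and t <= 1 + t^2. *)
Lemma integrable_diagonal_part w (f : X * X -> R) : measurable_fun setT f ->
  (forall p, `|f p| ^+ 2 <= sqnormc (w p)) ->
  nu.-integrable setT (fun p => (\1_sep_diagonal p * f p)%:E).
Proof.
move=> mf fw; have mD := measurable_sep_diagonal; have [mw iw] := L2P w.
have iD : nu.-integrable setT (fun p => (\1_sep_diagonal p : R)%:E).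
  apply/integrableP; split; first by apply/measurable_EFinP; exact: measurable_indic.
  under eq_integral do rewrite gee0_abs ?lee_fin//.
  rewrite integral_indic// setIT.
  apply: (@le_lt_trans _ _ 1%E); last by rewrite ltry.
  apply: le_trans (probability_le1 mu (measurable_graph_preimage pmp 1%g mD)).
  by rewrite le_eqVlt; apply/orP; left; apply/eqP; exact: orbit_measure_diagonal.
have iW : nu.-integrable setT (fun p => (sqnormc (w p))%:E).
  apply/integrableP; split; first exact: measurable_sqnormc.
  by under eq_integral do rewrite gee0_abs ?lee_fin ?sqr_ge0//.
apply: le_integrable (integrableD measurableT iD iW) => //.
  by apply/measurable_EFinP/measurable_funM => //; exact: measurable_indic.
move=> p _; rewrite -EFinD !abse_EFin lee_fin.
have s0 := sqnormc_ge0 (w p).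
rewrite [leRHS]ger0_norm ?addr_ge0// normrM indicE.
case: (p \in _); rewrite /= ?normr1 ?normr0 ?mul1r ?mul0r; last by rewrite add0r.
have := fw p; move: (`|f p|) => t h; have := sqr_ge0 (t - 1).
by rewrite sqrrB; lra.
Qed.

Lemma dot_localize_xi A w : measurable A ->
  let fr y := \1_E y * complex.Re (w (diag y)) in
  let fi y := \1_E y * complex.Im (w (diag y)) in
  [/\ mu.-integrable setT (EFin \o fr), mu.-integrable setT (EFin \o fi) &
  dot (localize A xi) w =
  Complex (\int[mu]_(y in A) fr y) (- \int[mu]_(y in A) fi y)].
Proof.
move=> mA fr fi; have [[mr mi] _] := L2P w; have mD := measurable_sep_diagonal.
have mI : measurable_fun setT (fun p : X * X => \1_A p.1 : R).
  have mA1 : measurable_fun setT (\1_A : X -> R) by exact: measurable_indic.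
  exact: (measurableT_comp mA1 measurable_fst).
have [ifr _] := integral_diagonal mr (integrable_diagonal_part mr (fun p => sqr_normr_Re _)).
have [ifi _] := integral_diagonal mi (integrable_diagonal_part mi (fun p => sqr_normr_Im _)).
have main (q : C -> R) : measurable_fun setT (fun p => q (w p)) ->
    (forall z, `|q z| ^+ 2 <= sqnormc z) ->
    \int[nu]_p (\1_sep_diagonal p * (\1_A p.1 * q (w p))) =
    \int[mu]_(y in A) (\1_E y * q (w (diag y))).
  move=> mq qle.
  have mqA : measurable_fun setT (fun p : X * X => \1_A p.1 * q (w p)) by exact: measurable_funM.
  rewrite (integral_diagonal mqA (integrable_diagonal_part (w := w) mqA _)).2; last first.
    move=> p; apply: le_trans (qle (w p)); rewrite ler_pXn2r ?nnegrE// normrM.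
    by rewrite -[leRHS]mul1r ler_wpM2r// indicE; case: (_ \in _); rewrite ?normr1 ?normr0.
  rewrite [RHS]Rintegral_mkcond; apply: eq_Rintegral => y _.
  have -> : \1_A (diag y).1 = (y \in A)%:R :> R by rewrite /graph /= (act1 pmp) indicE.
  by rewrite patchE; case: (y \in A); rewrite ?mul1r// mul0r mulr0.
split => //.
have [[mlr mli] _] := L2P (localize A xi).
have mdot : measurable_funC (fun p => localize A xi p * (w p)^*).
  by apply: measurable_funCM => //; exact: measurable_funC_conj.
have aeq : {ae nu, forall p, localize A xi p * (w p)^* =
    Complex (\1_sep_diagonal p * (\1_A p.1 * complex.Re (w p)))
            (- (\1_sep_diagonal p * (\1_A p.1 * complex.Im (w p))))}.
  apply: filterS2 (localizeE xi mA) xiE => p -> ->.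
  rewrite /xi_fun; case: (w p) => a b; apply/eqP; rewrite eq_complex /=.
  by apply/andP; split; apply/eqP; ring.
rewrite /= /L2dot /integralC -!main//; last 2 first.
- exact: sqr_normr_Im.
- exact: sqr_normr_Re.
have mR : measurable_fun setT (fun p : X * X => \1_sep_diagonal p * (\1_A p.1 * complex.Re (w p))).
  by apply: measurable_funM; [exact: measurable_indic|exact: measurable_funM].
have mM : measurable_fun setT (fun p : X * X => \1_sep_diagonal p * (\1_A p.1 * complex.Im (w p))).
  by apply: measurable_funM; [exact: measurable_indic|exact: measurable_funM].
have [mdr mdi] := mdot.
congr Complex.
  congr fine; apply: ae_eq_integral => //; try exact/measurable_EFinP.
  by apply: filterS aeq => p /= ->.
rewrite -[RHS]mulN1r -RintegralZl//; last first.
  apply: (integrable_diagonal_part (w := w)); first exact: measurable_funM.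
  move=> p; apply: le_trans (sqr_normr_Im (w p)); rewrite ler_pXn2r ?nnegrE// normrM.
  by rewrite -[leRHS]mul1r ler_wpM2r// indicE; case: (_ \in _); rewrite ?normr1 ?normr0.
congr fine; apply: ae_eq_integral => //; try exact/measurable_EFinP.
  by apply/measurable_EFinP/measurable_funM => //; exact: measurable_cst.
by apply: filterS aeq => p /= ->; rewrite mulN1r.
Qed.

(** This exhibits the function mu(Fix g) as the positive definite function of the vector xi. *)
Lemma dot_rep_xi g h : dot (pi g xi) (pi h xi) = fix_character mu act (h^-1 * g)%g.
Proof.
rewrite -(dot_isometry _ _ (rep_linear h^-1%g)); last exact: rep_hnorm.
rewrite -!repM mulVg rep1.
set k := (h^-1 * g)%g.
have mE := sep_measurable sep.
have mF := measurable_Fix lebX pmp k.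
transitivity ((dot (localize setT xi) (pi k xi))^*); first by rewrite localizeT; exact: (dotC dot).
have [_ _ ->] := dot_localize_xi (pi k xi) (@measurableT _ X).
have aek : {ae mu, forall y, pi k xi (diag y) = (\1_(Fix act k) y)%:C%C}.
  apply: filterS3 (ae_graph 1%g (repE k xi)) (ae_graph k^-1%g xiE) (xi_fun_graph k^-1%g).
  move=> y -> h1 h2.
  have -> : translate act k (diag y) = graph k^-1%g y by rewrite /translate /graph /= (act1 pmp).
  rewrite h1 h2 !indicE; congr (_%:R%:C%C); congr nat_of_bool.
  apply/idP/idP; rewrite !inE /Fix /= => e.
    by rewrite -{1}e (actKV pmp).
  by rewrite -{1}e (actK pmp).
have [[mr mi] _] := L2P (pi k xi); have mg := measurable_graph pmp 1%g.
have mrg : measurable_fun setT (fun y => complex.Re (pi k xi (diag y))).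
  exact: (measurableT_comp mr mg).
have mig : measurable_fun setT (fun y => complex.Im (pi k xi (diag y))).
  exact: (measurableT_comp mi mg).
have mIE : measurable_fun setT (\1_E : X -> R) by exact: measurable_indic.
have -> : \int[mu]_y (\1_E y * complex.Re (pi k xi (diag y))) = fine (mu (Fix act k)).
  rewrite -[Fix act k in RHS]setIT -integral_indic//; congr fine; apply: ae_eq_integral => //.
  - by apply/measurable_EFinP/measurable_funM.
  - by apply/measurable_EFinP; exact: measurable_indic.
  - by apply: filterS2 (sep_ae sep) aek => y Ey -> _; rewrite indicE mem_set// mul1r.
have -> : \int[mu]_y (\1_E y * complex.Im (pi k xi (diag y))) = 0.
  rewrite -[RHS](Rintegral_const_fun mu 0).
  congr fine; apply: ae_eq_integral => //.
  - by apply/measurable_EFinP/measurable_funM.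
  - by apply: filterS aek => y -> _; rewrite mulr0.
by rewrite /fix_character; apply/eqP; rewrite eq_complex /= !oppr0 !eqxx.
Qed.

End diagonal.

(** * Characters as functionals on the group algebra *)

Section characters.
Context (R : realType) (G : groupType).
Local Notation C := R[i].
Implicit Types (s t : seq (C * G)) (chi : G -> C).

Definition ev chi s : C := \sum_(p <- s) p.1 * chi p.2.

Lemma ev_cat chi s t : ev chi (s ++ t) = ev chi s + ev chi t.
Proof. by rewrite /ev big_cat. Qed.

Lemma ev_scale chi c s : ev chi (scale_seq c s) = c * ev chi s.
Proof. by rewrite /ev big_map mulr_sumr; apply: eq_bigr => p _; rewrite mulrA. Qed.

Lemma ev_mulE chi s t :
  ev chi (mul_seq s t) = \sum_(p <- s) \sum_(q <- t) p.1 * q.1 * chi (p.2 * q.2)%g.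
Proof. by rewrite /ev big_allpairs_dep. Qed.

Lemma ev_mulC chi s t : (forall g h, chi (g * h)%g = chi (h * g)%g) ->
  ev chi (mul_seq s t) = ev chi (mul_seq t s).
Proof.
move=> chiC; rewrite !ev_mulE exchange_big /=.
by apply: eq_bigr => p _; apply: eq_bigr => q _; rewrite chiC [q.1 * _]mulrC.
Qed.

Definition star_seq s : seq (C * G) := [seq (p.1^*, p.2^-1%g) | p <- s].

Lemma ev_star_mulE chi s t : ev chi (mul_seq (star_seq s) t) =
  \sum_(p <- s) \sum_(q <- t) p.1^* * q.1 * chi (p.2^-1 * q.2)%g.
Proof. by rewrite ev_mulE big_map. Qed.

Lemma character_star_ge0 chi s : is_character chi -> 0 <= ev chi (mul_seq (star_seq s) s).
Proof.
move=> hchi; have := character_psd hchi (fun i : 'I_(size s) => (tnth (in_tuple s) i).2^-1%g).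
move=> /(_ (\row_i (tnth (in_tuple s) i).1^*)); rewrite ev_star_mulE.
congr (0 <= _); rewrite mxE exchange_big big_tnth; apply: eq_bigr => j _.
rewrite !mxE mulr_suml big_tnth; apply: eq_bigr => i _.
by rewrite !mxE conjCK invgK mulrAC.
Qed.

(** The values at z = 1 and z = i force e' to be the conjugate of e; the bound is the value at
    z = - e. *)
Lemma quadratic_bound (e e' p : C) : 0 <= p ->
  (forall z : C, 0 <= z^* * z + z^* * e + z * e' + p) -> sqnormc e <= complex.Re p.
Proof.
move=> p0 h; have := h 1; have := h 'i%C; have := h (- e).
move: p0; rewrite sqnormcE; case: e h => a b h; case: e' h => a' b' h; case: p h => q r h.
rewrite !lecE /= => /andP[/eqP -> q0] /andP[/eqP h1 h2] /andP[/eqP h3 _] /andP[/eqP h4 _].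
have e1 : b' = - b by move: h4; lra.
have e2 : a' = a by move: h3; lra.
by move: h2; rewrite e1 e2; nra.
Qed.

(** Positivity on z 1 + s for all complex z. *)
Lemma character_cauchy_schwarz chi s : is_character chi ->
  sqnormc (ev chi s) <= complex.Re (ev chi (mul_seq (star_seq s) s)).
Proof.
move=> hchi; apply: (quadratic_bound (e' := ev chi (star_seq s))).
  exact: character_star_ge0.
move=> z; have := character_star_ge0 ((z, 1%g) :: s) hchi.
congr (0 <= _); rewrite ev_star_mulE !big_cons /= invg1 mulg1 (character1 hchi) mulr1.
rewrite -!addrA; congr (_ + _).
rewrite {1}/ev mulr_sumr /ev; congr (_ + _).
  by apply: eq_bigr => p _; rewrite mul1g mulrA.
under eq_bigr => p _ do rewrite big_cons /= mulg1.
rewrite big_split /= -ev_star_mulE; congr (_ + _).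
by rewrite big_map mulr_sumr; apply: eq_bigr => p _; rewrite mulrA [z * _]mulrC.
Qed.

End characters.

(** * Indecomposability of the character of fixed points *)

Section indecomposability.
Context d (X : measurableType d) (R : realType) (mu : probability X R).
Context (G : groupType) (act : G -> X -> X).
Context (countG : countable [set: G]) (lebX : lebesgue_space mu).
Context (pmp : pmp_action mu act) (erg : ergodic_action mu act).
Context (pnf : perfectly_nonfree mu act).
Context (E : set X) (m : X -> R) (sep : separator mu E m).
Local Notation C := R[i].
Local Notation nu := (orbit_measure countG lebX pmp).
Local Notation dot := (@L2dot _ _ _ nu).
Local Notation pi := (groupoid_rep countG lebX pmp).
Local Notation hnorm := (hnorm dot).
Local Notation localize := (@localize _ _ _ _ _ _ countG lebX pmp).
Local Notation op := (@op _ _ _ _ _ _ countG lebX pmp).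
Local Notation xi := (@xi _ _ _ _ _ _ countG lebX pmp _ _ sep).
Local Notation chi0 := (fix_character mu act).
Implicit Types (g h : G) (y : X) (u v w : L2 nu) (A B : set X) (s t : seq (C * G)).

Lemma dot_suml (I : Type) (r : seq I) (F : I -> L2 nu) w :
  dot (\sum_(i <- r) F i) w = \sum_(i <- r) dot (F i) w.
Proof.
elim: r => [|i r IH]; first by rewrite !big_nil; exact: linear0l.
by rewrite !big_cons -IH; exact: (dotDl dot).
Qed.

Lemma dot_sumr (I : Type) (r : seq I) (F : I -> L2 nu) w :
  dot w (\sum_(i <- r) F i) = \sum_(i <- r) dot w (F i).
Proof.
elim: r => [|i r IH]; first by rewrite !big_nil; exact: linear0r.
by rewrite !big_cons -IH; exact: (dotDr dot).
Qed.

Lemma L2dotZ (c c' : C) u v : dot (c *: u) (c' *: v) = c * c'^* * dot u v.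
Proof.
rewrite -mulrA; transitivity (c * dot u (c' *: v)); first exact: (dotZl dot).
by congr (_ * _); exact: (dotZr dot).
Qed.

Lemma L2dot_sqnorm u : dot u u = (sqnorm dot u)%:C%C.
Proof. exact: (dot_sqnorm dot). Qed.

Lemma op_xi_sqnorm s : (sqnorm dot (op s xi))%:C%C = ev chi0 (mul_seq (star_seq s) s).
Proof.
rewrite -L2dot_sqnorm ev_star_mulE exchange_big /= /op dot_suml.
apply: eq_bigr => q _; rewrite dot_sumr; apply: eq_bigr => p _.
by rewrite L2dotZ (dot_rep_xi countG lebX pmp sep) [q.1 * _]mulrC.
Qed.

Lemma fix_character_central g h : chi0 (g * h)%g = chi0 (h * g)%g.
Proof.
rewrite /fix_character -(act_preserving pmp h (measurable_Fix lebX pmp (h * g)%g)).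
congr (fine (mu _))%:C%C; apply/seteqP; split=> x; rewrite /Fix /= !(actM pmp) => e.
  by rewrite e.
by apply: (can_inj (actK pmp h)).
Qed.

Lemma fix_character_is_character : is_character chi0.
Proof.
split.
- exact: fix_character_central.
- move=> n gs v.
  pose w : L2 nu := \sum_(j < n) (v 0 j)^* *: pi (gs j)^-1%g xi.
  have := sqnorm_ge0 dot w; rewrite -ler0c -L2dot_sqnorm; congr (0 <= _).
  rewrite /w dot_suml !mxE; apply: eq_bigr => j _.
  rewrite dot_sumr !mxE mulr_suml; apply: eq_bigr => i _.
  rewrite L2dotZ (dot_rep_xi countG lebX pmp sep) !mxE conjCK invgK.
  by rewrite -mulrA mulrC.
- rewrite /fix_character (_ : Fix act 1%g = setT) ?[mu _](probability_setT mu)//.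
  by apply/seteqP; split=> // x _; exact: (act1 pmp).
Qed.

Section component.
Context (chi : G -> C) (hchi : is_character chi) (M : R).
Context (dom : forall s, Normc.normc (ev chi s) <= M * hnorm (op s xi)).

(** The bound makes s |-> chi(s) a bounded functional of s xi; in particular it depends on s xi
    only. *)
Lemma exists_density : exists k : L2 nu, forall s, ev chi s = dot (op s xi) k.
Proof.
have [|||k hk] := riesz_subspace (P := fun u c => exists2 s, u = op s xi & c = ev chi s)
  (M := M) (@L2_complete _ _ _ nu).
- by exists [::]; rewrite ?/op ?/ev big_nil.
- move=> c _ _ _ _ [s -> ->] [t -> ->]; exists (s ++ scale_seq c t).
    by rewrite op_cat op_scale.
  by rewrite ev_cat ev_scale.
- by move=> _ _ [s -> ->].
by exists k => s; apply: hk; exists s.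
Qed.

Context (k : L2 nu) (hk : forall s, ev chi s = dot (op s xi) k).
Local Notation L u := (dot u k).

(** L is continuous, so identities for L may be checked on approximations of both arguments. *)
Lemma L_eq u v : (forall e : R, 0 < e -> exists u' v', [/\ hnorm (u - u') < e,
  hnorm (v - v') < e & L u' = L v']) -> L u = L v.
Proof.
move=> h; apply/eqP; rewrite -subr_eq0; apply/eqP/Normc.eq0_normc/eqP.
rewrite eq_le normc_ge0 andbT leNgt; apply/negP; set r := Normc.normc _ => r0.
pose K := hnorm k + 1; have K0 : 0 < K by rewrite ltr_wpDl ?hnorm_ge0.
have [u' [v' [du dv e]]] := h (r / 2 / K) ltac:(by rewrite !divr_gt0).
have h1 := dot_close dot k u u'; have h2 := dot_close dot k v v'.
have rE : r <= Normc.normc (L u - L u') + Normc.normc (L v - L v').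
  rewrite [X in _ + X](_ : _ = Normc.normc (L v' - L v)); last first.
    by rewrite -opprB; case: (L v' - L v) => a b /=; rewrite !sqrrN.
  apply: le_trans (le_normcD _ _).
  by rewrite e addrA subrK.
have h3 : hnorm (u - u') * hnorm k < r / 2.
  apply: (@le_lt_trans _ _ (hnorm (u - u') * K)); first by rewrite ler_wpM2l ?hnorm_ge0// lerDl.
  by rewrite -ltr_pdivlMr.
have h4 : hnorm (v - v') * hnorm k < r / 2.
  apply: (@le_lt_trans _ _ (hnorm (v - v') * K)); first by rewrite ler_wpM2l ?hnorm_ge0// lerDl.
  by rewrite -ltr_pdivlMr.
have := le_lt_trans (le_trans rE (lerD h1 h2)) (ltrD h3 h4).
by rewrite -splitr ltxx.
Qed.

Lemma L_trace s t : L (op s (op t xi)) = L (op t (op s xi)).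
Proof. by rewrite -!op_mul -!hk; apply: ev_mulC; exact: (character_central hchi). Qed.

Lemma op1 g u : op [:: (1, g)] u = pi g u.
Proof. by rewrite /op big_seq1 scale1r. Qed.

(** With s and t approximating 1_B, both sides are close to chi(g s t) = chi(t g s). First s is
    chosen, good on xi and on 1_B xi, and then t, good on xi and on the vector pi(g) s xi that
    depends on s. *)
Lemma L_compress g B : measurable B ->
  L (pi g (localize B xi)) = L (localize B (pi g (localize B xi))).
Proof.
move=> mB; apply: L_eq => e e0.
have e2 : 0 < e / 2 by rewrite divr_gt0.
have [s [s1 s2]] := measurable_approximable pnf mB xi (localize B xi) e2.
have [M' M'0 sM] := op_bounded countG lebX pmp s.
pose f := Num.min (e / 2) (e / 2 / M').
have f0 : 0 < f by rewrite lt_min e2 divr_gt0.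
have [t [t1 t2]] := measurable_approximable pnf mB xi (pi g (op s xi)) f0.
move: t1 t2; rewrite !lt_min => /andP[_ t1] /andP[t2 _].
exists (pi g (op s (op t xi))), (op t (pi g (op s xi))); split.
- rewrite localizeI// setIid in s2; rewrite hnormC -(linB (rep_linear g)) rep_hnorm.
  apply: le_lt_trans (hnorm_dist _ _ (op s (localize B xi)) _) _.
  rewrite [e]splitr; apply: ltrD s2.
  rewrite -(linB (op_linear s)); apply: le_lt_trans (sM _) _.
  by rewrite mulrC -ltr_pdivlMr.
- rewrite hnormC; apply: le_lt_trans (hnorm_dist _ _ (localize B (pi g (op s xi))) _) _.
  rewrite [e]splitr ltrD// -(linB (localize_linear mB)).
  apply: le_lt_trans (localize_hnorm _ _) _.
  by rewrite -(linB (rep_linear g)) rep_hnorm.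
- by rewrite -!op1 -(op_mul _ s) L_trace op_mul.
Qed.

Lemma L_moved g B : measurable B -> (forall x, B x -> ~ B (act g x)) ->
  L (pi g (localize B xi)) = 0.
Proof.
move=> mB gB; rewrite L_compress// (_ : localize B _ = 0); first exact: linear0l.
rewrite -(localize0 (pi g (localize B xi))); apply/L2_eqP.
apply: filterS3 (filterI (localizeE (pi g (localize B xi)) mB)
    (localizeE (pi g (localize B xi)) measurable0))
  (repE g (localize B xi)) (ae_translate g (localizeE xi mB)) => p [-> ->] -> ->.
rewrite [in RHS]indicE in_set0 [RHS]mul0r mulrA -rmorphM.
have -> : \1_B p.1 * \1_B (translate act g p).1 = 0 :> R.
  rewrite !indicE; have [Bp|_] := boolP (p.1 \in B); last by rewrite mul0r.
  have [Bg|_] := boolP (_ \in B); last by rewrite mulr0.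
  by rewrite !inE in Bp Bg; have := gB _ Bg; rewrite /translate /= (actKV pmp).
by rewrite mul0r.
Qed.

Lemma LD u v : L (u + v) = L u + L v.
Proof. exact: (dotDl dot). Qed.

Lemma L_localizeU g B B' : measurable B -> measurable B' ->
  L (pi g (localize B xi)) = L (pi g (localize (B `&` B') xi)) + L (pi g (localize (B `\` B') xi)).
Proof.
move=> mB mB'; rewrite -LD -(linD (rep_linear g)).
have -> : B `\` B' = B `\` (B `&` B') by rewrite setDIr setDv set0U.
by rewrite (localizeD xi mB (measurableI _ _ mB mB') (@subIsetl _ _ _)) addrC subrK.
Qed.

(** The subsets of a finite union of the F n are cut into pieces contained in a single F n; a
    countable union is a limit of finite ones. *)
Lemma L_displaced g (F : nat -> set X) S : (forall n, measurable (F n)) ->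
  (forall n x, F n x -> ~ F n (act g x)) -> measurable S ->
  S `<=` \bigcup_n F n -> L (pi g (localize S xi)) = 0.
Proof.
move=> mF gF mS SF.
have fin n : forall B, measurable B -> B `<=` \big[setU/set0]_(i < n) F i ->
    L (pi g (localize B xi)) = 0.
  elim: n => [|n IH] B mB; first rewrite big_ord0 subset0 => ->.
    by rewrite localize0 (lin0 (rep_linear g)); exact: linear0l.
  rewrite big_ord_recr /= => BU; rewrite (L_localizeU g mB (mF n)).
  rewrite (L_moved (measurableI _ _ mB (mF n))); last by move=> x [_ /gF h] [_ /h].
  rewrite add0r; apply: IH; first exact: measurableD.
  by move=> x [/BU[]//].
rewrite -[RHS](linear0l dot k); apply: L_eq => e e0.
have mFS n : measurable (S `&` F n) by exact: measurableI.
have [N NP] := localize_bigcup (countG := countG) (lebX := lebX) (pmp := pmp) xi mFS e0.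
exists (pi g (localize (\big[setU/set0]_(i < N) (S `&` F i)) xi)), 0; split.
- rewrite -(linB (rep_linear g)) rep_hnorm hnormC.
  have -> : S = \bigcup_i (S `&` F i) by rewrite -setI_bigcupr (setIidl SF).
  by have := NP N (leqnn N); rewrite -setI_bigcupr (setIidl SF).
- by rewrite subrr hnorm_zero.
- rewrite (fin N); [by rewrite linear0l|exact: bigsetU_measurable|].
  move=> x; rewrite -(bigcup_mkord N (fun i => S `&` F i)) -bigcup_mkord => -[i iN [_ Fi]].
  by exists i.
Qed.

(** A point x with g x <> x satisfies m x < q < m (g x) or m (g x) < q < m x for some rational
    q, and each of these countably many conditions defines a set that g moves off itself. *)
Lemma L_fix g : L (pi g xi) = L (localize (Fix act g) xi).
Proof.
have mF := measurable_Fix lebX pmp g; have mS := measurableC mF.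
have [mE E1 mm minj] := sep.
have h := L_localizeU g (@measurableT _ X) mF.
rewrite localizeT setTI setTD in h; rewrite {}h.
have -> : pi g (localize (Fix act g) xi) = localize (Fix act g) xi.
  apply/L2_eqP; apply: filterS3 (localizeE xi mF) (repE g (localize (Fix act g) xi))
    (ae_translate g (localizeE xi mF)) => p -> -> ->.
  rewrite !indicE; have [Fp|nFp] := boolP (p.1 \in Fix act g).
    have e : translate act g p = p.
      rewrite inE /Fix /= in Fp; case: p Fp => x y /= e.
      by rewrite /translate /= -{1}e (actK pmp).
    by rewrite e mem_set//; rewrite inE in Fp.
  rewrite memNset ?mul0r// => Ft; move/negP: nFp; apply; rewrite inE.
  by move: Ft; rewrite /Fix /translate /= (actKV pmp) => h; rewrite [in LHS]h (actKV pmp).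
suff -> : L (pi g (localize (~` Fix act g) xi)) = 0 by rewrite addr0.
pose F n : set X := if unpickle n is Some (b, q) then
  if b : bool then [set x | m x < (ratr (q : rat) : R) /\ ratr q < m (act g x)]
  else [set x | m (act g x) < ratr q /\ ratr q < m x] else set0.
have mmg : measurable_fun setT (fun x => m (act g x)).
  exact: (measurableT_comp mm (act_measurable pmp g)).
have mlt (f1 : X -> R) c : measurable_fun setT f1 -> measurable [set x | f1 x < c].
  move=> mf1; rewrite (_ : mkset _ = f1 @^-1` `]-oo, c[%classic).
    by rewrite -[X in measurable X]setTI; apply: mf1 => //; exact: measurable_itv.
  by apply/seteqP; split=> x /=; rewrite in_itv.
have mgt (f1 : X -> R) c : measurable_fun setT f1 -> measurable [set x | c < f1 x].
  move=> mf1; rewrite (_ : mkset _ = f1 @^-1` `]c, +oo[%classic).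
    by rewrite -[X in measurable X]setTI; apply: mf1 => //; exact: measurable_itv.
  by apply/seteqP; split=> x /=; rewrite in_itv /= andbT.
have mFn n : measurable (F n).
  rewrite /F; case: (unpickle n) => [[[] q]|//]; apply: measurableI.
  - exact: mlt.
  - exact: mgt.
  - exact: mlt.
  - exact: mgt.
have gF n x : F n x -> ~ F n (act g x).
  by rewrite /F; case: (unpickle n) => [[[] q]|//] [h1 h2] [h3 h4];
    [have := lt_trans h3 h2|have := lt_trans h4 h1]; rewrite ltxx.
have mU : measurable (\bigcup_n F n) by exact: bigcupT_measurable.
rewrite (L_localizeU g mS mU) (L_displaced mFn gF); last 2 first.
- exact: measurableI.
- exact: subIsetr.
rewrite add0r (localize_null (A := _ `\` _)); [|exact: measurableD|].
  by rewrite (lin0 (rep_linear g)); exact: linear0l.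
have [N [mN N0 HN]] := filterI E1 (ae_act pmp g E1).
apply/eqP; rewrite eq_le measure_ge0 andbT -N0; apply: le_measure; rewrite ?inE//.
  exact: measurableD.
move=> x [nFx nUx]; apply: HN => -[Ex Egx]; apply: nUx.
have [lt|gt|eq] := ltgtP (m x) (m (act g x)).
- have [q] := rat_in_itvoo lt; rewrite in_itv /= => /andP[h1 h2].
  exists (pickle (true, q)); first exact: I.
  by rewrite /F pickleK.
- have [q] := rat_in_itvoo gt; rewrite in_itv /= => /andP[h1 h2].
  exists (pickle (false, q)); first exact: I.
  by rewrite /F pickleK.
- by case: nFx; rewrite /Fix /=; apply/esym/minj; rewrite ?inE.
Qed.

(** 1_(g^-1 B) is conjugate to 1_B under pi(g), and L is a trace. *)
Lemma L_invariant g B : measurable B ->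
  L (localize (act g @^-1` B) xi) = L (localize B xi).
Proof.
move=> mB; have mgB := measurable_act_preimage pmp g mB.
have -> : localize (act g @^-1` B) xi = pi g^-1%g (localize B (pi g xi)).
  apply/L2_eqP; have h := ae_translate g^-1%g (repE g xi).
  apply: filterS3 (localizeE xi mgB) (filterI h (repE g^-1%g (localize B (pi g xi))))
    (ae_translate g^-1%g (localizeE (pi g xi) mB)) => p -> [h1 ->] ->.
  rewrite h1 /translate /= invgK (actK pmp) -surjective_pairing.
  by rewrite !indicE; congr (_%:R%:C%C * _); congr nat_of_bool; apply/idP/idP; rewrite !inE.
apply: L_eq => e e0.
have [s [s1 s2]] := measurable_approximable pnf mB (pi g xi) xi e0.
exists (pi g^-1%g (op s (pi g xi))), (op s xi); split.
- by rewrite -(linB (rep_linear g^-1%g)) rep_hnorm hnormC.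
- by rewrite hnormC.
- rewrite -(op1 g^-1%g) -(op1 g xi) -(op_mul s) L_trace op_mul !op1.
  by rewrite -repM mulgV rep1.
Qed.

Lemma L_xi : L xi = 1.
Proof.
have := hk [:: (1, 1%g)]; rewrite op1 rep1 => <-.
by rewrite /ev big_seq1 mul1r (character1 hchi).
Qed.

(** The density of B |-> L(1_B xi) is the conjugate of k along the diagonal. *)
Lemma L_localize B : measurable B -> L (localize B xi) = (fine (mu B))%:C%C.
Proof.
move=> mB.
set fr := fun y => \1_E y * complex.Re (k (graph act 1%g y)).
set fi := fun y => \1_E y * complex.Im (k (graph act 1%g y)).
have LE A : measurable A -> [/\ mu.-integrable setT (EFin \o fr),
    mu.-integrable setT (EFin \o fi) & L (localize A xi) =
    Complex (\int[mu]_(y in A) fr y) (- \int[mu]_(y in A) fi y)].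
  exact: dot_localize_xi.
have [ifr ifi LB] := LE B mB.
have [_ _] := LE _ measurableT; rewrite localizeT L_xi => -[r1 i0].
have eR (f : X -> R) A A' : mu.-integrable setT (EFin \o f) -> measurable A -> measurable A' ->
    \int[mu]_(y in A) f y = \int[mu]_(y in A') f y ->
    (\int[mu]_(y in A) (f y)%:E = \int[mu]_(y in A') (f y)%:E)%E.
  move=> intf mA mA' h.
  have fA D : measurable D -> (\int[mu]_(y in D) (f y)%:E)%E \is a fin_num.
    by move=> mD; apply: integrable_fin_num => //; exact: integrableS intf.
  by rewrite -(fineK (fA _ mA)) -(fineK (fA _ mA')); congr EFin.
have invr g A : measurable A ->
    (\int[mu]_(x in act g @^-1` A) (fr x)%:E = \int[mu]_(x in A) (fr x)%:E)%E.
  move=> mA; have mgA := measurable_act_preimage pmp g mA.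
  apply: eR => //; have := L_invariant g mA.
  by have [_ _ ->] := LE _ mA; have [_ _ ->] := LE _ mgA => -[].
have invi g A : measurable A ->
    (\int[mu]_(x in act g @^-1` A) (fi x)%:E = \int[mu]_(x in A) (fi x)%:E)%E.
  move=> mA; have mgA := measurable_act_preimage pmp g mA.
  apply: eR => //; have := L_invariant g mA.
  by have [_ _ ->] := LE _ mA; have [_ _ ->] := LE _ mgA => -[_ /oppr_inj].
rewrite LB (invariant_density_integral countG pmp erg ifr invr mB).
rewrite (invariant_density_integral countG pmp erg ifi invi mB).
by rewrite -r1 mul1r -mulNr -i0 mul0r.
Qed.

Lemma component_eq g : chi g = chi0 g.
Proof.
have := hk [:: (1, g)]; rewrite op1 /ev big_seq1 mul1r => ->.
by rewrite L_fix L_localize//; exact: (measurable_Fix lebX pmp).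
Qed.

End component.

Lemma dominated_character_eq chi (a : R) : 0 < a -> is_character chi ->
  (forall s, a * complex.Re (ev chi (mul_seq (star_seq s) s)) <= sqnorm dot (op s xi)) ->
  chi = chi0.
Proof.
move=> a0 hchi dom; apply/funext => g.
have dom' s : Normc.normc (ev chi s) <= Num.sqrt a^-1 * hnorm (op s xi).
  rewrite -(@ler_pXn2r _ 2)// ?nnegrE ?normc_ge0 ?mulr_ge0 ?sqrtr_ge0 ?hnorm_ge0//.
  rewrite exprMn hnorm2 sqr_sqrtr ?invr_ge0 ?(ltW a0)// mulrC ler_pdivlMr//.
  apply: le_trans (dom s); rewrite mulrC ler_wpM2l ?(ltW a0)//.
  exact: character_cauchy_schwarz.
have [k hk] := exists_density dom'.
exact: (component_eq hchi hk).
Qed.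

(** Both components are dominated by a multiple of the character, so both are equal to it. *)
Theorem fix_character_indecomposable : indecomposable_character chi0.
Proof.
split; first exact: fix_character_is_character.
move=> [a [chi1 [chi2 [/andP[a0 a1] h1 h2 ne e]]]]; apply: ne.
have b0 : 0 < 1 - a by rewrite subr_gt0.
have evE s : complex.Re (ev chi0 s) =
    a * complex.Re (ev chi1 s) + (1 - a) * complex.Re (ev chi2 s).
  have -> : ev chi0 s = a%:C%C * ev chi1 s + (1 - a)%:C%C * ev chi2 s.
    rewrite /ev !mulr_sumr -big_split /=; apply: eq_bigr => p _.
    by rewrite e mulrDr !mulrA [p.1 * _]mulrC [p.1 * _]mulrC.
  by case: (ev chi1 s) => x y; case: (ev chi2 s) => z w /=; ring.
have Re_ge0 chi s : is_character chi -> 0 <= complex.Re (ev chi (mul_seq (star_seq s) s)).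
  by move=> /(character_star_ge0 s); case: (ev _ _) => x y; rewrite lecE => /andP[].
have sqE s : sqnorm dot (op s xi) = a * complex.Re (ev chi1 (mul_seq (star_seq s) s)) +
    (1 - a) * complex.Re (ev chi2 (mul_seq (star_seq s) s)).
  by rewrite -evE -op_xi_sqnorm.
have e1 : chi1 = chi0.
  apply: (dominated_character_eq a0 h1) => s.
  by rewrite sqE lerDl mulr_ge0 ?(ltW b0) ?Re_ge0.
have e2 : chi2 = chi0.
  apply: (dominated_character_eq b0 h2) => s.
  by rewrite sqE lerDr mulr_ge0 ?(ltW a0) ?Re_ge0.
by rewrite e1 e2.
Qed.

End indecomposability.

Theorem theorem13 (R : realType) (d : measure_display) (X : measurableType d)
    (mu : probability X R) (G : groupType) (act : G -> X -> X)
    (countG : countable [set: G]) (lebX : lebesgue_space mu)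
    (pmp : pmp_action mu act) (erg : ergodic_action mu act)
    (pnf : perfectly_nonfree mu act) :
  relation_vN countG lebX pmp = groupoid_vN countG lebX pmp /\
  indecomposable_character (fix_character mu act).
Proof.
split; first exact: relation_vN_groupoid.
have [E [m sep]] := exists_separator lebX.
exact: (fix_character_indecomposable countG lebX pmp erg pnf sep).
Qed.
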